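(* Let $n\ge 3$. For $(\alpha,\beta;\varpi;\lambda,\nu)\in\{\pm\}^2\times \mathrm{Irr}(SL(n-1,\mathbb R))_{\mathrm{fin}}\times\mathbb C^2$ the following three conditions are equivalent. (i) $\mathrm{Diff}_{G'}(I(\mathrm{triv},\lambda)^\alpha, J(\varpi,\nu)^\beta)\ne\{0\}$. (ii) $\dim \mathrm{Diff}_{G'}(I(\mathrm{triv},\lambda)^\alpha, J(\varpi,\nu)^\beta)=1$. (iii) $(\alpha,\beta;\varpi;\lambda,\nu)\in\Lambda_1\cup\Lambda_2$, where $$\Lambda_1=\{(\alpha,\alpha+m;\mathrm{triv};\lambda,\lambda+m):\alpha\in\{\pm\},\ \lambda\in\mathbb C,\ m\in\mathbb Z_{\ge0}\},$$ $$\Lambda_2=\{(\alpha,\alpha+m+\ell;\mathrm{poly}^\ell_{n-1};1-(m+\ell),1+\tfrac{\ell}{n-1}):\alpha\in\{\pm\},\ \ell,m\in\mathbb Z_{\ge0}\}.$$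
   Context: Groups: $G=SL(n+1,\mathbb R)$, $G'=\{\mathrm{diag}(g',1):g'\in SL(n,\mathbb R)\}\subset G$. With matrix units $E_{i,j}$ put $N_j^+=E_{1,j+1}$, $N_j^-=E_{j+1,1}$ ($1\le j\le n$), $\widetilde H_0=\frac1n\mathrm{diag}(n,-1,\dots,-1)$, $\widetilde H_0'=\frac1{n-1}\mathrm{diag}(n-1,-1,\dots,-1,0)$. Let $N_\pm=\exp(\mathrm{span}_{\mathbb R}\{N_1^\pm,\dots,N_n^\pm\})$, $N'_\pm=\exp(\mathrm{span}_{\mathbb R}\{N_1^\pm,\dots,N_{n-1}^\pm\})$, $A=\exp(\mathbb R\widetilde H_0)$, $A'=\exp(\mathbb R\widetilde H_0')$, $M=\{\mathrm{diag}(\det(g)^{-1},g):g\in SL^\pm(n,\mathbb R)\}$, $M'=\{\mathrm{diag}(\det(g')^{-1},g',1):g'\in SL^\pm(n-1,\mathbb R)\}$, where $SL^\pm(k,\mathbb R)$ is the group of real $k\times k$ matrices of determinant $\pm1$. Then $P=MAN_+$ and $P'=M'A'N_+'$ are parabolic subgroups with $G/P\simeq\mathbb{RP}^n$, $G'/P'\simeq\mathbb{RP}^{n-1}$, $P'\subset P$. Signs: $\{\pm\}$ is identified with $\{\pm1\}$; for $\delta\in\{\pm\}$ and $k\in\mathbb Z_{\ge0}$, $\delta+k$ denotes the sign $\delta\cdot(-1)^k$. Representations: $\mathrm{Irr}(\cdot)_{\mathrm{fin}}$ is the set of equivalence classes of finite-dimensional irreducible complex representations. For $\lambda,\nu\in\mathbb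 C$, $\mathbb C_\lambda$ is the character $\exp(t\widetilde H_0)\mapsto e^{\lambda t}$ of $A$ and $\mathbb C_\nu$ the character $\exp(t\widetilde H_0')\mapsto e^{\nu t}$ of $A'$. $\mathrm{sgn}^+=1$, $\mathrm{sgn}^-=\mathrm{sgn}(\det)$ on $SL^\pm$. Elements of $\mathrm{Irr}(M')_{\mathrm{fin}}$, $M'\simeq SL^\pm(n-1,\mathbb R)$, are written $\mathrm{sgn}^\beta\otimes\varpi$ with $\varpi\in\mathrm{Irr}(SL(n-1,\mathbb R))_{\mathrm{fin}}$ (extended to $SL^\pm(n-1,\mathbb R)$); similarly for $M$. $\mathrm{poly}^\ell_{k}$ is the representation on homogeneous degree-$\ell$ polynomials on $\mathbb C^k$, extended to $SL^\pm(k,\mathbb R)$ by $(g\cdot p)(v)=p(g^{-1}v)$. $I(\xi,\lambda)^\alpha=\mathrm{Ind}_P^G((\mathrm{sgn}^\alpha\otimes\xi)\boxtimes\mathbb C_\lambda)$ and $J(\varpi,\nu)^\beta=\mathrm{Ind}_{P'}^{G'}((\mathrm{sgn}^\beta\otimes\varpi)\boxtimes\mathbb C_\nu)$ are the unnormalized smooth induced representations ($N_+,N_+'$ acting trivially), e.g. $\mathrm{Ind}_P^G(\sigma)=\{f\in C^\infty(G,V):f(gp)=\sigma(p)^{-1}f(g)\ \forall p\in P\}$ with left translation; they are realized on smooth sections of homogeneous bundles over $G/P$ and $G'/P'$. $\mathrm{Diff}_{G'}(I,J)$ is the space of $G'$-intertwining differential operators $\mathbb D:I\to J$ (differential symmetry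 breaking operators), where, for the inclusion $\iota:G'/P'\hookrightarrow G/P$, a continuous linear map $\mathbb D$ between spaces of smooth sections is a differential operator if $\iota(\mathrm{Supp}(\mathbb Df))\subset\mathrm{Supp}(f)$ for all sections $f$ (equivalently, locally it is a matrix of partial differential operators followed by restriction to $G'/P'$). *)

(* Defs.v *)
From HB Require Import structures.
From mathcomp Require Import all_boot all_order all_fingroup all_algebra.
From mathcomp Require Import all_classical all_reals all_analysis.
From mathcomp Require Import complex.
From mathcomp Require mpoly.

Set Implicit Arguments.
Unset Strict Implicit.
Unset Printing Implicit Defensive.

Import Order.TTheory GRing.Theory Num.Theory.
Import numFieldNormedType.Exports.

Local Open Scope classical_set_scope.
Local Open Scope ring_scope.
Local Open Scope complex_scope.

Section SpecialLinear.
Variables (R : realType) (k : nat).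

Definition SLpred : {pred 'M[R]_k} := [pred g | \det g == 1].
Definition SLpmpred : {pred 'M[R]_k} := [pred g | `|\det g| == 1].

Record SL := MkSL { SLval :> 'M[R]_k; SLvalP : SLval \in SLpred }.

HB.instance Definition _ := [isSub for SLval].
HB.instance Definition _ := [Choice of SL by <:].

Lemma SL_det (g : SL) : \det (val g) = 1.
Proof. by apply/eqP; exact: (valP g). Qed.

Lemma SL_unit (g : SL) : val g \in unitmx.
Proof. by rewrite unitmxE SL_det unitr1. Qed.

Fact SL_oneP : 1%:M \in SLpred. Proof. by rewrite inE det1. Qed.
Fact SL_mulP (g h : SL) : val g *m val h \in SLpred.
Proof. by rewrite inE det_mulmx !SL_det mul1r. Qed.
Fact SL_invP (g : SL) : invmx (val g) \in SLpred.
Proof. by rewrite inE det_inv SL_det invr1. Qed.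

Let one := MkSL SL_oneP.
Let mul (g h : SL) := MkSL (SL_mulP g h).
Let inv (g : SL) := MkSL (SL_invP g).

Let mulA : associative mul.
Proof. by move=> x y z; apply/val_inj; rewrite /= mulmxA. Qed.
Let mul1 : left_id one mul.
Proof. by move=> x; apply/val_inj; rewrite /= mul1mx. Qed.
Let mulr1 : right_id one mul.
Proof. by move=> x; apply/val_inj; rewrite /= mulmx1. Qed.
Let mulV : left_inverse one inv mul.
Proof. by move=> x; apply/val_inj; rewrite /= mulVmx ?SL_unit. Qed.
Let mulrV : right_inverse one inv mul.
Proof. by move=> x; apply/val_inj; rewrite /= mulmxV ?SL_unit. Qed.

HB.instance Definition _ := isGroup.Build SL mulA mul1 mulr1 mulV mulrV.

HB.instance Definition _ := Topological.copy SL (initial_topology (@SLval)).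

Lemma SL_valM (g h : SL) : val (g * h)%g = val g *m val h. Proof. by []. Qed.
Lemma SL_valV (g : SL) : val (g^-1)%g = invmx (val g). Proof. by []. Qed.

End SpecialLinear.

(* The inclusion g' |-> diag(g', 1) of SL(k, R) into SL(k + 1, R). *)
Section Embedding.
Variables (R : realType) (k : nat).

Definition diag1_mx (g : 'M[R]_k) : 'M[R]_k.+1 :=
  castmx (addn1 k, addn1 k) (block_mx g 0 0 1%:M).

Fact diag1_subproof (g : SL R k) : diag1_mx (val g) \in @SLpred R k.+1.
Proof.
have det_cast m m' (e : m = m') (A : 'M[R]_m) : \det (castmx (e, e) A) = \det A.
  by case: m' / e; rewrite castmx_id.
by rewrite inE det_cast det_ublock SL_det det1 mulr1.
Qed.

Definition diag1 (g : SL R k) : SL R k.+1 := MkSL (diag1_subproof g).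

End Embedding.

Section Continuity.
Variable R : realType.

Lemma sum_continuous (V : normedModType R) (T : topologicalType)
    (I : finType) (F : I -> T -> V) :
  (forall i, continuous (F i)) -> continuous (fun x => \sum_i F i x).
Proof.
move=> cF.
have := @continuous_big V I +%R 0 xpredT (@add_continuous V) T (index_enum I) F.
by apply=> i _.
Qed.

Lemma prod_continuous (T : topologicalType)
    (I : finType) (F : I -> T -> R) :
  (forall i, continuous (F i)) -> continuous (fun x => \prod_i F i x).
Proof.
move=> cF.
have := @continuous_big R I *%R 1 xpredT (@mul_continuous R) T (index_enum I) F.
by apply=> i _.
Qed.

Lemma det_continuous (k : nat) :
  continuous (fun x : 'M[R]_k => \det x).
Proof.
have := @sum_continuous R^o 'M[R]_k {perm 'I_k}
  (fun s x => (-1) ^+ s * \prod_i x i (s i)).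
apply=> s x.
have cp := @prod_continuous _ _ (fun i (y : 'M[R]_k) => y i (s i))
  (fun i => @coord_continuous R k k i (s i)).
have cc : (fun=> (-1) ^+ s : R) @ x --> ((-1) ^+ s : R) 
  by exact: cst_continuous.
exact: (cvgM cc (cp x)).
Qed.

Lemma mulmx_continuous (k : nat) (A : 'M[R]_k) :
  continuous (mulmx A : 'M[R]_k -> 'M[R]_k).
Proof.
rewrite (_ : mulmx A =
    fun y : 'M[R]_k => \sum_i \sum_j y i j *: (A *m delta_mx i j)).
  apply: sum_continuous => i; apply: sum_continuous => j x.
  have cc : (fun=> A *m delta_mx i j) @ x --> A *m delta_mx i j.
    exact: cst_continuous.
  exact: (cvgZ (@coord_continuous R k k i j x) cc).
apply/funext => y; rewrite [in LHS](matrix_sum_delta y) mulmx_sumr.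
apply: eq_bigr => i _; rewrite mulmx_sumr; apply: eq_bigr => j _.
by rewrite scalemxAr.
Qed.

End Continuity.

Section Smooth.
Variable R : realType.

Fixpoint iterD (V : normedModType R) (w : seq V) (F : V -> R) : V -> R :=
  if w is v :: w' then 'D_v (iterD w' F) else F.

(* F is C^oo on the open set U: all iterated directional derivatives exist and
   are continuous on U. *)
Definition smooth_on (V : normedModType R) (U : set V) (F : V -> R) : Prop :=
  forall (w : seq V) (x : V), U x ->
    {for x, continuous (iterD w F)} /\ forall v, derivable (iterD w F) x v.

(* Real part (b = false) or imaginary part (b = true). *)
Definition reim (b : bool) (z : R[i]) : R :=
  if b then complex.Im z else complex.Re z.

Definition GLset (k : nat) : set 'M[R]_k := [set x | \det x != 0].

Lemma open_GLset k : open (@GLset k).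
Proof.
rewrite (_ : @GLset k = (fun x => \det x) @^-1` [set r : R | r != 0]) //.
apply: open_comp => [x _|]; first exact: det_continuous.
exact: open_neq.
Qed.

(* The smooth retraction of the open set GL(q + 1, R) of matrix space onto
   SL(q + 1, R): the first column is divided by the determinant. *)
Definition sl_retract (q : nat) (x : 'M[R]_q.+1) : 'M[R]_q.+1 :=
  x *m diag_mx (\row_j (if j == ord0 then (\det x)^-1 else 1)).

(* f o sl_retract, which restricts to f on SL(q + 1, R); the value outside
   GL(q + 1, R) is irrelevant. *)
Definition gl_ext (q d : nat) (f : SL R q.+1 -> 'cV[R[i]]_d) (x : 'M[R]_q.+1) :
    'cV[R[i]]_d :=
  if insub (sl_retract x) is Some g then f g else 0.

Definition gl_comp (q d : nat) (f : SL R q.+1 -> 'cV[R[i]]_d) (i : 'I_d)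
    (b : bool) (x : 'M[R]_q.+1) : R :=
  reim b (gl_ext f x i ord0).

(* As sl_retract is a smooth retraction, f is C^oo on the closed submanifold
   SL(q + 1, R) iff f o sl_retract is C^oo on the open set GL(q + 1, R). *)
Definition smooth (q d : nat) (f : SL R q.+1 -> 'cV[R[i]]_d) : Prop :=
  forall i b, smooth_on (@GLset q.+1) (gl_comp f i b).

(* The sets of those f all of whose partial derivatives of order at most N are
   smaller than e on K, for K compact, N in nat and e > 0, are a basis of
   neighbourhoods of 0 for the usual Frechet topology of
   C^oo(SL(q + 1, R), C^d). *)
Definition Cinfty_nbhs0 (q d : nat) (K : set 'M[R]_q.+1) (N : nat) (e : R) :
    set (SL R q.+1 -> 'cV[R[i]]_d) :=
  [set f | forall x, K x -> forall w : seq ('I_q.+1 * 'I_q.+1),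
    (size w <= N)%N -> forall i b,
    `|iterD [seq delta_mx ij.1 ij.2 | ij <- w] (gl_comp f i b) x| < e].

End Smooth.

Section SmoothClosed.
Variable R : realType.

Lemma iterD_lin (V : normedModType R) (U : set V) (F G : V -> R) (a b : R) :
  open U -> smooth_on U F -> smooth_on U G -> forall w x, U x ->
  iterD w (fun y => a * F y + b * G y) x = a * iterD w F x + b * iterD w G x.
Proof.
move=> oU sF sG; elim=> [//|v w IH] x Ux /=.
have [_ dF] := sF w x Ux; have [_ dG] := sG w x Ux.
rewrite (@near_eq_derive _ _ _ _ (a *: iterD w F + b *: iterD w G)); last first.
  have : nbhs x U by exact: open_nbhs_nbhs.
  by apply: filterS => y Uy; rewrite IH.
rewrite deriveD; [|exact: derivableZ|exact: derivableZ].
by rewrite !deriveZ.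
Qed.

Lemma smooth_on_lin (V : normedModType R) (U : set V) (F G : V -> R) (a b : R) :
  open U -> smooth_on U F -> smooth_on U G ->
  smooth_on U (fun y => a * F y + b * G y).
Proof.
move=> oU sF sG w x Ux.
have [cF dF] := sF w x Ux; have [cG dG] := sG w x Ux.
have nU : nbhs x U by exact: open_nbhs_nbhs.
have e : \near x, (a *: iterD w F + b *: iterD w G) x =
    iterD w (fun y => a * F y + b * G y) x.
  by apply: filterS nU => y Uy; rewrite (iterD_lin _ _ oU sF sG).
split=> [|v].
- have cH : {for x, continuous (a *: iterD w F + b *: iterD w G)}.
    have cc (c : R) : (fun=> c) @ x --> c by exact: cst_continuous.
    exact: (cvgD (cvgM (cc a) cF) (cvgM (cc b) cG)).
  by move: cH; rewrite /prop_for /continuous_at (nbhs_singleton e);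
     exact: (cvg_trans (near_eq_cvg e)).
- by apply: near_eq_derivable e _; apply: derivableD; exact: derivableZ.
Qed.

Lemma smooth_on_cst (V : normedModType R) (U : set V) (c : R) :
  smooth_on U (cst c).
Proof.
have h w : exists c', iterD w (cst c : V -> R) = cst c'.
  elim: w => [|v w [c' e]]; first by exists c.
  by exists 0; rewrite /= e; apply/funext => x; rewrite derive_cst.
move=> w x _; have [c' ->] := h w.
by split=> [|v]; [exact: cst_continuous|exact: derivable_cst].
Qed.

Lemma smooth0 q d : smooth (0 : SL R q.+1 -> 'cV[R[i]]_d).
Proof.
move=> i b; rewrite (_ : gl_comp _ i b = cst 0); first exact: smooth_on_cst.
apply/funext => x; rewrite /gl_comp /gl_ext.
by case: insub => [g|]; rewrite mxE; case: b.
Qed.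

Lemma smoothD q d (f g : SL R q.+1 -> 'cV[R[i]]_d) :
  smooth f -> smooth g -> smooth (f + g).
Proof.
move=> sf sg i b.
rewrite (_ : gl_comp _ i b =
    fun x => 1 * gl_comp f i b x + 1 * gl_comp g i b x).
  by apply: smooth_on_lin; [exact: open_GLset|exact: sf|exact: sg].
apply/funext => x; rewrite /gl_comp /gl_ext !mul1r.
case: insub => [h|]; rewrite !mxE; last by case: b; rewrite /= addr0.
by case: (f h i ord0) (g h i ord0) => [? ?] [? ?]; case: b.
Qed.

Lemma smoothZ q d (c : R[i]) (f : SL R q.+1 -> 'cV[R[i]]_d) :
  smooth f -> smooth (c *: f).
Proof.
move=> sf i b.
rewrite (_ : gl_comp _ i b =
    fun x => complex.Re c * gl_comp f i b x
      + (if b then complex.Im c else - complex.Im c) * gl_comp f i (~~ b) x).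
  by apply: smooth_on_lin; [exact: open_GLset|exact: sf|exact: sf].
apply/funext => x; rewrite /gl_comp /gl_ext.
case: insub => [h|]; rewrite !mxE; last by case: b; rewrite /= !mulr0 addr0.
case: c (f h i ord0) => [? ?] [? ?]; case: b => //=; rewrite mulNr //.
Qed.

End SmoothClosed.

Section LeftTranslation.
Variables (R : realType) (q d : nat).

Definition ltrans (g : SL R q.+1) (f : SL R q.+1 -> 'cV[R[i]]_d) :
    SL R q.+1 -> 'cV[R[i]]_d :=
  fun x => f (g^-1 * x)%g.

Lemma sl_retract_mull (g : SL R q.+1) x :
  sl_retract (val g *m x) = val g *m sl_retract x.
Proof. by rewrite /sl_retract det_mulmx SL_det mul1r mulmxA. Qed.

Lemma gl_ext_ltrans g (f : SL R q.+1 -> 'cV[R[i]]_d) x :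
  gl_ext (ltrans g f) x = gl_ext f (invmx (val g) *m x).
Proof.
rewrite /gl_ext -SL_valV sl_retract_mull.
case: (insubP (SL R q.+1) (sl_retract x)) => [h hS eh|hS].
  by rewrite -eh -SL_valM valK.
rewrite insubN //; apply: contra hS.
by rewrite !inE det_mulmx SL_det mul1r.
Qed.

Lemma iterD_mull (A : 'M[R]_q.+1) (F : 'M[R]_q.+1 -> R) w :
  iterD w (fun x => F (A *m x)) =
  fun x => iterD [seq A *m v | v <- w] F (A *m x).
Proof.
elim: w => [//|v w IH] /=; rewrite IH; apply/funext => x.
rewrite /derive; set f1 := (X in X @ _); set f2 := (X in _ = lim (X @ _)).
by have -> : f1 = f2 by apply/funext => h; rewrite /f1 /f2 /= mulmxDr scalemxAr.
Qed.

Lemma smooth_ltrans g (f : SL R q.+1 -> 'cV[R[i]]_d) :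
  smooth f -> smooth (ltrans g f).
Proof.
move=> sf i b w x Ux; set A := invmx (val g).
have UA : GLset (A *m x).
  by rewrite /GLset /= det_mulmx /A -SL_valV SL_det mul1r.
rewrite (_ : gl_comp _ i b = fun y => gl_comp f i b (A *m y)); last first.
  by apply/funext => y; rewrite /gl_comp gl_ext_ltrans.
rewrite iterD_mull; set G := iterD _ _.
have [cG dG] := sf i b [seq A *m v | v <- w] _ UA.
split=> [|v].
- exact: (continuous_comp (@mulmx_continuous R _ A x) cG).
- have := dG (A *m v); rewrite /derivable.
  set f1 := (X in X @ _); set f2 := (X in _ -> cvg (X @ _)).
  by have -> : f1 = f2 by apply/funext => h; rewrite /f1 /f2 /= mulmxDr scalemxAr.
Qed.

End LeftTranslation.

(* Finite-dimensional complex representations of the groups SL(k, R) and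
   SL^{+-}(k, R), given by a matrix-valued function on 'M[R]_k of which only the
   values on the group S (SLpred or SLpmpred) matter. *)
Section Representations.
Variables (R : realType) (k d : nat).
Implicit Types (S : {pred 'M[R]_k}) (rho : 'M[R]_k -> 'M[R[i]]_d).

Definition is_rep S rho : Prop :=
  [/\ rho 1%:M = 1%:M,
      {in S &, forall g h, rho (g *m h) = rho g *m rho h} &
      forall i j b, {within [set g | g \in S],
        continuous (fun g : 'M[R]_k => reim b (rho g i j))}].

(* Row spaces of matrices U represent subspaces, while rho acts on column
   vectors; hence the transpose. *)
Definition irreducible S rho : Prop :=
  (0 < d)%N /\
  forall U : 'M[R[i]]_d, (forall g, g \in S -> stablemx U (rho g)^T) ->
    U = 0 \/ row_full U.

(* rho is equivalent to the representation act of S on the subspace W of V. *)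
Definition rep_iso S rho (V : lmodType R[i]) (W : set V)
    (act : 'M[R]_k -> V -> V) : Prop :=
  exists T : {linear 'cV[R[i]]_d -> V},
    [/\ injective T, range T = W &
        forall g, g \in S -> forall v, T (rho g *m v) = act g (T v)].

Definition is_triv S rho : Prop :=
  rep_iso S rho (V := R[i]^o) setT (fun _ z => z).

(* Homogeneous polynomials of degree l on C^k, as functions. *)
Definition homog_poly (l : nat) : set ('cV[R[i]]_k -> R[i]^o) :=
  [set p | exists P : mpoly.dhomog k R[i] l,
    p = fun v : 'cV[R[i]]_k =>
      mpoly.meval (fun i => v i ord0) (mpoly.mpoly_of_dhomog P)].

Definition poly_act (g : 'M[R]_k) (p : 'cV[R[i]]_k -> R[i]^o) :
    'cV[R[i]]_k -> R[i]^o :=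
  fun v => p (invmx (map_mx (real_complex R) g) *m v).

Definition is_poly (l : nat) S rho : Prop :=
  rep_iso S rho (homog_poly l) poly_act.

(* The extension of an irreducible representation of SL(k, R) to SL^{+-}(k, R)
   is only determined up to sgn. It is a convention, of which one needs to know
   that triv is extended by triv, and poly^l by (g . p)(v) = p(g^-1 v). *)
Definition extends_to_SLpm (rho rhopm : 'M[R]_k -> 'M[R[i]]_d) : Prop :=
  [/\ is_rep (@SLpmpred R k) rhopm, {in @SLpred R k, rhopm =1 rho},
      is_triv (@SLpred R k) rho -> is_triv (@SLpmpred R k) rhopm &
      forall l, is_poly l (@SLpred R k) rho -> is_poly l (@SLpmpred R k) rhopm].

(* The sign (-1)^b is represented by b : bool. *)
Definition sgn_tensor (b : bool) rho : 'M[R]_k -> 'M[R[i]]_d :=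
  fun g => (real_complex R (Num.sg (\det g)) ^+ b) *: rho g.

End Representations.

Section InducedRepresentation.
Variable R : realType.

Definition cexp (z : R[i]) : R[i] :=
  real_complex R (expR (complex.Re z))
    * Complex (cos (complex.Im z)) (sin (complex.Im z)).

(* M, A and N_+ of the maximal parabolic subgroup P = MAN_+ of SL(k + 1, R):
   par_A t is exp(t H) with H = k^-1 diag(k, -1, ..., -1), and par_N x is
   exp(\sum_j x_j E_{1, j+1}). *)
Definition par_M (k : nat) (h : 'M[R]_k) : 'M[R]_(1 + k) :=
  block_mx (\det h)^-1%:M 0 0 h.
Definition par_A (k : nat) (t : R) : 'M[R]_(1 + k) :=
  block_mx (expR t)%:M 0 0 (expR (- (t / k%:R)))%:M.
Definition par_N (k : nat) (x : 'rV[R]_k) : 'M[R]_(1 + k) :=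
  block_mx 1%:M x 0 1%:M.

Variables (k d : nat) (sigma : 'M[R]_k -> 'M[R[i]]_d) (la : R[i]).

(* Smooth f on SL(k + 1, R) with f(g p) = (sigma(m) e^(la t))^-1 f(g)
   for p = m exp(t H) n in P. *)
Definition Ind_pred : {pred (SL R k.+1 -> 'cV[R[i]]_d)} :=
  mem [set f : SL R k.+1 -> 'cV[R[i]]_d | smooth f /\
    forall (g p : SL R k.+1) (h : 'M[R]_k) (t : R) (x : 'rV[R]_k),
      h \in @SLpmpred R k -> val p = par_M h *m par_A k t *m par_N x ->
      f (g * p)%g = invmx (cexp (la * real_complex R t) *: sigma h) *m f g].

Record Ind := MkInd {
  Ind_fun :> SL R k.+1 -> 'cV[R[i]]_d; IndP : Ind_fun \in Ind_pred }.

HB.instance Definition _ := [isSub for Ind_fun].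
HB.instance Definition _ := [Choice of Ind by <:].

Lemma Ind_submod_closed : submod_closed Ind_pred.
Proof.
split=> [|c f f'].
  by rewrite inE; split=> [|g p h t x _ _]; [exact: smooth0|rewrite mulmx0].
rewrite !inE => -[sf ef] [sf' ef']; split.
  by apply: smoothD => //; exact: smoothZ.
move=> g p h t x hh hp; have := ef g p h t x hh hp; have := ef' g p h t x hh hp.
by rewrite !fctE => -> ->; rewrite mulmxDr scalemxAr.
Qed.

HB.instance Definition _ := GRing.isSubmodClosed.Build _ _ Ind_pred
  Ind_submod_closed.
HB.instance Definition _ := [SubChoice_isSubLmodule of Ind by <:].

Fact Ind_action_subproof (g : SL R k.+1) (f : Ind) : ltrans g f \in Ind_pred.
Proof.
have := IndP f; rewrite !inE => -[sf ef]; split; first exact: smooth_ltrans.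
by move=> g' p h t x hh hp; rewrite /ltrans mulgA (ef _ _ _ _ _ hh hp).
Qed.

Definition Ind_action (g : SL R k.+1) (f : Ind) : Ind :=
  MkInd (Ind_action_subproof g f).

(* The inverse image in SL(k + 1, R) of the support in G/P of the section f. *)
Definition Ind_supp (f : Ind) : set (SL R k.+1) :=
  closure [set g | f g != 0].

End InducedRepresentation.

(* G'-intertwining differential operators, where G' = SL(p + 1, R) is embedded
   in G = SL(p + 2, R) by diag1. *)
Section DifferentialOperators.
Variables (R : realType) (p d e : nat).
Variables (sigma : 'M[R]_p.+1 -> 'M[R[i]]_d) (la : R[i]).
Variables (tau : 'M[R]_p -> 'M[R[i]]_e) (nu : R[i]).

Local Notation I := (Ind sigma la).
Local Notation J := (Ind tau nu).

(* Continuity at 0, hence continuity when D is linear. *)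
Definition Cinfty_continuous (D : I -> J) : Prop :=
  forall (K' : set 'M[R]_p.+1) (N' : nat) (e' : R),
    compact K' -> K' `<=` @GLset R p.+1 -> 0 < e' ->
  exists (K : set 'M[R]_p.+2) (N : nat) (eps : R),
    [/\ compact K, K `<=` @GLset R p.+2, 0 < eps &
        forall f : I, Cinfty_nbhs0 K N eps f -> Cinfty_nbhs0 K' N' e' (D f)].

Definition is_diffop (D : I -> J) : Prop :=
  [/\ linear D, Cinfty_continuous D &
      forall f, @diag1 R p.+1 @` Ind_supp (D f) `<=` Ind_supp f].

Definition intertwining (D : I -> J) : Prop :=
  forall (g : SL R p.+1) (f : I),
    D (Ind_action (diag1 g) f) = Ind_action g (D f).

Definition Diff : set (I -> J) := [set D | is_diffop D /\ intertwining D].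

End DifferentialOperators.

(* The linear subspace S of V has dimension m. *)
Definition has_dim (K : fieldType) (V : lmodType K) (S : set V) (m : nat) :
    Prop :=
  exists b : 'I_m -> V, (forall i, S (b i)) /\
    forall v, S v -> exists! c : 'rV[K]_m, v = \sum_i c ord0 i *: b i.

Section MainObjects.
Variable R : realType.

(* I(triv, la)^a for G = SL(n + 1, R), and J(varpi, nu)^b for G' = SL(n, R),
   where p = n - 1 and varpi is already extended to SL^{+-}(p, R). *)
Definition Diff_triv (p d : nat) (a b : bool) (varpi : 'M[R]_p -> 'M[R[i]]_d)
    (la nu : R[i]) :=
  @Diff R p 1 d (sgn_tensor a (fun _ : 'M[R]_p.+1 => 1%:M)) la
    (sgn_tensor b varpi) nu.

(* For p = n - 1, (a, b; varpi; la, nu) is in Lambda_1, resp. Lambda_2; here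
   varpi is a representation of SL(p, R). *)
Definition Lambda1 (p d : nat) (a b : bool) (varpi : 'M[R]_p -> 'M[R[i]]_d)
    (la nu : R[i]) : Prop :=
  exists m : nat, [/\ b = a (+) odd m, is_triv (@SLpred R p) varpi &
    nu = la + m%:R].

Definition Lambda2 (p d : nat) (a b : bool) (varpi : 'M[R]_p -> 'M[R[i]]_d)
    (la nu : R[i]) : Prop :=
  exists l m : nat, [/\ b = a (+) odd (m + l), is_poly l (@SLpred R p) varpi,
    la = 1 - (m + l)%:R & nu = 1 + l%:R / p%:R].

End MainObjects.

Arguments Diff_triv {R p d} a b varpi la nu.

(* Main.v *)
From HB Require Import structures.
Require Import Defs.
From mathcomp Require Import all_boot all_order all_fingroup all_algebra.
From mathcomp Require Import all_classical all_reals all_analysis.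
From mathcomp Require Import complex ring lra.
From mathcomp Require mpoly.

Set Implicit Arguments.
Unset Strict Implicit.
Unset Printing Implicit Defensive.

Import Order.TTheory GRing.Theory Num.Theory.
Import numFieldNormedType.Exports.
Import (canonicals, coercions) mpoly.

Local Open Scope classical_set_scope.
Local Open Scope ring_scope.

Local Notation iterD := Defs.iterD.

(** A section of the bundle over G/P is a function phi on R^(n+1) \ 0, homogeneous
    under the character chi, and a G'-intertwining operator D is determined by the
    functional phi |-> (D phi)(1). By continuity and locality this functional only
    depends on a finite jet of phi at the base point e_0, so that in the
    coordinates (v_0, x', z) it is given by linear maps psi_(l,m) on the
    polynomials q(x') of degree l, applied to the test sections with leading term
    q(x') z^m. The Levi part of P' makes psi_(l,m) equivariant: as soon as it is
    nonzero, it is an isomorphism from poly^l to varpi, which determines l, m, nu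
    and beta, and D up to a scalar. The action of N'_+ on the test section of
    q(x') z^m, for q of degree l - 1, then forces lambda + l + m = 1 unless l = 0.
    Conversely, phi |-> (y |-> D_y^l D_(e_n)^m phi (e_0)) is covariant under P',
    because N'_+ only changes the direction y by a multiple of the base point, and
    the derivatives of order l of a function which is homogeneous of degree l - 1
    are insensitive to that. *)

(** * Iterated directional derivatives *)

(** Continuity bounds [D phi] at 1 by finitely many derivatives over a compact set [K], possibly far
    from the base point. A section that vanishes to high order along the axis R e_0 is multiplied by
    a cutoff in the angle to the axis. Near the base point nothing changes, while the derivatives up
    to order N tend to 0 on [K], so the functional vanishes on the section. The cutoff is a function
    of degree 0, for the product to be again a section. That psi_(l,m) is injective once it is
    nonzero comes from inserting matrices s + e y^T in the polynomial. They depend polynomially on s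
    and are invertible for almost all s, and at s = 0 they produce the l-th powers of all real
    linear forms. Surjectivity is irreducibility of varpi. Degrees are then compared by the weights
    of the torus diag(s, s^-1, 1, ...), for which n >= 3 provides two indices. In the converse
    direction, smoothness and continuity of the operator are read off from an expansion in
    derivatives of phi whose smooth coefficients do not depend on phi. *)

Section Calculus.
Variables (R : realType) (V : normedModType R).
Implicit Types (U : set V) (F G : V -> R) (w : seq V).

(** The condition that [smooth_on U F] imposes on each [iterD w F] at each point of U, isolated so
    that the closure properties below deal with one differentiation at a time. *)
Definition diff1 F (x : V) :=
  {for x, continuous F} /\ forall v, derivable F x v.

Lemma diff1_cst (c : R) x : diff1 (cst c) x.
Proof. by split=> [|v]; [exact: cst_continuous|exact: derivable_cst]. Qed.

Lemma diff1D F G x : diff1 F x -> diff1 G x -> diff1 (fun y => F y + G y) x.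
Proof.
move=> [cF dF] [cG dG]; split=> [|v]; first exact: (cvgD cF cG).
exact: (derivableD (dF v) (dG v)).
Qed.

Lemma diff1M F G x : diff1 F x -> diff1 G x -> diff1 (fun y => F y * G y) x.
Proof.
move=> [cF dF] [cG dG]; split=> [|v]; first exact: (cvgM cF cG).
exact: (derivableM (dF v) (dG v)).
Qed.

Lemma diff1_near F G x : (\forall y \near x, F y = G y) -> diff1 F x -> diff1 G x.
Proof.
move=> e [cF dF]; split=> [|v]; last exact: near_eq_derivable e (dF v).
move: cF; rewrite /prop_for /continuous_at (nbhs_singleton e).
exact: (cvg_trans (near_eq_cvg e)).
Qed.

Lemma diff1_sum (I : Type) (r : seq I) (f : I -> V -> R) x :
  (forall i, diff1 (f i) x) -> diff1 (fun y => \sum_(i <- r) f i y) x.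
Proof.
move=> df; elim: r => [|i r IH].
  rewrite (_ : (fun _ => _) = cst 0); first exact: diff1_cst.
  by apply/funext => y; rewrite big_nil.
rewrite (_ : (fun _ => _) = fun y => f i y + \sum_(j <- r) f j y).
  exact: (diff1D (df i) IH).
by apply/funext => y; rewrite big_cons.
Qed.

Lemma derive_fD F G x v : diff1 F x -> diff1 G x ->
  'D_v (fun y => F y + G y) x = 'D_v F x + 'D_v G x.
Proof. by move=> [_ dF] [_ dG]; exact: (deriveD (dF v) (dG v)). Qed.

Lemma derive_fM F G x v : diff1 F x -> diff1 G x ->
  'D_v (fun y => F y * G y) x = F x * 'D_v G x + 'D_v F x * G x.
Proof.
move=> [_ dF] [_ dG]; rewrite (deriveM (dF v) (dG v)) /=.
by congr (_ + _); rewrite mulrC.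
Qed.

Lemma derive_fsum (I : Type) (r : seq I) (f : I -> V -> R) x v :
  (forall i, diff1 (f i) x) ->
  'D_v (fun y => \sum_(i <- r) f i y) x = \sum_(i <- r) 'D_v (f i) x.
Proof.
move=> df; elim: r => [|i r IH].
  rewrite (_ : (fun _ => _) = cst 0) ?derive_cst ?big_nil//.
  by apply/funext => y; rewrite big_nil.
rewrite big_cons (_ : (fun _ => _) = fun y => f i y + \sum_(j <- r) f j y).
  by rewrite (derive_fD v (df i) (diff1_sum r df)) IH.
by apply/funext => y; rewrite big_cons.
Qed.

Lemma iterD_near w F G (x : V) : (\forall y \near x, F y = G y) ->
  \forall y \near x, iterD w F y = iterD w G y.
Proof.
move=> e; elim: w => [//|v w IH] /=.
have /nbhs_interior : nbhs x [set y | iterD w F y = iterD w G y] := IH.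
by apply: filterS => y ey; exact: near_eq_derive.
Qed.

Lemma iterD_eq U w F G : open U -> (forall x, U x -> F x = G x) ->
  forall x, U x -> iterD w F x = iterD w G x.
Proof.
move=> oU e x Ux; apply: (nbhs_singleton (iterD_near w _)).
by have := open_nbhs_nbhs (conj oU Ux); apply: filterS.
Qed.

Lemma iterD_cat w1 w2 F : iterD (w1 ++ w2) F = iterD w1 (iterD w2 F).
Proof. by elim: w1 => [//|v w IH] /=; rewrite IH. Qed.

Lemma smooth_iterD U w F : smooth_on U F -> smooth_on U (iterD w F).
Proof. by move=> sF w' x Ux; rewrite -iterD_cat; exact: sF. Qed.

Lemma smooth_derive U v F : smooth_on U F -> smooth_on U ('D_v F).
Proof. exact: (@smooth_iterD U [:: v] F). Qed.

Lemma smooth_diff1 U F x : smooth_on U F -> U x -> diff1 F x.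
Proof. by move=> sF Ux; exact: (sF [::]). Qed.

Lemma smooth_local U F :
  (forall x, U x -> exists U' G, [/\ open U', U' x, smooth_on U' G &
     forall y, U' y -> F y = G y]) -> smooth_on U F.
Proof.
move=> h w x Ux; have [U' [G [oU' U'x sG e]]] := h x Ux.
apply: (@diff1_near (iterD w G)); last exact: sG.
apply: iterD_near; have := open_nbhs_nbhs (conj oU' U'x).
by apply: filterS => y /e ->.
Qed.

Lemma smooth_eq U F G : open U -> (forall x, U x -> F x = G x) ->
  smooth_on U G -> smooth_on U F.
Proof. by move=> oU e sG; apply: smooth_local => x Ux; exists U, G. Qed.

Lemma smooth_sub U U' F : U' `<=` U -> smooth_on U F -> smooth_on U' F.
Proof. by move=> s sF w x /s; exact: sF. Qed.

(** Every iterated derivative of a member of [P] agrees on U with another member. So a class closed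
    under one derivative takes the place of formulas for the higher derivatives of products and
    compositions. *)
Lemma smooth_coind U (P : (V -> R) -> Prop) : open U ->
  (forall F, P F -> (forall x, U x -> diff1 F x) /\
     forall v, exists2 G, P G & forall x, U x -> 'D_v F x = G x) ->
  forall F, P F -> smooth_on U F.
Proof.
move=> oU h F PF.
have H w : exists2 G, P G & forall x, U x -> iterD w F x = G x.
  elim: w => [|v w [G PG e]]; first by exists F.
  have [_ /(_ v) [G' PG' e']] := h G PG; exists G' => // x Ux /=.
  rewrite -e' //; apply: near_eq_derive.
  by have := open_nbhs_nbhs (conj oU Ux); apply: filterS.
move=> w x Ux; have [G PG e] := H w.
apply: (@diff1_near G); last exact: (h G PG).1.
by have := open_nbhs_nbhs (conj oU Ux); apply: filterS => y /e ->.
Qed.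

Lemma smooth_cst U (c : R) : smooth_on U (fun=> c).
Proof. exact: smooth_on_cst. Qed.

End Calculus.

Global Opaque smooth_on.

Section Calculus.
Variables (R : realType) (V : normedModType R).
Implicit Types (U : set V) (F G : V -> R) (w : seq V).

Lemma smoothD U F G : open U -> smooth_on U F -> smooth_on U G ->
  smooth_on U (fun x => F x + G x).
Proof.
move=> oU sF sG; apply: (smooth_eq oU (G := fun x => 1 * F x + 1 * G x)).
  by move=> x _; rewrite !mul1r.
exact: (smooth_on_lin 1 1 oU sF sG).
Qed.

Lemma smooth_sum U (I : Type) (r : seq I) (f : I -> V -> R) : open U ->
  (forall i, smooth_on U (f i)) -> smooth_on U (fun x => \sum_(i <- r) f i x).
Proof.
move=> oU sf; elim: r => [|i r IH].
  by apply: (smooth_eq oU (G := fun=> 0)) => [x _|]; rewrite ?big_nil//; exact: smooth_cst.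
apply: (smooth_eq oU (G := fun x => f i x + \sum_(j <- r) f j x)).
  by move=> x _; rewrite big_cons.
exact: (smoothD oU (sf i) IH).
Qed.

Lemma smoothM U F G : open U -> smooth_on U F -> smooth_on U G ->
  smooth_on U (fun x => F x * G x).
Proof.
move=> oU sF sG.
(* Finite sums of products: the product rule sends such a sum over I to one over I + I. *)
pose P (K : V -> R) := exists (I : finType) (a b : I -> V -> R),
  [/\ forall i, smooth_on U (a i), forall i, smooth_on U (b i) &
     K = fun x => \sum_i a i x * b i x].
apply: (smooth_coind (P := P) oU); last first.
  exists unit, (fun=> F), (fun=> G); split=> //.
  by apply/funext => x; rewrite big_const card_unit /= addr0.
move=> _ [I [a [b [sa sb ->]]]].
have da i x (Ux : U x) : diff1 (a i) x := smooth_diff1 (sa i) Ux.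
have db i x (Ux : U x) : diff1 (b i) x := smooth_diff1 (sb i) Ux.
split=> [x Ux|v]; first by apply: diff1_sum => i; exact: (diff1M (da i x Ux) (db i x Ux)).
exists (fun x => \sum_i ((a i x * 'D_v (b i) x) + ('D_v (a i) x * b i x))).
  exists (I + I)%type,
    (fun i => match i with inl i => a i | inr i => 'D_v (a i) end),
    (fun i => match i with inl i => 'D_v (b i) | inr i => b i end); split.
  - by case=> i; [exact: sa|exact: (smooth_derive v (sa i))].
  - by case=> i; [exact: (smooth_derive v (sb i))|exact: sb].
  - by apply/funext => x; rewrite big_sumType big_split.
move=> x Ux; rewrite derive_fsum; last by move=> i; exact: (diff1M (da i x Ux) (db i x Ux)).
by apply: eq_bigr => i _; rewrite (derive_fM v (da i x Ux) (db i x Ux)).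
Qed.

Lemma smoothZ U (c : R) F : open U -> smooth_on U F ->
  smooth_on U (fun x => c * F x).
Proof. by move=> oU sF; exact: (smoothM oU (smooth_cst c) sF). Qed.

Lemma smoothN U F : open U -> smooth_on U F -> smooth_on U (fun x => - F x).
Proof.
move=> oU sF; apply: (smooth_eq oU _ (smoothZ (-1) oU sF)) => x _.
by rewrite mulN1r.
Qed.

Lemma smoothB U F G : open U -> smooth_on U F -> smooth_on U G ->
  smooth_on U (fun x => F x - G x).
Proof. by move=> oU sF sG; exact: (smoothD oU sF (smoothN oU sG)). Qed.

Lemma smooth_prod U (I : Type) (r : seq I) (f : I -> V -> R) : open U ->
  (forall i, smooth_on U (f i)) -> smooth_on U (fun x => \prod_(i <- r) f i x).
Proof.
move=> oU sf; elim: r => [|i r IH].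
  by apply: (smooth_eq oU (G := fun=> 1)) => [x _|]; rewrite ?big_nil//; exact: smooth_cst.
apply: (smooth_eq oU (G := fun x => f i x * \prod_(j <- r) f j x)).
  by move=> x _; rewrite big_cons.
exact: (smoothM oU (sf i) IH).
Qed.

Lemma smoothX U F n : open U -> smooth_on U F -> smooth_on U (fun x => F x ^+ n).
Proof.
move=> oU sF; elim: n => [|n IH]; first exact: smooth_cst.
by apply: (smooth_eq oU _ (smoothM oU sF IH)) => x _; rewrite exprS.
Qed.

Lemma iterD_lin_sum U (I : Type) (r : seq I) (c : I -> R) (f : I -> V -> R) w :
  open U -> (forall i, smooth_on U (f i)) -> forall x, U x ->
  iterD w (fun y => \sum_(i <- r) c i * f i y) x = \sum_(i <- r) c i * iterD w (f i) x.
Proof.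
move=> oU sf; elim: r => [|i r IH] x Ux.
  rewrite big_nil (@iterD_eq _ _ U w _ (fun y => 0 * 0 + 0 * 0)) //; last first.
    by move=> y _; rewrite big_nil !mul0r addr0.
  have s0 := smooth_cst (U := U) 0.
  by rewrite (iterD_lin 0 0 oU s0 s0 _ Ux) !mul0r addr0.
rewrite big_cons -IH // (@iterD_eq _ _ U w _
   (fun y => c i * f i y + 1 * \sum_(j <- r) c j * f j y)) //; last first.
  by move=> y _; rewrite big_cons mul1r.
have sS := smooth_sum r oU (fun j => smoothZ (c j) oU (sf j)).
by rewrite (iterD_lin (c i) 1 oU (sf i) sS _ Ux) mul1r.
Qed.

Lemma iterD_cst0 w : iterD w (fun=> 0 : R) = (fun=> 0 : R).
Proof.
by elim: w => [//|v w /= ->]; apply/funext => y; exact: derive_cst.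
Qed.

Lemma is_derive_line F x v (t : R) : derivable F (t *: v + x) v ->
  is_derive t 1 (fun s : R => F (s *: v + x)) ('D_v F (t *: v + x)).
Proof.
move=> dF; rewrite /derivable in dF.
have e : (fun h : R => h^-1 *: (((fun s : R => F (s *: v + x)) \o shift t) (h *: (1 : R^o)) - F (t *: v + x)))
   = (fun h => h^-1 *: ((F \o shift (t *: v + x)) (h *: v) - F (t *: v + x))).
  by apply/funext => h /=; rewrite [h *: 1]mulr1 scalerDl addrA.
by split; rewrite /derivable /derive e.
Qed.

Lemma line_continuous (x v : V) : continuous (fun s : R => s *: v + x).
Proof. by move=> s; apply: cvgD; [exact: scalel_continuous|exact: cvg_cst]. Qed.

Lemma mvt_line F x v : (forall t : R, 0 <= t <= 1 -> diff1 F (t *: v + x)) ->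
  exists2 t : R, 0 < t < 1 & F (v + x) - F x = 'D_v F (t *: v + x).
Proof.
move=> dF.
have := @MVT R (fun s => F (s *: v + x)) (fun s => 'D_v F (s *: v + x)) 0 1 ltr01.
case=> [t||t tI].
- rewrite in_itv /= => /andP [t0 t1]; apply: is_derive_line.
  by apply: (dF t _).2; rewrite !ltW.
- apply/continuous_within_itvP => //; split.
  + move=> s; rewrite in_itv /= => /andP [s0 s1].
    apply: (@continuous_comp _ _ _ (fun s : R => s *: v + x) F); first exact: line_continuous.
    by apply: (dF s _).1; rewrite !ltW.
  + apply: cvg_at_right_filter.
    apply: (@continuous_comp _ _ _ (fun s : R => s *: v + x) F); first exact: line_continuous.
    by apply: (dF 0 _).1; rewrite lexx ler01.
  + apply: cvg_at_left_filter.
    apply: (@continuous_comp _ _ _ (fun s : R => s *: v + x) F); first exact: line_continuous.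
    by apply: (dF 1 _).1; rewrite lexx ler01.
rewrite scale1r scale0r add0r subr0 mulr1 => e; by exists t.
Qed.

End Calculus.

Section Lines.
Variables (R : realType) (V : normedModType R).
Implicit Types (U : set V) (F G : V -> R) (w : seq V).

Lemma nbhs0_normP (x : V) (A : set V) : nbhs x A ->
  exists2 d : R, 0 < d & forall y, `|y| < d -> A (y + x).
Proof.
move=> /nbhs_normP [d /= d0 h]; exists d => // y yd; apply: h => /=.
by rewrite opprD addrCA subrr addr0 normrN.
Qed.

(** Derivability along v is that of a function of one real variable, where it amounts to
    differentiability. This makes the derivative homogeneous in the direction. *)
Lemma line_quot F x v a : 
  (fun h : R => h^-1 *: (F (h *: (a *: v) + x) - F x)) =
  (fun h : R => h^-1 *: (((fun s : R^o => F (s *: v + x)) \o shift 0) (h *: (a : R^o)) -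
      F ((0 : R^o) *: v + x))).
Proof.
by apply/funext => h; rewrite /= addr0 scale0r add0r scalerA.
Qed.

Lemma derivable_scalev F x v a : derivable F x v -> derivable F x (a *: v).
Proof.
move=> /derivable1P/derivable1_diffP dg; have := @diff_derivable _ _ _ _ _ a dg.
by rewrite /derivable -line_quot.
Qed.

Lemma derive_scalev F x v a : derivable F x v ->
  'D_(a *: v) F x = a * 'D_v F x.
Proof.
move=> /derivable1P/derivable1_diffP dg.
have e b : 'D_(b *: v) F x = 'D_b (fun s : R^o => F (s *: v + x)) 0.
  by rewrite /derive -line_quot.
rewrite e -[v in 'D_v F x]scale1r e !deriveE //.
by rewrite -[X in 'd _ _ X = _](mulr1 a) linearZ.
Qed.

(** Directional derivatives alone need not be additive in the direction; continuity of ['D_u F] is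
    what makes them so. The quotient along u + v is split at the point h v + x, and the mean value
    theorem turns the part along u into a value of ['D_u F] near x. *)
Lemma derive_addv U F x u v : open U -> smooth_on U F -> U x ->
  'D_(u + v) F x = 'D_u F x + 'D_v F x.
Proof.
move=> oU sF Ux; apply: cvg_lim => //=.
have [_ dF] := smooth_diff1 sF Ux.
have cv : (fun h : R => h^-1 *: (F (h *: v + x) - F x)) @ 0^' --> 'D_v F x.
  exact: dF.
suff cu : (fun h : R => h^-1 *: (F (h *: (u + v) + x) - F (h *: v + x))) @ 0^' --> 'D_u F x.
  apply: cvg_trans (cvgD cu cv); apply: near_eq_cvg; near=> h => /=.
  transitivity (h^-1 *: (F (h *: (u + v) + x) - F (h *: v + x)) +
    h^-1 *: (F (h *: v + x) - F x)) => //.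
  by rewrite -scalerDr addrA subrK.
apply/cvgrPdist_le => e e0.
have [cu _] := smooth_diff1 (smooth_derive u sF) Ux.
move/cvgrPdist_le : cu => /(_ e e0) nu.
have nn : nbhs x ([set t | `|'D_u F x - 'D_u F t| <= e] `&` U).
  by apply: filterI => //; exact: open_nbhs_nbhs.
have [d d0 hd] := nbhs0_normP nn.
(* For |h| below this bound the points t h u + h v with t in [0, 1] stay in the ball of radius d;
   the summand 1 keeps the denominator positive. *)
have p0 : 0 < d / (`|u| + `|v| + 1) by rewrite divr_gt0 // ltr_wpDl // addr_ge0.
near=> h.
have hn0 : h != 0 by near: h; exact: nbhs_dnbhs_neq.
have hs (t : R) : 0 <= t <= 1 -> `|t *: (h *: u) + h *: v| < d.
  move=> /andP[t0 t1].
  have hsm : `|h| < d / (`|u| + `|v| + 1) by near: h; exact: dnbhs0_lt.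
  apply: (@le_lt_trans _ _ (`|h| * (`|u| + `|v| + 1))).
    apply: (le_trans (ler_normD _ _)); rewrite !normrZ (ger0_norm t0).
    rewrite mulrCA !mulrDr -addrA lerD //; last by rewrite lerDl mulr1.
    by rewrite ler_wpM2l // ler_piMl.
  by rewrite -ltr_pdivlMr // ltr_wpDl // addr_ge0.
have [t|t /andP[t0 t1] e1] := @mvt_line R V F (h *: v + x) (h *: u).
  move=> /hs /hd [_]; rewrite -addrA => Ut; exact: (smooth_diff1 sF Ut).
have tI : 0 <= t <= 1 by rewrite !ltW.
have [/= hb Ut] := hd _ (hs _ tI); rewrite -addrA in hb Ut.
rewrite (scalerDr h u v) -addrA e1 derive_scalev; last exact: (smooth_diff1 sF Ut).2.

by rewrite [_ *: _]mulrA mulVf // mul1r.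
Unshelve. all: by end_near. Qed.

Lemma derive_sumv U F x (I : Type) (r : seq I) (c : I -> R) (e : I -> V) :
  open U -> smooth_on U F -> U x ->
  'D_(\sum_(i <- r) c i *: e i) F x = \sum_(i <- r) c i * 'D_(e i) F x.
Proof.
move=> oU sF Ux; elim: r => [|i r IH]; first by rewrite !big_nil derive0.
rewrite !big_cons (derive_addv _ _ oU sF Ux) IH derive_scalev //.
exact: (smooth_diff1 sF Ux).2.
Qed.

Lemma iterD_sumv U F x w1 w2 (I : Type) (r : seq I) (c : I -> R) (e : I -> V) :
  open U -> smooth_on U F -> U x ->
  iterD (w1 ++ (\sum_(i <- r) c i *: e i) :: w2) F x =
  \sum_(i <- r) c i * iterD (w1 ++ e i :: w2) F x.
Proof.
move=> oU sF Ux; rewrite iterD_cat /=.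
have sF2 := smooth_iterD w2 sF.
rewrite (@iterD_eq _ _ U w1 _ (fun y => \sum_(i <- r) c i * 'D_(e i) (iterD w2 F) y)) //.
  rewrite (iterD_lin_sum r c w1 oU (fun i => smooth_derive (e i) sF2) Ux).
  by apply: eq_bigr => i _; rewrite iterD_cat.
by move=> y Uy; exact: (derive_sumv r c e oU sF2 Uy).
Qed.

Lemma iterD_scalev U F x w1 w2 (c : R) v :
  open U -> smooth_on U F -> U x ->
  iterD (w1 ++ (c *: v) :: w2) F x = c * iterD (w1 ++ v :: w2) F x.
Proof.
move=> oU sF Ux.
by have := iterD_sumv w1 w2 [:: tt] (fun=> c) (fun=> v) oU sF Ux; rewrite !big_seq1.
Qed.

(* Both mixed derivatives are approximated by the same second difference
   quotient, which the mean value theorem evaluates in either order. *)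
Lemma derive_comm U F x u v : open U -> smooth_on U F -> U x ->
  'D_u ('D_v F) x = 'D_v ('D_u F) x.
Proof.
move=> oU sF Ux.
have suv := smooth_derive u (smooth_derive v sF).
have svu := smooth_derive v (smooth_derive u sF).
apply/eqP; rewrite -subr_eq0 -normr_le0; apply/ler_addgt0Pl => e e0; rewrite addr0.
have [/cvgrPdist_le cuv _] := smooth_diff1 suv Ux.
have [/cvgrPdist_le cvu _] := smooth_diff1 svu Ux.
have e20 : 0 < e / 2 by rewrite divr_gt0.
have n1 := cuv _ e20; have n2 := cvu _ e20.
have nn : nbhs x ([set t | `|'D_u ('D_v F) x - 'D_u ('D_v F) t| <= e / 2] `&`
    [set t | `|'D_v ('D_u F) x - 'D_v ('D_u F) t| <= e / 2] `&` U).
  apply: filterI (open_nbhs_nbhs (conj oU Ux)); apply: filterI; [exact: n1|exact: n2].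
have [d d0 hd] := nbhs0_normP nn.

pose D := `|u| + `|v| + 1.
have D0 : 0 < D by rewrite ltr_wpDl // addr_ge0.
have [h h0 hD] : exists2 h : R, 0 < h & h * D < d.
  exists (d / D / 2); first by rewrite !divr_gt0.
  have -> : d / D / 2 * D = d / 2 by field; rewrite gt_eqF.
  by rewrite ltr_pdivrMr // ltr_pMr // ltr1n.
have hs (s t : R) : 0 <= s <= 1 -> 0 <= t <= 1 -> `|s *: (h *: u) + t *: (h *: v)| < d.
  move=> /andP[s0 s1] /andP[t0 t1].
  apply: (@le_lt_trans _ _ (h * D)) => //.
  apply: (le_trans (ler_normD _ _)); rewrite !normrZ (ger0_norm s0) (ger0_norm t0) (gtr0_norm h0).
  rewrite mulrCA [t * _]mulrCA -!mulrDr ler_wpM2l ?(ltW h0) // /D.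
  apply: (@le_trans _ _ (`|u| + `|v|)); last by rewrite lerDl.
  by apply: lerD; rewrite ler_piMl.
have I1 : (0 : R) <= 1 <= (1 : R) by rewrite ler01 lexx.
have I0 : (0 : R) <= 0 <= (1 : R) by rewrite ler01 lexx.
have key (a b : V) : (forall s t : R, 0 <= s <= 1 -> 0 <= t <= 1 -> U (s *: (h *: a) + t *: (h *: b) + x)) ->
   exists s t : R, [/\ 0 <= s <= 1, 0 <= t <= 1 &
   F (h *: b + (h *: a + x)) - F (h *: a + x) - (F (h *: b + x) - F x) =
   h * (h * 'D_b ('D_a F) (s *: (h *: a) + t *: (h *: b) + x))].
  move=> Uab.
  have sh s : 0 <= s <= 1 -> diff1 (fun y => F (h *: b + y)) (s *: (h *: a) + x) /\
     'D_(h *: a) (fun y => F (h *: b + y)) (s *: (h *: a) + x) = 'D_(h *: a) F (h *: b + (s *: (h *: a) + x)).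
    move=> sI; have := Uab s 1 sI I1; rewrite scale1r addrAC addrC => Us.
    have [cF dF] := smooth_diff1 sF Us.
    have ee c : (fun k : R => k^-1 *: (F (h *: b + (k *: c + (s *: (h *: a) + x))) - F (h *: b + (s *: (h *: a) + x))))
      = (fun k : R => k^-1 *: (F (k *: c + (h *: b + (s *: (h *: a) + x))) - F (h *: b + (s *: (h *: a) + x)))).
      by apply/funext => k; rewrite [in LHS]addrCA.
    split; [split|].
    - apply: (@continuous_comp _ _ _ (fun y => h *: b + y) F) => //.
      by apply: cvgD; [exact: cvg_cst|exact: cvg_id].
    - by move=> c; rewrite /derivable /= ee; exact: dF.
    - by rewrite /derive /= ee.
  have [s|s /andP[s0 s1] e1] := @mvt_line R V (fun y => F (h *: b + y) - F y) x (h *: a).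
    move=> sI; have [d1 _] := sh s sI.
    have := Uab s 0 sI I0; rewrite scale0r addr0 => Us.
    have := diff1D d1 (diff1M (diff1_cst (-1) _) (smooth_diff1 sF Us)).
    by apply: diff1_near; apply: nearW => y; rewrite mulN1r.
  have sI : 0 <= s <= 1 by rewrite !ltW.
  have [d1 e2] := sh s sI.
  have := Uab s 0 sI I0; rewrite scale0r addr0 => Us.
  have d2 := smooth_diff1 sF Us.
  move: e1; rewrite [in 'D_(h *: a) _ _](_ : (fun y => F (h *: b + y) - F y) =
     (fun y => F (h *: b + y) + cst (-1) y * F y)); last by apply/funext => y; rewrite /= mulN1r.
  rewrite (derive_fD _ d1 (diff1M (diff1_cst (-1) _) d2)).
  rewrite (derive_fM _ (diff1_cst (-1) _) d2) derive_cst mul0r addr0 [cst _ _ * _]mulN1r e2.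
  have := Uab s 1 sI I1; rewrite scale1r addrAC addrC => Us1.
  rewrite !derive_scalev; [|exact: (smooth_diff1 sF _).2|exact: (smooth_diff1 sF _).2].
  rewrite -mulrBr => e3.
  have [t|t /andP[t0 t1] e4] := @mvt_line R V ('D_a F) (s *: (h *: a) + x) (h *: b).
    move=> tI; have := Uab s t sI tI; rewrite -addrA addrCA => Ut.
    exact: (smooth_diff1 (smooth_derive a sF) Ut).
  have tI : 0 <= t <= 1 by rewrite !ltW.
  exists s, t; split => //.
  rewrite e3 e4 derive_scalev; first by rewrite addrA [in RHS]addrAC [in RHS]addrC addrA.
  have := Uab s t sI tI; rewrite -addrA addrCA => Ut.
  exact: (smooth_diff1 (smooth_derive a sF) Ut).2.
have [s [t [sI tI e1]]] : exists s t : R, [/\ 0 <= s <= 1, 0 <= t <= 1 &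
   F (h *: v + (h *: u + x)) - F (h *: u + x) - (F (h *: v + x) - F x) =
   h * (h * 'D_v ('D_u F) (s *: (h *: u) + t *: (h *: v) + x))].
  by apply: key => s t sI tI; have [_] := hd _ (hs s t sI tI).
have [s' [t' [sI' tI' e2]]] : exists s t : R, [/\ 0 <= s <= 1, 0 <= t <= 1 &
   F (h *: u + (h *: v + x)) - F (h *: v + x) - (F (h *: u + x) - F x) =
   h * (h * 'D_u ('D_v F) (s *: (h *: v) + t *: (h *: u) + x))].
  apply: key => s' t' sI' tI'; have [_] := hd _ (hs t' s' tI' sI').
  by rewrite [s' *: _ + _]addrC.
have e3 : 'D_v ('D_u F) (s *: (h *: u) + t *: (h *: v) + x) =
    'D_u ('D_v F) (s' *: (h *: v) + t' *: (h *: u) + x).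
  apply: (mulfI (lt0r_neq0 h0)); apply: (mulfI (lt0r_neq0 h0)).
  apply: (etrans (esym e1)); apply: etrans e2.
  rewrite [h *: u + (h *: v + x)]addrCA.
  move: (F _) (F _) (F _) (F _) => p q r o.
  by rewrite !opprB addrACA [RHS]addrACA [- q - r]addrC.
have [[_ b1] _] := hd _ (hs s t sI tI).
have [[b2 _] _] := hd _ (hs t' s' tI' sI').
move: b1 b2 => /= b1; rewrite [t' *: _ + _]addrC => b2; rewrite e3 in b1.
rewrite -(subrKA ('D_u ('D_v F) (s' *: (h *: v) + t' *: (h *: u) + x))).
apply: (le_trans (ler_normD _ _)); rewrite [leRHS]splitr.
by apply: lerD; [exact: b2|rewrite distrC; exact: b1].
Qed.

Lemma iterD_front U F x a v b : open U -> smooth_on U F -> U x ->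
  iterD (a ++ v :: b) F x = iterD (v :: a ++ b) F x.
Proof.
move=> oU sF; elim: a x => [//|u a IH] x Ux.
rewrite cat_cons [LHS]/= (_ : 'D_u _ x = 'D_u (iterD (v :: a ++ b) F) x).
  exact: (derive_comm u v oU (smooth_iterD (a ++ b) sF) Ux).
apply: near_eq_derive; have := open_nbhs_nbhs (conj oU Ux).
by apply: filterS => y; exact: IH.
Qed.

Lemma iterD_perm U F x w w' : open U -> smooth_on U F -> U x ->
  perm_eq w w' -> iterD w F x = iterD w' F x.
Proof.
move=> oU sF; elim: w w' x => [|v w IH] w' x Ux.
  by rewrite perm_sym => /perm_nilP ->.
move=> pw; have vw : v \in w' by rewrite -(perm_mem pw) mem_head.
case/splitPr: vw pw => a b pw.
have pab : perm_eq w (a ++ b).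
  by rewrite -(perm_cons v) (perm_trans pw) // -cat1s perm_catCA.
rewrite (iterD_front _ _ _ oU sF Ux) /=; apply: near_eq_derive.
have := open_nbhs_nbhs (conj oU Ux); apply: filterS => y Uy; exact: IH.
Qed.

End Lines.

(** * Composition with affine maps *)

Section Affine.
Variables (R : realType) (V' V : normedModType R) (A L : V' -> V).
Hypothesis hA : forall (h : R) v x, A (h *: v + x) = h *: L v + A x.

Lemma iterD_affine w (F : V -> R) :
  iterD w (fun x => F (A x)) = fun x => iterD (map L w) F (A x).
Proof.
elim: w => [//|v w /= ->]; apply/funext => x.
rewrite /derive; set f1 := (X in X @ _); set f2 := (X in _ = lim (X @ _)).
by have -> : f1 = f2 by apply/funext => h; rewrite /f1 /f2 /= hA.
Qed.

Lemma derivable_affine (F : V -> R) x v :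
  derivable F (A x) (L v) -> derivable (fun y => F (A y)) x v.
Proof.
rewrite /derivable; set f1 := (X in X @ _); set f2 := (X in _ -> cvg (X @ _)).
by have -> : f1 = f2 by apply/funext => h; rewrite /f1 /f2 /= hA.
Qed.

Hypothesis cA : continuous A.

Lemma smooth_affine U' U (F : V -> R) : (forall x, U' x -> U (A x)) ->
  smooth_on U F -> smooth_on U' (fun x => F (A x)).
Proof.
Transparent smooth_on.
move=> UA sF w x /UA Ux; rewrite iterD_affine.
have [cF dF] := smooth_diff1 (smooth_iterD (map L w) sF) Ux.
split; first by apply: continuous_comp; [exact: cA|exact: cF].
by move=> v; apply: derivable_affine.
Opaque smooth_on.
Qed.

(** The coefficients and words are chosen before F, so that one expansion serves all sections in the
    later estimates. Being subwords of [map L w], the words have no higher order and use the same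
    directions. *)
Lemma iterD_mul_affine U' U (c : V' -> R) w : open U' -> smooth_on U' c ->
  (forall x, U' x -> U (A x)) ->
  exists (I : finType) (cs : I -> V' -> R) (ws : I -> seq V),
  [/\ forall i, smooth_on U' (cs i), forall i, subseq (ws i) (map L w) &
    forall F : V -> R, smooth_on U F -> forall x, U' x ->
      iterD w (fun y => c y * F (A y)) x = \sum_i cs i x * iterD (ws i) F (A x)].
Proof.
move=> oU' sc UA; elim: w => [|v w [I [cs [ws [scs sub e]]]]].
  exists unit, (fun=> c), (fun=> [::]); split=> // F sF x U'x.
  by rewrite big_const card_unit /= addr0.
exists (I + I)%type, (fun i => match i with inl i => 'D_v (cs i) | inr i => cs i end),
  (fun i => match i with inl i => ws i | inr i => L v :: ws i end); split.
- by case=> i; [exact: (smooth_derive v (scs i))|exact: scs].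
- case=> i; last by rewrite /= eqxx; exact: sub.
  exact: subseq_trans (sub i) (subseq_cons _ _).
move=> F sF x U'x /=.
have sA i := smooth_affine UA (smooth_iterD (ws i) sF).
rewrite (@near_eq_derive _ _ _ _ (fun y => \sum_i cs i y * iterD (ws i) F (A y))); last first.
  have := open_nbhs_nbhs (conj oU' U'x); apply: filterS => y U'y; exact: e.
have d1 i := smooth_diff1 (scs i) U'x.
have d2 i := smooth_diff1 (sA i) U'x.
rewrite derive_fsum; last by move=> i; exact: (diff1M (d1 i) (d2 i)).
rewrite big_sumType /= -big_split /=; apply: eq_bigr => i _.
rewrite (derive_fM v (d1 i) (d2 i)) addrC; congr (_ + _).
congr (_ * _); exact: (congr1 (fun f => f x) (iterD_affine [:: v] (iterD (ws i) F))).
Qed.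

End Affine.

(** * Smooth functions of one real variable *)

Section OneVariable.
Variable R : realType.
Implicit Types (O : set R^o) (F G : R^o -> R).

Lemma diff1_is_derive F x (d : R) : is_derive x (1 : R^o) F d -> diff1 F x.
Proof.
move=> [dF _]; split=> [|v]; last by have := @derivable_scalev _ _ _ _ _ v dF; rewrite [v *: _]mulr1.
exact/differentiable_continuous/derivable1_diffP.
Qed.

Lemma is_derive_diff1 F x (d : R) : diff1 F x -> 'D_(1 : R^o) F x = d ->
  is_derive x (1 : R^o) F d.
Proof. by move=> [_ dF] e; split. Qed.

(** On the line every direction is a multiple of 1, so closure of the class under scalar factors
    takes care of the derivatives along all other directions. *)
Lemma smooth1_coind O (P : (R^o -> R) -> Prop) : open O ->
  (forall c F, P F -> P (fun x => c * F x)) ->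
  (forall F, P F -> exists2 G : R^o -> R, P G & forall x, O x -> is_derive x (1 : R^o) F (G x)) ->
  forall F, P F -> smooth_on O F.
Proof.
move=> oO PZ h; apply: smooth_coind => // F /h [G PG dF].
split=> [x Ox|v]; first exact: diff1_is_derive (dF x Ox).
exists (fun x => v * G x); first exact: PZ.
move=> x Ox; have [dFx <-] := dF x Ox.
by rewrite -(derive_scalev v dFx) [v *: 1]mulr1.
Qed.

Lemma smooth1_derive O F G : open O -> (forall x, O x -> is_derive x (1 : R^o) F (G x)) ->
  smooth_on O G -> smooth_on O F.
Proof.
move=> oO dF sG.
apply: (smooth1_coind (P := fun H => smooth_on O H \/ exists c, H = fun x => c * F x) oO).
- move=> c H [sH|[c' ->]]; first by left; exact: smoothZ.
  by right; exists (c * c'); apply/funext => x; rewrite mulrA.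
- move=> H [sH|[c ->]].
    exists ('D_(1 : R^o) H); first by left; exact: smooth_derive.
    by move=> x Ox; apply: is_derive_diff1 => //; exact: (smooth_diff1 sH).
  exists (fun x => c * G x); first by left; exact: (smoothZ c oO sG).
  move=> x Ox; have dFx := dF x Ox; have d1 := diff1_is_derive dFx.
  apply: is_derive_diff1; first exact: (diff1M (diff1_cst c x) d1).
  by rewrite (derive_fM _ (diff1_cst c x) d1) derive_cst mul0r addr0 derive_val.
- by right; exists 1; apply/funext => x; rewrite mul1r.
Qed.

Lemma smooth1_id O : open O -> smooth_on O (fun x : R^o => x).
Proof.
move=> oO; apply: (smooth1_derive (G := fun=> 1) oO); last exact: smooth_cst.
Qed.

Lemma open_neq0 : open [set s : R^o | s != 0].
Proof. exact: open_neq. Qed.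

Lemma open_gt0 : open [set s : R^o | 0 < s].
Proof. exact: open_gt. Qed.

Lemma smooth1_inv : smooth_on [set s : R^o | s != 0] (fun s => s^-1 : R).
Proof.
apply: (smooth1_coind (P := fun H => exists c k, H = fun s => c * s^-1 ^+ k.+1) open_neq0).
- move=> c _ [c' [k ->]]; exists (c * c'), k.
  by apply/funext => s; rewrite mulrA.
- move=> _ [c [k ->]]; exists (fun s => (c * - k.+1%:R) * s^-1 ^+ k.+2).
    by exists (c * - k.+1%:R), k.+1.
  move=> s s0.
  have dV : is_derive s (1 : R^o) (fun s : R^o => s^-1 : R) (- s ^- 2).
    split; first by apply: derivableV; [exact: s0|exact: derivable_id].
    by rewrite deriveV ?derive_id ?[_ *: 1]mulr1 //; exact: derivable_id.
  have dX : is_derive s (1 : R^o) (fun s : R^o => s^-1 ^+ k.+1 : R) ((k.+1%:R * s^-1 ^+ k) * - s ^- 2).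
    by have := @is_deriveX _ _ (fun s : R^o => s^-1) k.+1 s 1 _ dV; rewrite exprfctE.
  have d1 := diff1_is_derive dX.
  apply: is_derive_diff1; first exact: (diff1M (diff1_cst c s) d1).
  rewrite (derive_fM _ (diff1_cst c s) d1) derive_cst mul0r addr0 derive_val.
  rewrite /cst -[RHS]mulrA; congr (_ * _).
  by rewrite mulrN mulNr -mulrA -exprVn -exprD addn2.
- by exists 1, 0%N; apply/funext => s; rewrite mul1r expr1.
Qed.

Lemma smooth1_expR O : open O -> smooth_on O (expR : R^o -> R).
Proof.
move=> oO; apply: (smooth1_coind (P := fun H => exists c, H = fun s => c * expR s) oO).
- by move=> c _ [c' ->]; exists (c * c'); apply/funext => s; rewrite mulrA.
- move=> _ [c ->]; exists (fun s => c * expR s); first by exists c.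
  move=> s _; have dE := is_derive_expR s; have d1 := diff1_is_derive dE.
  apply: is_derive_diff1; first exact: (diff1M (diff1_cst c s) d1).
  by rewrite (derive_fM _ (diff1_cst c s) d1) derive_cst mul0r addr0 derive_val.
- by exists 1; apply/funext => s; rewrite mul1r.
Qed.

Lemma smooth1_trig O (a b : R) : open O ->
  smooth_on O (fun s : R^o => a * cos s + b * sin s).
Proof.
move=> oO; apply: (smooth1_coind (P := fun H => exists a b, H = fun s => a * cos s + b * sin s) oO).
- move=> c _ [a' [b' ->]]; exists (c * a'), (c * b').
  by apply/funext => s; rewrite mulrDr !mulrA.
- move=> _ [a' [b' ->]]; exists (fun s => b' * cos s + (- a') * sin s); first by exists b', (- a').
  move=> s _; have dC := is_derive_cos s; have dS := is_derive_sin s.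
  have d1 := diff1_is_derive dC; have d2 := diff1_is_derive dS.
  have d3 := diff1M (diff1_cst a' s) d1; have d4 := diff1M (diff1_cst b' s) d2.
  apply: is_derive_diff1; first exact: (diff1D d3 d4).
  rewrite (derive_fD _ d3 d4) (derive_fM _ (diff1_cst a' s) d1) (derive_fM _ (diff1_cst b' s) d2).
  by rewrite !derive_cst !mul0r !addr0 !derive_val /cst mulrN mulNr addrC.
- by exists a, b.
Qed.

Lemma smooth1_ln : smooth_on [set s : R^o | 0 < s] (@ln R : R^o -> R).
Proof.
apply: (smooth1_derive (G := fun s => s^-1) open_gt0).
by apply: smooth_sub smooth1_inv => s /= s0; rewrite gt_eqF.
Qed.

End OneVariable.

Section Composition.
Variables (R : realType) (V : normedModType R).

Lemma diff1_comp1 (g : R^o -> R) (F : V -> R) x : diff1 g (F x) -> diff1 F x ->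
  diff1 (fun y => g (F y)) x /\
  forall v, 'D_v (fun y => g (F y)) x = 'D_(1 : R^o) g (F x) * 'D_v F x.
Proof.
move=> [cg dg] [cF dF].
have line v : is_derive (0 : R) (1 : R) (fun h : R => F (h *: v + x)) ('D_v F x).
  by have := @is_derive_line R V F x v 0; rewrite scale0r add0r => /(_ (dF v)).
have dgx : is_derive (F ((0 : R) *: x + x)) (1 : R) g ('D_(1 : R^o) g (F x)).
  by rewrite scale0r add0r; split.
have comp v : is_derive (0 : R) (1 : R) (fun h : R => g (F (h *: v + x))) ('D_(1 : R^o) g (F x) * 'D_v F x).
  have := @is_derive1_comp R g (fun h : R => F (h *: v + x)) 0 _ _ _ (line v).
  by rewrite !scale0r add0r in dgx *; exact.
have e v : (fun h : R => h^-1 *: (g (F (h *: v + x)) - g (F x))) =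
  (fun h : R => h^-1 *: (((fun h : R => g (F (h *: v + x))) \o shift 0) (h *: (1 : R^o)) - g (F ((0 : R) *: v + x)))).
  by apply/funext => h /=; rewrite addr0 scale0r add0r [h *: 1]mulr1.
split; first split.
- exact: (@continuous_comp _ _ _ F g).
- by move=> v; have [] := comp v; rewrite /derivable /= -e.
- by move=> v; have [_ <-] := comp v; rewrite /derive /= e.
Qed.

Lemma smooth_comp1 (O : set R^o) (U : set V) (g : R^o -> R) (F : V -> R) :
  open O -> open U -> smooth_on O g -> smooth_on U F ->
  (forall x, U x -> O (F x)) -> smooth_on U (fun x => g (F x)).
Proof.
move=> oO oU sg sF UO.
(* By the chain rule, sums of terms a(F) b with F fixed form a class closed under derivatives. *)
pose P (K : V -> R) := exists (I : finType) (a : I -> R^o -> R) (b : I -> V -> R),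
  [/\ forall i, smooth_on O (a i), forall i, smooth_on U (b i) &
     K = fun x => \sum_i a i (F x) * b i x].
apply: (smooth_coind (P := P) oU); last first.
  exists unit, (fun=> g), (fun=> fun=> 1); split=> //.
    by move=> _; exact: smooth_cst.
  by apply/funext => x; rewrite big_const card_unit /= addr0 mulr1.
move=> _ [I [a [b [sa sb ->]]]].
have dF x (Ux : U x) := smooth_diff1 sF Ux.
have da i x (Ux : U x) := diff1_comp1 (smooth_diff1 (sa i) (UO x Ux)) (dF x Ux).
have db i x (Ux : U x) : diff1 (b i) x := smooth_diff1 (sb i) Ux.
split=> [x Ux|v]; first by apply: diff1_sum => i; exact: (diff1M (da i x Ux).1 (db i x Ux)).
exists (fun x => \sum_i (a i (F x) * 'D_v (b i) x + 'D_(1 : R^o) (a i) (F x) * ('D_v F x * b i x))).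
  exists (I + I)%type,
    (fun i => match i with inl i => a i | inr i => 'D_(1 : R^o) (a i) end),
    (fun i => match i with inl i => 'D_v (b i) | inr i => fun x => 'D_v F x * b i x end); split.
  - by case=> i; [exact: sa|exact: (smooth_derive (1 : R^o) (sa i))].
  - by case=> i; [exact: (smooth_derive v (sb i))|exact: (smoothM oU (smooth_derive v sF) (sb i))].
  - by apply/funext => x; rewrite big_sumType big_split.
move=> x Ux; rewrite derive_fsum; last by move=> i; exact: (diff1M (da i x Ux).1 (db i x Ux)).
apply: eq_bigr => i _; rewrite (derive_fM v (da i x Ux).1 (db i x Ux)) (da i x Ux).2.
by rewrite mulrA.
Qed.

Lemma smooth_linear (U : set V) (F : V -> R) : open U -> continuous F ->
  (forall (h : R) v x, F (h *: v + x) = h * F v + F x) -> smooth_on U F.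
Proof.
move=> oU cF lF; have oT : open (setT : set R^o) := openT.
exact: (@smooth_affine R V R^o F F lF cF U setT (fun x : R^o => x) (fun _ _ => I) (smooth1_id oT)).
Qed.

Lemma smooth_inv (U : set V) (F : V -> R) : open U -> smooth_on U F ->
  (forall x, U x -> F x != 0) -> smooth_on U (fun x => (F x)^-1).
Proof.
move=> oU sF F0.
exact: (smooth_comp1 (@open_neq0 R) oU (@smooth1_inv R) sF F0).
Qed.

End Composition.

(** * A cutoff function and the characters of the real line minus zero *)

Section Bump.
Variable R : realType.

(* The derivatives of s |-> exp(-1/s) are of this form. *)
Definition flat (p : {poly R}) (s : R^o) : R :=
  if 0 < s then p.[s^-1] * expR (- s^-1) else 0.

Lemma derive_inv1 (s : R^o) : s != 0 ->
  'D_(1 : R^o) (fun t : R^o => t^-1 : R) s = - s ^- 2.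
Proof.
by move=> s0; rewrite deriveV ?derive_id ?[_ *: 1]mulr1 //; exact: derivable_id.
Qed.

(** From y^n / n! <= exp y, by induction on the coefficients of p. It controls the difference
    quotient of [flat] at 0 through y = 1/h. *)
Lemma poly_expR_bound (p : {poly R}) k :
  exists C : R, forall y, 0 <= y -> `|p.[y]| * y ^+ k * expR (- y) <= C.
Proof.
have b1 n y : 0 <= y -> y ^+ n * expR (- y) <= n`!%:R :> R.
  move=> y0; rewrite expRN ler_pdivrMr ?expR_gt0 //.
  case: n => [|n]; first by rewrite expr0 mul1r -[1]expR0 ler_expR.
  rewrite mulrC -ler_pdivrMr ?ltr0n ?fact_gt0 //.
  by apply: le_trans (expR_ge1Dxn n y0); rewrite lerDr.
elim/poly_ind: p k => [|p c IH] k.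
  by exists 0 => y _; rewrite horner0 normr0 !mul0r.
have [C hC] := IH k.+1; exists (C + `|c| * k`!%:R) => y y0.
rewrite hornerMXaddC -mulrA.
apply: (@le_trans _ _ ((`|p.[y]| * y + `|c|) * (y ^+ k * expR (- y)))).
  rewrite ler_wpM2r //; first by rewrite mulr_ge0 ?exprn_ge0 ?expR_ge0.
  by rewrite (le_trans (ler_normD _ _)) // normrM (ger0_norm y0).
rewrite mulrDl lerD //; last by rewrite ler_wpM2l ?b1.
by rewrite -mulrA [y * _]mulrA -exprS mulrA hC.
Qed.

(** For s > 0 the derivative of p(1/s) exp(-1/s) is s^-2 (p - p')(1/s) exp(-1/s), whence the
    polynomial. At 0 the quotient h^-1 p(1/h) exp(-1/h), for h > 0, is at most C h in absolute
    value, by [poly_expR_bound] with k = 2. *)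
Lemma is_derive_flat p s : is_derive s (1 : R^o) (flat p) (flat ('X^2 * (p - p^`())) s).
Proof.
have [s0|s0|->] := ltgtP s 0.
- have -> : flat ('X^2 * (p - p^`())) s = 0 by rewrite /flat ltNge (ltW s0).
  have dc := @is_derive_cst R R^o R^o 0 s 1.
  apply: near_eq_is_derive dc.
  near=> t; rewrite /flat ltNge (_ : t <= 0) // ltW //.
  by near: t; exact: lt_nbhsl.
- rewrite [flat ('X^2 * _) s]/flat s0.
  apply: (@near_eq_is_derive _ _ _ (fun t : R^o => p.[t^-1] * expR (- t^-1))).
    near=> t; rewrite /flat (_ : 0 < t) //.
    by near: t; exact: lt_nbhsr.
  have dV : diff1 (fun t : R^o => t^-1 : R) s.
    by apply: (smooth_diff1 (@smooth1_inv R)); rewrite /= gt_eqF.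
  have dP : diff1 (horner p : R^o -> R) s^-1 by exact: diff1_is_derive (is_derive_poly p s^-1).
  have dN : diff1 (fun t : R^o => - t : R) s^-1.
    by apply: (@diff1_is_derive _ _ _ (-1)); exact: is_deriveNid.
  have dE : diff1 (fun t : R^o => expR t) (- s^-1) by exact: diff1_is_derive (is_derive_expR _).
  have [dEN eEN] := diff1_comp1 dE dN.
  have dPE := diff1M dP dEN.
  have [dF eF] := diff1_comp1 dPE dV.
  apply: is_derive_diff1 => //; rewrite eF (derive_fM _ dP dEN) eEN.
  have [_ ->] := is_derive_expR (- s^-1).
  have [_ ->] := is_derive_poly p s^-1.
  have [_ ->] := @is_deriveNid R R^o s^-1 1.
  rewrite derive_inv1 ?gt_eqF // -exprVn !hornerE /=; ring.
rewrite /flat ltxx; set f := fun t => _.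
suff c : (fun h : R => h^-1 *: ((f \o shift 0) (h *: (1 : R^o)) - f 0)) @ 0^' --> (0 : R).
  by split; [apply/cvg_ex; exists 0|exact: cvg_lim c].
have [C hC] := poly_expR_bound p 2.
have C0 : 0 <= C.
  by apply: le_trans (hC 0 (lexx _)); rewrite !mulr_ge0 ?exprn_ge0 ?expR_ge0.
apply/cvgrPdist_le => /= e e0.
have p0 : 0 < e / (C + 1) by rewrite divr_gt0 // ltr_wpDl.
near=> h.
have hs : `|h| < e / (C + 1) by near: h; exact: dnbhs0_lt.
rewrite sub0r normrN addr0 [h *: 1]mulr1.
rewrite /f ltxx subr0; case: ltP => h0; last by rewrite scaler0 normr0 ltW.
have hn0 : h != 0 by rewrite gt_eqF.
apply: (@le_trans _ _ (h * C)).
  rewrite [_ *: _]mulrC normrM normrM (gtr0_norm (expR_gt0 _)) normfV (gtr0_norm h0).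
  rewrite -ler_pdivrMl //; apply: le_trans (hC h^-1 _); last by rewrite invr_ge0 ltW.
  rewrite expr2 le_eqVlt; apply/orP; left; apply/eqP; ring.
rewrite gtr0_norm // in hs.
apply: (@le_trans _ _ (h * (C + 1))); first by rewrite ler_wpM2l ?lerDl // ltW.
by rewrite -ler_pdivlMr ?ltr_wpDl // ltW.
Unshelve. all: by end_near. Qed.

Lemma smooth_flat p O : open O -> smooth_on O (flat p).
Proof.
move=> oO; apply: (smooth1_coind (P := fun F => exists p, F = flat p) oO); last by exists p.
  move=> c _ [q ->]; exists (c *: q); apply/funext => s; rewrite /flat.
  by case: ifP; rewrite ?mulr0 // hornerZ mulrA.
move=> _ [q ->]; exists (flat ('X^2 * (q - q^`()))); first by exists ('X^2 * (q - q^`())).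
by move=> s _; exact: is_derive_flat.
Qed.

(** The bounds on the derivatives concern s >= 0, the range of [ratio]. They come from compactness
    of [0, 1] and from vanishing beyond 1. *)
Lemma exists_cutoff : exists kap : R^o -> R,
  [/\ smooth_on setT kap, forall s, s <= 2^-1 -> kap s = 1,
      forall s, 1 <= s -> kap s = 0 &
      forall i, exists C : R, forall s, 0 <= s ->
        `|iterD (nseq i (1 : R^o)) kap s| <= C /\
        (1 < s -> iterD (nseq i (1 : R^o)) kap s = 0)].
Proof.
have oT : open (setT : set R^o) := openT.
have fge0 s : 0 <= flat 1 s.
  by rewrite /flat hornerC mul1r; case: ifP => // _; exact: expR_ge0.
have fgt0 s : 0 < s -> 0 < flat 1 s.
  by rewrite /flat hornerC mul1r => ->; exact: expR_gt0.
have fle0 s : s <= 0 -> flat 1 s = 0.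
  by rewrite /flat ltNge => ->.
(* The first summand is positive for s < 1 and the second for s > 1/2, so that [den] has no zero,
   and the quotient [kap] below is 1 up to 1/2 and 0 from 1 on. *)
pose den s := flat 1 (1 - s) + flat 1 (s - 2^-1).
have den0 s : den s != 0.
  rewrite gt_eqF // /den; have [s1|s1] := ltP s 1.
    by rewrite ltr_wpDr // fgt0 // subr_gt0.
  rewrite ltr_wpDl // fgt0 // subr_gt0 (lt_le_trans _ s1) //.
  by rewrite invf_lt1 // ltr1n.
pose kap s := flat 1 (1 - s) * (den s)^-1.
have sid := smooth1_id oT.
have s1 : smooth_on setT (fun s : R^o => flat 1 (1 - s)).
  have sB := smoothB oT (smooth_cst (1 : R)) sid.
  exact: (smooth_comp1 oT oT (smooth_flat 1 oT) sB (fun _ _ => I)).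
have s2 : smooth_on setT (fun s : R^o => flat 1 (s - 2^-1)).
  have sB := smoothB oT sid (smooth_cst (2^-1 : R)).
  exact: (smooth_comp1 oT oT (smooth_flat 1 oT) sB (fun _ _ => I)).
have sk : smooth_on setT (kap : R^o -> R).
  exact: (smoothM oT s1 (smooth_inv oT (smoothD oT s1 s2) (fun x _ => den0 x))).
have k0 s : 1 <= s -> kap s = 0.
  by move=> h; rewrite /kap fle0 ?mul0r // subr_le0.
exists kap; split => //.
  move=> s h; rewrite /kap /den (fle0 (s - _)) ?subr_le0 // addr0 divff // gt_eqF // fgt0 //.
  by rewrite subr_gt0 (le_lt_trans h) // invf_lt1 // ltr1n.
move=> i; set D := iterD _ _.
have D0 s : 1 < s -> D s = 0.
  move=> hs; have -> : D s = iterD (nseq i (1 : R^o)) (fun=> 0) s.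
    apply: (@iterD_eq _ _ [set t : R^o | 1 < t]) => //.
    by move=> t /= ht; rewrite k0 // ltW.
  by rewrite iterD_cst0.
have cD : continuous (fun s => `|D s|).
  move=> s; apply: continuous_comp; last exact: norm_continuous.
  exact: (smooth_diff1 (smooth_iterD (nseq i (1 : R^o)) sk) I).1.
have [c cI hc] := @EVT_max R (fun s => `|D s|) 0 1 ler01 (continuous_subspaceT cD).
exists `|D c| => s hs; split; last exact: D0.
have [s1'|s1'] := ltP 1 s; first by rewrite D0 // normr0.
by apply: hc; rewrite in_itv /= hs.
Qed.

End Bump.

Section Chi.
Variable R : realType.
Variables (a : bool) (la : R[i]).

(* sgn(s)^a |s|^-la; the value at s = 0 is irrelevant. *)
Definition chi (s : R) : R[i] :=
  real_complex R (Num.sg s) ^+ a * cexp (- la * real_complex R (ln `|s|)).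

Lemma cexpD (x y : R[i]) : cexp (x + y) = cexp x * cexp y.
Proof.
case: x y => [x1 x2] [y1 y2]; rewrite /cexp /= expRD cosD sinD.
apply/eqP; rewrite eq_complex /=; apply/andP; split; apply/eqP; ring.
Qed.

Lemma cexp0 : cexp (0 : R[i]) = 1.
Proof. by rewrite /cexp /= expR0 cos0 sin0 mul1r. Qed.

Lemma chiM s t : s != 0 -> t != 0 -> chi (s * t) = chi s * chi t.
Proof.
move=> s0 t0; rewrite /chi sgrM rmorphM exprMn normrM lnM ?posrE ?normr_gt0 //.
by rewrite rmorphD mulrDr cexpD mulrACA.
Qed.

Lemma chi1 : chi 1 = 1.
Proof. by rewrite /chi sgr1 normr1 ln1 expr1n mul1r mulr0 cexp0. Qed.

Lemma chi_neq0 s : s != 0 -> chi s != 0.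
Proof.
move=> s0; apply/eqP => e; have := chiM s0 (invr_neq0 s0).
by rewrite divff // chi1 e mul0r => /eqP; rewrite oner_eq0.
Qed.

Lemma chiV s : s != 0 -> chi s^-1 = (chi s)^-1.
Proof.
move=> s0; apply: (mulfI (chi_neq0 s0)).
by rewrite -chiM ?invr_neq0 // !divff // ?chi1 // chi_neq0.
Qed.

Lemma smooth_chi b : smooth_on [set s : R^o | s != 0] (fun s => reim b (chi s)).
Proof.
have oO := @open_neq0 R.
(* Half of this is ln |s|, written in a form that is visibly smooth on both sides of 0. *)
pose L (s : R^o) := ln (s ^+ 2).
have sL : smooth_on [set s : R^o | s != 0] L.
  apply: (smooth_comp1 (@open_gt0 R) oO (@smooth1_ln R) (smoothX 2 oO (smooth1_id oO))).
  by move=> s /= s0; rewrite exprn_even_gt0.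
have eL (s : R^o) : s != 0 -> ln `|s| = 2^-1 * L s.
  move=> s0; rewrite /L -real_normK ?num_real // lnXn ?normr_gt0 //.
  by move: (ln _) => x; rewrite mulr2n; field.
have ssg : smooth_on [set s : R^o | s != 0] (fun s => Num.sg s ^+ a : R).
  apply: smooth_local => s /= s0; case: (ltgtP s 0) => [h|h|h]; last by rewrite h eqxx in s0.
    exists [set t : R^o | t < 0], (fun=> (-1) ^+ a); split => //.
      exact: smooth_cst.
    by move=> t /= /ltr0_sg ->.
  exists [set t : R^o | 0 < t], (fun=> 1 ^+ a); split => //.
    exact: smooth_cst.
  by move=> t /= /gtr0_sg ->.
have oT : open (setT : set R^o) := openT.
pose E (s : R^o) := expR ((- complex.Re la * 2^-1) * L s).
have sE : smooth_on [set s : R^o | s != 0] E.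
  exact: (smooth_comp1 oT oO (smooth1_expR oT) (smoothZ (- complex.Re la * 2^-1) oO sL) (fun _ _ => I)).
pose T (s : R^o) := (fun u => (~~ b)%:R * cos u + b%:R * sin u) ((- complex.Im la * 2^-1) * L s).
have sT : smooth_on [set s : R^o | s != 0] T.
  exact: (smooth_comp1 oT oO (smooth1_trig (~~ b)%:R b%:R oT) (smoothZ (- complex.Im la * 2^-1) oO sL) (fun _ _ => I)).
apply: (smooth_eq oO _ (smoothM oO ssg (smoothM oO sE sT))) => s /= s0.
rewrite /E /T -!mulrA -(eL s s0) /chi /cexp.
rewrite -rmorphXn; move: (_ ^+ a) (ln _) => x y.
case: (la) => [l1 l2]; rewrite /reim; case: (b) => /=; rewrite !(mulr0, mul0r, oppr0, addr0, add0r, subr0, mul1r) !mulNr; ring.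
Qed.

End Chi.

(** * Functions vanishing along the axis *)

Section Vanishing.
Variables (R : realType) (q : nat).
Local Notation V := 'cV[R]_q.+1.
Implicit Types (U : set V) (F G H : V -> R) (v : V).

Definition bvec (i : 'I_q.+1) : V := delta_mx i ord0.

Definition on_axis v := forall i, i != ord0 -> v i ord0 = 0.

Lemma norm_cV_le v (C : R) : 0 <= C -> (forall i, `|v i ord0| <= C) -> `|v| <= C.
Proof.
move=> C0 h; rewrite [leLHS]/Num.Def.normr /= mx_normrE bigmax_le // => -[i j] _ /=.
by rewrite ord1.
Qed.

Lemma coord_le_norm v i : `|v i ord0| <= `|v|.
Proof.
rewrite [leRHS]/Num.Def.normr /= mx_normrE.
exact: (le_bigmax _ (fun ij : 'I_q.+1 * 'I_1 => `|v ij.1 ij.2|) (i, ord0)).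
Qed.

Lemma cV_sum_bvec v : v = \sum_i v i ord0 *: bvec i.
Proof.
rewrite [LHS]matrix_sum_delta; apply: eq_bigr => i _.
by rewrite big_ord1.
Qed.

Lemma coord_smooth U i : open U -> smooth_on U (fun v => v i ord0).
Proof.
move=> oU; apply: (smooth_linear oU); first exact: coord_continuous.
by move=> h v x; rewrite !mxE.
Qed.

(* H vanishes to order m along the axis R e_0. *)
Definition van U m H := smooth_on U H /\
  forall w, (size w < m)%N -> forall v, U v -> on_axis v -> iterD w H v = 0.

Lemma van_le U m m' H : (m' <= m)%N -> van U m H -> van U m' H.
Proof. by move=> mm [sH h]; split=> // w hw; apply: h; exact: leq_trans mm. Qed.

Lemma van_eq U m F G : open U -> (forall v, U v -> F v = G v) -> van U m G -> van U m F.
Proof.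
move=> oU e [sG h]; split; first exact: (smooth_eq oU e sG).
by move=> w hw v Uv Lv; rewrite (iterD_eq w oU e Uv) h.
Qed.

Lemma van_derive U m v H : van U m H -> van U m.-1 ('D_v H).
Proof.
move=> [sH h]; split; first exact: smooth_derive.
move=> w hw x Ux Lx; have := h (rcons w v) _ x Ux Lx.
by rewrite size_rcons -cats1 iterD_cat; apply; case: m hw {h}.
Qed.

Lemma van_succ U m H : smooth_on U H -> (forall v, U v -> on_axis v -> H v = 0) ->
  (forall w, van U m ('D_w H)) -> van U m.+1 H.
Proof.
move=> sH H0 h; split=> // w; case/lastP: w => [_|w x]; first exact: H0.
rewrite size_rcons ltnS => hw v Uv Lv.
by rewrite -cats1 iterD_cat; exact: (h x).2.
Qed.

Lemma van_lin U m F G (a b : R) : open U -> van U m F -> van U m G ->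
  van U m (fun v => a * F v + b * G v).
Proof.
move=> oU [sF hF] [sG hG]; split; first exact: smooth_on_lin.
move=> w hw v Uv Lv.
by rewrite (iterD_lin a b oU sF sG w Uv) hF // hG // !mulr0 addr0.
Qed.

Lemma vanD U m F G : open U -> van U m F -> van U m G -> van U m (fun v => F v + G v).
Proof.
move=> oU vF vG; apply: (van_eq oU _ (van_lin 1 1 oU vF vG)) => v _.
by rewrite !mul1r.
Qed.

Lemma van0 U m : van U m (fun=> 0).
Proof.
split; first exact: smooth_cst.
by move=> w _ v _ _; rewrite iterD_cst0.
Qed.

Lemma van_sum U m (I : Type) (r : seq I) (f : I -> V -> R) : open U ->
  (forall i, van U m (f i)) -> van U m (fun v => \sum_(i <- r) f i v).
Proof.
move=> oU vf; elim: r => [|i r IH].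
  by apply: (van_eq oU _ (van0 U m)) => v _; rewrite big_nil.
by apply: (van_eq oU _ (vanD oU (vf i) IH)) => v _; rewrite big_cons.
Qed.

(** The inequality m <= a + b, in place of equality, lets the induction pass to [a.-1] and [b.-1]
    even when a or b is 0. *)
Lemma vanM U m a b F G : open U -> (m <= a + b)%N -> van U a F -> van U b G ->
  van U m (fun v => F v * G v).
Proof.
move=> oU; elim: m a b F G => [|m IH] a b F G mab vF vG.
  by split=> //; exact: (smoothM oU vF.1 vG.1).
apply: van_succ; first exact: (smoothM oU vF.1 vG.1).
  move=> v Uv Lv; case: a vF mab => [|a] vF mab.
    case: b vG mab => [//|b] vG _.
    by rewrite (vG.2 [::] isT v Uv Lv : G v = 0) mulr0.
  by rewrite (vF.2 [::] isT v Uv Lv : F v = 0) mul0r.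
move=> w; apply: (@van_eq _ _ _ (fun v => F v * 'D_w G v + 'D_w F v * G v)) => //.
  move=> v Uv; exact: (derive_fM w (smooth_diff1 vF.1 Uv) (smooth_diff1 vG.1 Uv)).
apply: (vanD oU).
  apply: (IH a b.-1 _ _ _ vF (van_derive w vG)).
  by case: b {vG} mab => [|b]; rewrite ?addn0 ?addnS //; exact: ltnW.
apply: (IH a.-1 b _ _ _ (van_derive w vF) vG).
by case: a {vF} mab => [|a]; rewrite ?add0n ?addSn //; exact: ltnW.
Qed.

Lemma van_succ_basis U m H : open U -> smooth_on U H ->
  (forall v, U v -> on_axis v -> H v = 0) ->
  (forall i, van U m ('D_(bvec i) H)) -> van U m.+1 H.
Proof.
move=> oU sH H0 h; apply: van_succ => // w.
apply: (van_eq oU (G := fun v => \sum_i w i ord0 * 'D_(bvec i) H v)) => [v Uv|].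
  by rewrite {1}[w]cV_sum_bvec (derive_sumv _ _ _ oU sH Uv).
apply: (van_sum _ oU) => i; apply: (van_eq oU _ (van_lin (w i ord0) 0 oU (h i) (van0 U m))) => v _.
by rewrite mulr0 addr0.
Qed.

Definition rho2 v : R := \sum_(i | i != ord0) v i ord0 ^+ 2.
Definition nrm2 v : R := \sum_i v i ord0 ^+ 2.
Definition tau v : R := Num.sqrt (rho2 v).

Lemma rho2_ge0 v : 0 <= rho2 v.
Proof. by apply: sumr_ge0 => i _; rewrite sqr_ge0. Qed.

Lemma nrm2_gt0 v : v != 0 -> 0 < nrm2 v.
Proof.
move=> v0; rewrite lt_neqAle sumr_ge0 ?andbT; last by move=> i _; rewrite sqr_ge0.
apply: contra v0; rewrite eq_sym psumr_eq0; last by move=> i _; rewrite sqr_ge0.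
move=> /allP h; apply/eqP/matrixP => i j; rewrite ord1 mxE.
by apply/eqP; have := h i; rewrite mem_index_enum sqrf_eq0; apply.
Qed.

Lemma rho2_le_nrm2 v : rho2 v <= nrm2 v.
Proof.
rewrite /nrm2 (bigID (fun i => i != ord0)) /= lerDl.
by apply: sumr_ge0 => i _; rewrite sqr_ge0.
Qed.

Lemma coord_le_tau v i : i != ord0 -> `|v i ord0| <= tau v.
Proof.
move=> i0; rewrite -sqrtr_sqr ler_wsqrtr // /rho2 (bigD1 i) //= lerDl.
by apply: sumr_ge0 => j _; rewrite sqr_ge0.
Qed.

(** A Taylor estimate in the distance [tau] to the axis. In the inductive step the mean value
    theorem is applied on the segment from the projection [p] of v to the axis up to v. There H
    changes by a combination of its partial derivatives with coefficients at most [tau v]. *)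
Lemma van_bound U m H v0 : open U -> van U m H -> U v0 -> on_axis v0 ->
  exists2 C : R, 0 <= C & \forall v \near v0, `|H v| <= C * tau v ^+ m.
Proof.
move=> oU; elim: m H => [|m IH] H vH Uv0 Lv0.
  exists (`|H v0| + 1); first by rewrite addr_ge0.
  have [/cvgrPdist_le cH _] := smooth_diff1 vH.1 Uv0.
  apply: filterS (cH 1 ltr01) => v hv; rewrite expr0 mulr1 -lerBlDl.
  by apply: le_trans hv; rewrite distrC lerB_dist.
have /choice [C hC] : forall i, exists C : R, 0 <= C /\ \forall v \near v0, `|'D_(bvec i) H v| <= C * tau v ^+ m.
  by move=> i; have [C C0 hC] := IH _ (van_derive (bvec i) vH) Uv0 Lv0; exists C.
exists (\sum_i C i); first by apply: sumr_ge0 => i _; exact: (hC i).1.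
have nn : nbhs v0 ([set v | forall i, `|'D_(bvec i) H v| <= C i * tau v ^+ m] `&` U).
  apply: filterI (open_nbhs_nbhs (conj oU Uv0)).
  by apply: (@filter_forall _ 'I_q.+1 (fun i v => `|'D_(bvec i) H v| <= C i * tau v ^+ m) (nbhs v0)) => i; exact: (hC i).2.
have [d d0 hd] := nbhs0_normP nn.
have nb : nbhs v0 [set v | `|v - v0| < d].
  apply/(nbhs_normP v0 (fun v => `|v - v0| < d)); exists d => //= v.
  by rewrite /= distrC.
apply: filterS nb => v /= vd.
pose c i : R := (i != ord0)%:R * v i ord0.
pose u : V := \sum_i c i *: bvec i.
have uE i : u i ord0 = c i.
  rewrite /u summxE (bigD1 i) //= !mxE !eqxx mulr1 big1 ?addr0 // => j ji.
  by rewrite !mxE eq_sym (negbTE ji) mulr0.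
pose p : V := v - u.
have pE i : p i ord0 = (i == ord0)%:R * v i ord0.
  rewrite /p !mxE uE /c; case: eqP => _ /=; rewrite ?mul1r ?mul0r ?subr0 ?subrr //.
have up : u + p = v by rewrite addrC subrK.
have uS : u = \sum_i c i *: bvec i by [].
clearbody u p.
have Lp : on_axis p by move=> i /negbTE i0; rewrite pE i0 mul0r.
(* In the maximum norm the ball around v0 contains, with v, the segment from p to v: the coordinate
   along the axis stays fixed and the others only shrink. *)
have near_p (t : R) : 0 <= t <= 1 -> `|t *: u + p - v0| < d.
  move=> /andP[t0 t1]; apply: le_lt_trans vd; apply: norm_cV_le => // i.
  rewrite !mxE uE pE /c; have [->|i0] := eqVneq i ord0.
    by rewrite mul0r mulr0 add0r mul1r; have := coord_le_norm (v - v0) ord0; rewrite !mxE.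
  rewrite mul1r mul0r addr0 Lv0 // subr0 normrM (ger0_norm t0).
  have := coord_le_norm (v - v0) i; rewrite !mxE Lv0 // subr0.
  by apply: le_trans; rewrite ler_piMl.
have hp (t : R) : 0 <= t <= 1 -> (forall i, `|'D_(bvec i) H (t *: u + p)| <= C i * tau (t *: u + p) ^+ m) /\ U (t *: u + p).
  by move=> /near_p /hd; rewrite subrK.
have [t tI|t /andP[t0 t1]] := @mvt_line R V H p u.
  exact: (smooth_diff1 vH.1 (hp t tI).2).
have tI : 0 <= t <= 1 by rewrite !ltW.
have I0 : (0 : R) <= 0 <= (1 : R) by rewrite ler01 lexx.
have Up := (hp 0 I0).2; rewrite scale0r add0r in Up.
rewrite up (vH.2 [::] isT p Up Lp : H p = 0) subr0 => ->.
have [hb Ut] := hp t tI.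
rewrite {2}uS (derive_sumv _ _ _ oU vH.1 Ut).
apply: le_trans (ler_norm_sum _ _ _) _.
rewrite mulr_suml; apply: ler_sum => i _; rewrite normrM exprS mulrCA.
apply: ler_pM => //.
  rewrite /c; have [_|i0] := eqVneq i ord0; first by rewrite mul0r normr0 sqrtr_ge0.
  by rewrite mul1r coord_le_tau.
apply: le_trans (hb i) _; rewrite ler_wpM2l ?(hC i).1 //.
rewrite lerXn2r ?nnegrE ?sqrtr_ge0 // ler_wsqrtr // /rho2.
apply: ler_sum => j j0; rewrite !mxE uE pE (negbTE j0) mul0r addr0 /c j0 mul1r.
rewrite exprMn ler_piMl ?sqr_ge0 // expr_le1 //; exact: ltW.
Qed.

End Vanishing.

Arguments bvec {R q} i.

Section Cutoff.
Variables (R : realType) (q : nat).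
Local Notation V := 'cV[R]_q.+1.
Implicit Types (v : V).

Definition punct : set V := [set v | v != 0].

Lemma open_punct : open punct.
Proof.
rewrite (_ : punct = (fun v => `|v|) @^-1` [set r : R | r != 0]).
  by apply: open_comp => [x _|]; [exact: norm_continuous|exact: open_neq].
by apply/seteqP; split => v; rewrite /punct /= normr_eq0.
Qed.

(** The squared sine of the angle between v and the axis. It has degree 0, so that a section
    multiplied by a function of it remains a section. *)
Definition ratio v : R := rho2 v / nrm2 v.

Lemma rho2E v : rho2 v = nrm2 v - v ord0 ord0 ^+ 2.
Proof. by rewrite /rho2 /nrm2 [in RHS](bigD1 ord0) //= addrAC subrr add0r. Qed.

Lemma smooth_nrm2 U : open U -> smooth_on U (@nrm2 R q).
Proof.
by move=> oU; apply: (smooth_sum _ oU) => i; exact: (smoothX 2 oU (coord_smooth i oU)).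
Qed.

Lemma smooth_rho2 U : open U -> smooth_on U (@rho2 R q).
Proof.
move=> oU; apply: (smooth_eq oU _ (smoothB oU (smooth_nrm2 oU) (smoothX 2 oU (coord_smooth ord0 oU)))).
by move=> v _; exact: rho2E.
Qed.

Lemma smooth_ratio : smooth_on punct ratio.
Proof.
have oU := open_punct.
apply: (smoothM oU (smooth_rho2 oU) (smooth_inv oU (smooth_nrm2 oU) _)).
by move=> v /nrm2_gt0 h; rewrite gt_eqF.
Qed.

Lemma ratio_ge0 v : 0 <= ratio v.
Proof. by rewrite divr_ge0 ?rho2_ge0 // sumr_ge0 // => i _; rewrite sqr_ge0. Qed.

Lemma ratio_eq0 v : v != 0 -> ratio v = 0 -> on_axis v.
Proof.
move=> v0 /eqP; rewrite mulf_eq0 invr_eq0 (gt_eqF (nrm2_gt0 v0)) orbF psumr_eq0; last first.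
  by move=> i _; rewrite sqr_ge0.
move=> /allP h i i0; have := h i (mem_index_enum _); rewrite i0 /= sqrf_eq0.
by move/eqP.
Qed.

Lemma ratio_axis v : on_axis v -> ratio v = 0.
Proof.
by move=> L; rewrite /ratio /rho2 big1 ?mul0r // => i /L ->; rewrite expr0n.
Qed.

Lemma ratioZ (c : R) v : c != 0 -> ratio (c *: v) = ratio v.
Proof.
move=> c0; rewrite /ratio.
have -> : rho2 (c *: v) = c ^+ 2 * rho2 v.
  by rewrite /rho2 mulr_sumr; apply: eq_bigr => i _; rewrite mxE exprMn.
have -> : nrm2 (c *: v) = c ^+ 2 * nrm2 v.
  by rewrite /nrm2 mulr_sumr; apply: eq_bigr => i _; rewrite mxE exprMn.
by rewrite -mulf_div divff ?mul1r // expf_neq0.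
Qed.

Variables (kap : R^o -> R).
Local Notation Dk i := (iterD (nseq i (1 : R^o)) kap).
Hypothesis kap_smooth : smooth_on setT kap.
Hypothesis kap_bound : forall i, exists C : R, forall s, 0 <= s ->
        `|Dk i s| <= C /\ (1 < s -> Dk i s = 0).

Lemma smooth_cut (c : R) : smooth_on punct (fun v => kap (c * ratio v)).
Proof.
exact: (smooth_comp1 openT open_punct kap_smooth (smoothZ c open_punct smooth_ratio) (fun _ _ => I)).
Qed.

(** A derivative that hits the cutoff costs one power of c, and one that hits the other factor costs
    one order of vanishing. The exponents and the functions [Hs] do not depend on c. *)
Lemma iterD_cut M (Phi : V -> R) w : van punct M Phi ->
  exists (I : finType) (ks : I -> nat) (Hs : I -> V -> R),
  [/\ forall i, (ks i <= size w)%N, forall i, van punct (M - size w) (Hs i) &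
    forall (c : R) v, punct v -> iterD w (fun v => kap (c * ratio v) * Phi v) v =
      \sum_i c ^+ ks i * (Dk (ks i) (c * ratio v) * Hs i v)].
Proof.
have oU := open_punct.
move=> vP; elim: w => [|v w [I [ks [Hs [hk vH e]]]]].
  exists unit, (fun=> 0%N), (fun=> Phi); split => //; first by move=> i; rewrite subn0.
  by move=> c v _; rewrite big_const card_unit /= addr0 mul1r.
exists (I + I)%type, (fun i => match i with inl i => ks i | inr i => (ks i).+1 end),
  (fun i => match i with inl i => 'D_v (Hs i) | inr i => fun x => 'D_v ratio x * Hs i x end).
split.
- by case=> i /=; rewrite ?ltnS // (leq_trans (hk i)).
- case=> i; first by rewrite /= subnS; exact: (van_derive v (vH i)).
  have v0 : van punct 0 ('D_v ratio) by split=> //; exact: (smooth_derive v smooth_ratio).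
  by apply: (vanM oU _ v0 (vH i)); rewrite /= subnS leq_pred.
move=> c x Ux /=.
have dr := smooth_diff1 (smoothZ c oU smooth_ratio) Ux.
have dk i := @diff1_comp1 R V _ (fun v => c * ratio v) x (smooth_diff1 (smooth_iterD (nseq (ks i) (1 : R^o)) kap_smooth) (Logic.I : setT (c * ratio x))) dr.
have dH i := smooth_diff1 (vH i).1 Ux.
rewrite (@near_eq_derive _ _ _ _ (fun v => \sum_i c ^+ ks i * (Dk (ks i) (c * ratio v) * Hs i v))); last first.
  have := open_nbhs_nbhs (conj oU Ux); apply: filterS => y Uy; exact: e.
have d1 i := diff1M (dk i).1 (dH i).
rewrite derive_fsum; last by move=> i; exact: (diff1M (diff1_cst _ _) (d1 i)).
rewrite big_sumType /= -big_split /=; apply: eq_bigr => i _.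
rewrite (derive_fM v (diff1_cst (c ^+ ks i) x) (d1 i)) derive_cst mul0r addr0.
rewrite (derive_fM v (dk i).1 (dH i)) (dk i).2.
rewrite (derive_fM v (diff1_cst c x) (smooth_diff1 smooth_ratio Ux)) derive_cst mul0r addr0.
rewrite /cst exprS /=; ring.
Qed.

(* On the support of the cutoff, ratio <= e: the vanishing of Phi compensates the
   powers of e^-1 produced by the derivatives of the cutoff. *)
Lemma cut_decay N w (Phi : V -> R) v0 (d : R) :
  van punct (N + (N.+1).*2) Phi -> (size w <= N)%N -> punct v0 -> 0 < d ->
  \forall v \near v0 & e \near (0 : R)^'+,
    `|iterD w (fun v => kap (e^-1 * ratio v) * Phi v) v| < d.
Proof.
have oU := open_punct.
move=> vP sw U0 d0; have [I [ks [Hs [hk vH e]]]] := iterD_cut w vP.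
have nU : nbhs v0 punct by exact: open_nbhs_nbhs (conj oU U0).
have [cr _] := smooth_diff1 smooth_ratio U0.
(* Away from the axis the argument of the cutoff exceeds 1 for small e, uniformly near v0, and all
   terms vanish. *)
have := ratio_ge0 v0; rewrite le_eqVlt => /orP[/eqP r0|r0]; last first.
  have p0 : 0 < ratio v0 / 2 by rewrite divr_gt0.
  have hr : \forall v \near v0, ratio v0 / 2 < ratio v.
    apply: (cvgr_gt _ cr); rewrite ltr_pdivrMr // ltr_pMr // ltr1n //.
  near=> v x => /=.
  have x0 : 0 < x by near: x; exact: nbhs_right_gt.
  have x1 : x < ratio v0 / 2 by near: x; exact: nbhs_right_lt.
  have hv : ratio v0 / 2 < ratio v by near: v.
  rewrite e; last by near: v.
  rewrite big1 ?normr0 // => i _.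
  have [C hC] := kap_bound (ks i).
  have h1 : 1 < x^-1 * ratio v by rewrite mulrC ltr_pdivlMr // mul1r (lt_trans x1).
  by rewrite (hC _ (ltW (lt_trans ltr01 h1))).2 // mul0r mulr0.
have L0 := ratio_eq0 U0 (esym r0).
have /choice [C hC] := fun i => kap_bound (ks i).
(* After at most N derivatives the order of vanishing is still at least 2(N + 1). Where ratio <= e
   this gives tau^(2(N+1)) <= (e S)^(N+1), and the cutoff costs at most N powers of e^-1, so that a
   factor e remains. *)
have /choice [B hB] : forall i, exists B : R, 0 <= B /\ \forall v \near v0, `|Hs i v| <= B * tau v ^+ (N.+1).*2.
  move=> i; have vi : van punct (N.+1).*2 (Hs i).
    by apply: van_le (vH i); rewrite -addnBAC // leq_addl.
  by have [B B0 nB] := van_bound oU vi U0 L0; exists B.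
have nB : \forall v \near v0, forall i, `|Hs i v| <= B i * tau v ^+ (N.+1).*2.
  by apply: (@filter_forall _ I (fun i v => `|Hs i v| <= B i * tau v ^+ (N.+1).*2) (nbhs v0)) => i; exact: (hB i).2.
pose S := nrm2 v0 + 1.
have S0 : 0 <= S by rewrite addr_ge0 // ltW // nrm2_gt0.
have nS : \forall v \near v0, nrm2 v < S.
  have [cn _] := smooth_diff1 (smooth_nrm2 oU) U0.
  by apply: (cvgr_lt _ cn); rewrite ltrDl.
have C0 i : 0 <= C i by apply: le_trans (hC i 0 (lexx _)).1.
pose T := \sum_i C i * B i * S ^+ N.+1.
have T0 : 0 <= T.
  by apply: sumr_ge0 => i _; rewrite !mulr_ge0 ?exprn_ge0 ?(hB i).1.
have p0 : 0 < d / (T + 1) by rewrite divr_gt0 // ltr_wpDl.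
near=> v x => /=.
have x0 : 0 < x by near: x; exact: nbhs_right_gt.
have x1 : x < 1 by near: x; exact: nbhs_right_lt.
have x2 : x < d / (T + 1) by near: x; exact: nbhs_right_lt.
have Uv : punct v by near: v.
have hb : forall i, `|Hs i v| <= B i * tau v ^+ (N.+1).*2 by near: v.
have hS : nrm2 v < S by near: v.
rewrite e // {e}.
apply: (@le_lt_trans _ _ (x * T)); last first.
  rewrite ltr_pdivlMr ?ltr_wpDl // in x2; apply: le_lt_trans x2.
  by rewrite ler_wpM2l ?lerDl // ltW.
apply: le_trans (ler_norm_sum _ _ _) _; rewrite /T mulr_sumr.
apply: ler_sum => i _; set k := ks i.
have rhs0 : 0 <= x * (C i * B i * S ^+ N.+1).
  by rewrite !mulr_ge0 ?exprn_ge0 ?(hB i).1 // ltW.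
have y0 : 0 <= x^-1 * ratio v by rewrite mulr_ge0 ?ratio_ge0 // invr_ge0 ltW.
have [h1|h1] := ltP 1 (x^-1 * ratio v).
  by rewrite (hC i _ y0).2 // mul0r mulr0 normr0.
rewrite mulrC ler_pdivrMr // mul1r in h1.
have ht : tau v ^+ (N.+1).*2 <= x ^+ N.+1 * S ^+ N.+1.
  rewrite -mul2n exprM sqr_sqrtr ?rho2_ge0 // -exprMn.
  rewrite lerXn2r ?nnegrE ?rho2_ge0 ?mulr_ge0 // ?(ltW x0) //.
  have -> : rho2 v = ratio v * nrm2 v by rewrite divfK // gt_eqF // nrm2_gt0.
  by apply: ler_pM => //; [exact: ratio_ge0|exact: le_trans (rho2_ge0 v) (rho2_le_nrm2 v)|exact: ltW].
rewrite normrM normrX (gtr0_norm (_ : 0 < x^-1)) ?invr_gt0 //.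
apply: (@le_trans _ _ (x^-1 ^+ k * (C i * (B i * (x ^+ N.+1 * S ^+ N.+1))))).
  apply: ler_wpM2l; first by rewrite exprn_ge0 // invr_ge0 ltW.
  rewrite normrM; apply: ler_pM => //; first exact: (hC i _ y0).1.
  by apply: le_trans (hb i) _; rewrite ler_wpM2l ?(hB i).1.
have kN : (k <= N)%N by exact: leq_trans (hk i) sw.
have -> : x^-1 ^+ k * (C i * (B i * (x ^+ N.+1 * S ^+ N.+1))) =
    (x^-1 ^+ k * x ^+ N.+1) * (C i * B i * S ^+ N.+1) by ring.
rewrite ler_wpM2r ?mulr_ge0 ?exprn_ge0 ?(hB i).1 //.
rewrite exprVn mulrC -expfB_cond; last by rewrite gt_eqF // add0n leqW.
rewrite subSn // exprS ler_piMr ?(ltW x0) // exprn_ile1 // ltW.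
Unshelve. all: by end_near. Qed.

End Cutoff.

Section ComplexSmooth.
Variables (R : realType) (V : normedModType R).
Implicit Types (U : set V) (f g : V -> R[i]).

Definition csmooth U f := forall b, smooth_on U (fun v => reim b (f v)).

Lemma csmooth_eq U f g : open U -> (forall v, U v -> f v = g v) -> csmooth U g -> csmooth U f.
Proof. by move=> oU e sg b; apply: (smooth_eq oU _ (sg b)) => v /e ->. Qed.

Lemma csmooth_cst U (c : R[i]) : csmooth U (fun=> c).
Proof. by move=> b; exact: smooth_cst. Qed.

Lemma csmoothD U f g : open U -> csmooth U f -> csmooth U g ->
  csmooth U (fun v => f v + g v).
Proof.
move=> oU sf sg b; apply: (smooth_eq oU _ (smoothD oU (sf b) (sg b))) => v _.
by case: (f v) (g v) => ? ? [? ?]; case: b.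
Qed.

Lemma csmoothM U f g : open U -> csmooth U f -> csmooth U g ->
  csmooth U (fun v => f v * g v).
Proof.
move=> oU sf sg [].
  apply: (smooth_eq oU _ (smoothD oU (smoothM oU (sf false) (sg true)) (smoothM oU (sf true) (sg false)))) => v _.
  by case: (f v) (g v) => ? ? [? ?].
apply: (smooth_eq oU _ (smoothB oU (smoothM oU (sf false) (sg false)) (smoothM oU (sf true) (sg true)))) => v _.
by case: (f v) (g v) => ? ? [? ?].
Qed.

Lemma csmooth_real U (F : V -> R) : open U -> smooth_on U F ->
  csmooth U (fun v => real_complex R (F v)).
Proof. by move=> oU sF []; [exact: smooth_cst|exact: sF]. Qed.

Lemma csmoothX U f n : open U -> csmooth U f -> csmooth U (fun v => f v ^+ n).
Proof.
move=> oU sf; elim: n => [|n IH]; first exact: csmooth_cst.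
by apply: (csmooth_eq oU _ (csmoothM oU sf IH)) => v _; rewrite exprS.
Qed.

Lemma csmooth_chi U a la (F : V -> R) : open U -> smooth_on U F ->
  (forall v, U v -> F v != 0) -> csmooth U (fun v => chi a la (F v)).
Proof.
move=> oU sF F0 b.
exact: (smooth_comp1 (@open_neq0 R) oU (smooth_chi a la b) sF F0).
Qed.

End ComplexSmooth.

(** * Sections as homogeneous functions *)

Section Matrices.
Variable R : realType.

Lemma mx_coord_smooth m n (U : set 'M[R]_(m, n)) i j : open U -> smooth_on U (fun x => x i j).
Proof.
move=> oU; apply: (smooth_linear oU); first exact: coord_continuous.
by move=> h v x; rewrite !mxE.
Qed.

Lemma smooth_det k (U : set 'M[R]_k) : open U -> smooth_on U (fun x => \det x).
Proof.
move=> oU; apply: (smooth_sum _ oU) => s.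
apply: (smoothZ _ oU); apply: (smooth_prod _ oU) => i; exact: mx_coord_smooth.
Qed.

Lemma linear_mx_continuous m n m' n' (f : 'M[R]_(m, n) -> 'M[R]_(m', n')) :
  linear f -> continuous f.
Proof.
move=> lf.
have [g gE] : exists g : {linear 'M[R]_(m, n) -> 'M[R]_(m', n')}, g =1 f.
  pose Lf := GRing.isLinear.Build _ _ _ _ f lf.
  pose g : {linear 'M[R]_(m, n) -> 'M[R]_(m', n')} := HB.pack f Lf.
  by exists g.
rewrite (_ : f = fun y : 'M[R]_(m, n) => \sum_i \sum_j y i j *: f (delta_mx i j)).
  apply: sum_continuous => i; apply: sum_continuous => j x.
  have cc : (fun=> f (delta_mx i j)) @ x --> f (delta_mx i j) by exact: cst_continuous.
  exact: (cvgZ (@coord_continuous R m n i j x) cc).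
apply/funext => y; rewrite -gE [in LHS](matrix_sum_delta y) linear_sum.
apply: eq_bigr => i _; rewrite linear_sum; apply: eq_bigr => j _.
by rewrite linearZ gE.
Qed.

Lemma col_continuous m n (j : 'I_n) : continuous (fun x : 'M[R]_(m, n) => col j x).
Proof.
by apply: linear_mx_continuous => a x y; apply/matrixP => i k; rewrite !mxE.
Qed.

End Matrices.

(** * The parabolic subgroup as the stabiliser of the line R e_0 *)

Section Parabolic.
Variables (R : realType) (k : nat).

Lemma bvec0E : bvec ord0 = col_mx 1%:M 0 :> 'cV[R]_(1 + k).
Proof.
apply/matrixP => i j; rewrite ord1; case: (split_ordP i) => l ->.
  by rewrite col_mxEu !ord1 !mxE.
by rewrite col_mxEd !mxE.
Qed.

Lemma par_mul_col (h : 'M[R]_k) t (x : 'rV[R]_k) (a : 'M[R]_1) (y : 'cV[R]_k) :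
  par_M h *m par_A k t *m par_N x *m col_mx a y =
  col_mx (((\det h)^-1 * expR t) *: (a + x *m y)) (expR (- (t / k%:R)) *: (h *m y)).
Proof.
rewrite /par_M /par_A /par_N -!mulmxA !mul_block_col !mul1mx !mul0mx !add0r !addr0.
by rewrite !mul_scalar_mx scalerA -scalemxAr.
Qed.

Lemma SLpm_det (h : 'M[R]_k) : h \in @SLpmpred R k -> \det h = 1 \/ \det h = -1.
Proof.
rewrite inE => /eqP; case: (lerP 0 (\det h)) => [h0|h0].
  by rewrite ger0_norm // => ->; left.
by rewrite ltr0_norm // => /(congr1 -%R); rewrite opprK => ->; right.
Qed.

(** The scalar c determines the factor in A and the sign of [det h]: e^t = |c|, and the determinant
    of h is the sign of c. The rest of the first row gives the factor in N_+. *)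
Lemma par_decomp (p : SL R k.+1) (c : R) : (0 < k)%N -> col ord0 (val p) = c *: bvec ord0 ->
  exists h t x, [/\ h \in @SLpmpred R k, val p = par_M h *m par_A k t *m par_N x &
    c = (\det h)^-1 * expR t].
Proof.
move=> k0 hp; pose P : 'M[R]_(1 + k) := val p.
have PE : P = block_mx c%:M (ursubmx P) 0 (drsubmx P).
  rewrite -[LHS]submxK; congr block_mx.
    apply/matrixP => i j; rewrite !ord1 !mxE eqxx mulr1n.
    by move/matrixP/(_ ord0 ord0): hp; rewrite !mxE eqxx mulr1 => <-; congr (P _ _); apply/val_inj.
  apply/matrixP => i j; rewrite !ord1 !mxE.
  move/matrixP/(_ (rshift 1 i) ord0): hp; rewrite !mxE /= mulr0 => <-.
  by congr (P _ _); apply/val_inj.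
have dP : c * \det (drsubmx P) = 1.
  by rewrite -(SL_det p) -[RHS]/(\det P) [in RHS]PE det_ublock det_scalar1.
have c0 : c != 0 by apply: contra_eq_neq dP => ->; rewrite mul0r eq_sym oner_neq0.
have nc0 : 0 < `|c| by rewrite normr_gt0.
set h0 := drsubmx P in PE dP; pose t := ln `|c|.
have et : expR t = `|c| by rewrite lnK.
pose h := expR (t / k%:R) *: h0.
have k0' : k%:R != 0 :> R by rewrite pnatr_eq0 -lt0n.
have dh : \det h = `|c| / c.
  rewrite /h detZ -expRM_natr divfK // et; congr (_ * _).
  by apply: (mulfI c0); rewrite dP divff.
have dhc : (\det h)^-1 * expR t = c.
  by rewrite dh et invf_div divfK // gt_eqF.
exists h, t, (c^-1 *: ursubmx P); split=> //.
  by rewrite inE dh normrM normfV normr_id divff // gt_eqF.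
rewrite -[LHS]/P [LHS]PE /par_M /par_A /par_N !mulmx_block !mul0mx !mulmx0 !mulmx1 !addr0 !add0r.
rewrite -!scalar_mxM dhc mul_scalar_mx scalerA divff // scale1r.
by rewrite mul_mx_scalar /h scalerA -expRD addNr expR0 scale1r mul0mx add0r.
Qed.

(** The argument of [chi] is the factor by which m a n multiplies e_0. This translates equivariance
    under P into homogeneity under [chi]. *)
Lemma invmx_char (a : bool) (la : R[i]) (h : 'M[R]_k) (t : R) : h \in @SLpmpred R k ->
  invmx (cexp (la * real_complex R t) *: sgn_tensor a (fun _ : 'M[R]_k => 1%:M : 'M[R[i]]_1) h) =
  (chi a la ((\det h)^-1 * expR t))%:M.
Proof.
move=> hh; rewrite /sgn_tensor scalerA scalemx1 invmx_scalar; congr (_%:M).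
have cN : cexp (- (la * real_complex R t)) = (cexp (la * real_complex R t))^-1.
  apply: (@mulrI _ (cexp (la * real_complex R t))).
    by rewrite unitfE; apply/eqP => e; have := cexpD (la * real_complex R t) (- (la * real_complex R t));
       rewrite subrr cexp0 e mul0r => /eqP; rewrite oner_eq0.
  rewrite -cexpD subrr cexp0 divff //.
  by apply/eqP => e; have := cexpD (la * real_complex R t) (- (la * real_complex R t));
       rewrite subrr cexp0 e mul0r => /eqP; rewrite oner_eq0.
rewrite /chi invfM mulrC -cN.
have [->|->] := SLpm_det hh.
  by rewrite invr1 mul1r (gtr0_sg (expR_gt0 t)) (gtr0_norm (expR_gt0 t)) expRK sgr1 mulNr expr1n invr1.
rewrite invrN1 mulN1r !sgrN normrN (gtr0_sg (expR_gt0 t)) (gtr0_norm (expR_gt0 t)) expRK mulNr.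
by rewrite sgr1 -exprVn -fmorphV invrN1.
Qed.

End Parabolic.

Section Charts.
Variables (R : realType) (q : nat).
Local Notation V := 'cV[R]_q.+1.

(** The matrix of the transposition (0 i) with its first column replaced by v. It is affine in v and
    invertible where v_i is not 0, and so lifts v locally to GL. *)
Definition chart (i : 'I_q.+1) (v : V) : 'M[R]_q.+1 :=
  v *m (delta_mx ord0 ord0 : 'rV[R]_q.+1) +
  tperm_mx ord0 i *m (block_mx 0 0 0 1%:M : 'M[R]_(1 + q)).

Lemma chart_affine i (h : R) (v x : V) :
  chart i (h *: v + x) = h *: (v *m (delta_mx ord0 ord0 : 'rV[R]_q.+1)) + chart i x.
Proof. by rewrite /chart mulmxDl scalemxAl addrA. Qed.

Lemma chart_continuous i : continuous (chart i).
Proof.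
have c1 : continuous (fun v : V => v *m (delta_mx ord0 ord0 : 'rV[R]_q.+1)).
  by apply: linear_mx_continuous => c x y; rewrite mulmxDl scalemxAl.
by move=> v; apply: (cvgD (c1 v)); exact: cvg_cst.
Qed.

Lemma chart_col0 i v : col ord0 (chart i v) = v.
Proof.
have B0 : (block_mx 0 0 0 1%:M : 'M[R]_(1 + q)) *m delta_mx ord0 ord0 = 0 :> 'cV[R]_(1 + q).
  rewrite -[delta_mx _ _]/(bvec ord0 : 'cV[R]_(1 + q)) bvec0E mul_block_col.
  by rewrite !mul0mx !mulmx0 !addr0 col_mx0.
rewrite colE /chart mulmxDl -!mulmxA mul_delta_mx B0.
rewrite mulmx0 addr0 -[RHS]mulmx1; congr (_ *m _).
by apply/matrixP => r s; rewrite !ord1 !mxE !eqxx.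
Qed.

Lemma det_chart i v : \det (chart i v) = \det (tperm_mx ord0 i : 'M[R]_q.+1) * v i ord0.
Proof.
set T : 'M[R]_q.+1 := tperm_mx ord0 i.
have TT : T *m T = 1%:M by rewrite -perm_mxM tperm2 perm_mx1.
pose u : 'cV[R]_(1 + q) := T *m v.
have rE : delta_mx ord0 ord0 = row_mx 1%:M 0 :> 'rV[R]_(1 + q).
  apply/matrixP => r s; rewrite [r]ord1; case: (split_ordP s) => l ->.
    by rewrite row_mxEl !ord1 !mxE.
  by rewrite row_mxEr !mxE.
have -> : chart i v = T *m (u *m (delta_mx ord0 ord0 : 'rV[R]_(1 + q)) + block_mx 0 0 0 1%:M).
  by rewrite mulmxDr !mulmxA TT mul1mx.
rewrite rE.
rewrite det_mulmx; congr (_ * _).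
rewrite -[u]vsubmxK mul_col_row add_block_mx !mulmx1 !mulmx0 !addr0 add0r.
have dl := @det_lblock R 1 q (usubmx u) (dsubmx u) 1%:M.
rewrite det1 mulr1 in dl; transitivity (\det (usubmx u)); first exact: dl.
rewrite [usubmx u]mx11_scalar det_scalar1 mxE /u -row_permE mxE.
by rewrite (_ : lshift q ord0 = ord0) ?tpermL //; apply/val_inj.
Qed.

Lemma det_tperm_neq0 i : \det (tperm_mx ord0 i : 'M[R]_q.+1) != 0.
Proof. by rewrite det_perm signr_eq0. Qed.

Lemma exists_coord (v : V) : v != 0 -> exists i, v i ord0 != 0.
Proof.
move=> v0; apply: contrapT => h; move/eqP: v0; apply.
apply/matrixP => i j; rewrite ord1 mxE; apply/eqP.
by apply/negPn/negP => vi; apply: h; exists i.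
Qed.

Lemma exists_SL_col0 (v : V) : (0 < q)%N -> v != 0 ->
  exists g : SL R q.+1, col ord0 (val g) = v.
Proof.
move=> q0 /exists_coord [i vi]; set X := chart i v.
have d0 : \det X != 0 by rewrite det_chart mulf_neq0 ?det_tperm_neq0.
(* The determinant is corrected in the last column, which differs from the first as q > 0. *)
pose D : 'rV[R]_q.+1 := \row_j (if j == ord_max then (\det X)^-1 else 1).
have hg : X *m diag_mx D \in @SLpred R q.+1.
  rewrite inE det_mulmx det_diag (bigD1 ord_max) //= mxE eqxx big1 ?mulr1 ?divff //.
  by move=> j /negbTE hj; rewrite mxE hj.
exists (MkSL hg); rewrite /= -[RHS](chart_col0 i).
apply/matrixP => r s; rewrite !ord1 [LHS]mxE [RHS]mxE mul_mx_diag [LHS]mxE [D _ _]mxE.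
by rewrite (_ : ord0 == ord_max = false) ?mulr1 // -val_eqE /= eq_sym; apply/negbTE; rewrite -lt0n.
Qed.

Lemma SL_col0_neq0 (g : SL R q.+1) : col ord0 (val g) != 0.
Proof.
apply/eqP => e; have := SL_det g; rewrite (expand_det_col _ ord0) big1 => [/esym/eqP|i _].
  by rewrite oner_eq0.
by move/matrixP/(_ i ord0): e; rewrite !mxE => ->; rewrite mul0r.
Qed.

Lemma col0_neq0 (x : 'M[R]_q.+1) : GLset x -> col ord0 x != 0.
Proof.
move=> /eqP h; apply/eqP => e; apply: h; rewrite (expand_det_col _ ord0) big1 // => i _.
by move/matrixP/(_ i ord0): e; rewrite !mxE => ->; rewrite mul0r.
Qed.

Lemma col0_retract (x : 'M[R]_q.+1) : col ord0 (sl_retract x) = (\det x)^-1 *: col ord0 x.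
Proof.
apply/matrixP => i j; rewrite /sl_retract [LHS]mxE mul_mx_diag !mxE eqxx.
by rewrite mulrC.
Qed.

Lemma retractP (x : 'M[R]_q.+1) : GLset x -> sl_retract x \in @SLpred R q.+1.
Proof.
move=> x0; rewrite inE /sl_retract det_mulmx det_diag (bigD1 ord0) //= mxE eqxx.
rewrite big1 ?mulr1 ?divff // => j /negbTE hj.
by rewrite mxE hj.
Qed.

Lemma gl_extE d (f : SL R q.+1 -> 'cV[R[i]]_d) x : GLset x ->
  exists2 g, val g = sl_retract x & gl_ext f x = f g.
Proof.
move=> x0; rewrite /gl_ext; case: insubP => [g _ gE|]; first by exists g.
by rewrite retractP.
Qed.

End Charts.

Section Sections.
Variables (R : realType) (q : nat) (a : bool) (la : R[i]).
Hypothesis q_gt0 : (0 < q)%N.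
Local Notation V := 'cV[R]_q.+1.
Local Notation rep := (sgn_tensor a (fun _ : 'M[R]_q => 1%:M : 'M[R[i]]_1)).
Local Notation chi := (chi a la).

Definition homogeneous (phi : V -> R[i]) :=
  forall (c : R) v, c != 0 -> v != 0 -> phi (c *: v) = chi c * phi v.

(** Both conditions concern nonzero vectors only; the value of phi at 0 is arbitrary. *)
Definition isec phi := csmooth (@punct R q) phi /\ homogeneous phi.

Definition sec (phi : V -> R[i]) (g : SL R q.+1) : 'cV[R[i]]_1 :=
  const_mx (phi (col ord0 (val g))).

Lemma gl_ext_sec phi x : homogeneous phi -> GLset x ->
  gl_ext (sec phi) x = const_mx (chi (\det x)^-1 * phi (col ord0 x)).
Proof.
move=> hp x0; have [g gE ->] := gl_extE (sec phi) x0.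
by rewrite /sec gE col0_retract hp ?invr_neq0 // col0_neq0.
Qed.

Lemma open_GL : open (@GLset R q.+1).
Proof. exact: open_GLset. Qed.

Lemma csmooth_chi_detV : csmooth (@GLset R q.+1) (fun x => chi (\det x)^-1).
Proof.
have oU := open_GL.
apply: (csmooth_chi _ _ oU) => [|x x0]; last by rewrite invr_neq0.
exact: (smooth_inv oU (smooth_det oU) (fun _ h => h)).
Qed.

Lemma smooth_sec phi : isec phi -> smooth (sec phi).
Proof.
move=> [sp hp] i b; have oU := open_GL.
have sc : csmooth (@GLset R q.+1) (fun x => phi (col ord0 x)).
  have cA (h : R) (v x : 'M[R]_q.+1) : col ord0 (h *: v + x) = h *: col ord0 v + col ord0 x.
    by apply/matrixP => r s; rewrite !mxE.
  move=> b'; exact: (smooth_affine cA (@col_continuous R q.+1 q.+1 ord0) (@col0_neq0 R q) (sp b')).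
apply: (smooth_eq oU _ (csmoothM oU csmooth_chi_detV sc b)) => x x0.
by rewrite /gl_comp gl_ext_sec // mxE.
Qed.

Lemma sec_Ind phi : isec phi -> sec phi \in Ind_pred rep la.
Proof.
move=> ip; rewrite inE; split; first exact: smooth_sec.
move=> g p h t x hh hp; rewrite (invmx_char _ _ _ hh).
have c0 : (\det h)^-1 * expR t != 0.
  have dh0 : \det h != 0 by have [->|->] := SLpm_det hh; rewrite ?oppr_eq0 oner_eq0.
  by rewrite mulf_neq0 ?invr_neq0 // expR_eq0.
have cp : col ord0 (val (g * p)%g) = ((\det h)^-1 * expR t) *: col ord0 (val g).
  rewrite SL_valM !colE -mulmxA scalemxAr; congr (_ *m _).
  rewrite hp -[delta_mx _ _]/(bvec ord0 : 'cV[R]_(1 + q)) bvec0E par_mul_col.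
  rewrite !mulmx0 addr0 scaler0.
  have e := @scale_col_mx R 1 q 1 ((\det h)^-1 * expR t) 1%:M 0.
  by rewrite scaler0 in e; exact: esym e.
rewrite /sec cp ip.2 ?SL_col0_neq0 // mul_scalar_mx.
by apply/matrixP => i j; rewrite !mxE.
Qed.

Lemma Ind_col f (g g' : SL R q.+1) c : f \in Ind_pred rep la -> c != 0 ->
  col ord0 (val g') = c *: col ord0 (val g) -> f g' = chi c *: f g.
Proof.
rewrite inE => -[_ hf] c0 e.
have [] := @par_decomp R q (g^-1 * g')%g c q_gt0.
  rewrite colE SL_valM -mulmxA -colE e -scalemxAr colE mulmxA SL_valV mulVmx ?SL_unit //.
  by rewrite mul1mx.
move=> h [t [x [hh hp ce]]].
by rewrite -(mulKVg g g') (hf _ _ _ _ _ hh hp) (invmx_char _ _ _ hh) -ce mul_scalar_mx.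
Qed.

(** The inverse of [sec]. By [Ind_col] with c = 1 the choice of g with first column v does not
    matter; at v = 0 there is no such g and the default g = 1 is used. *)
Definition phi_of (f : SL R q.+1 -> 'cV[R[i]]_1) (v : V) : R[i] :=
  f (xget 1%g [set g : SL R q.+1 | col ord0 (val g) = v]) ord0 ord0.

Lemma phi_ofE f (g : SL R q.+1) : f \in Ind_pred rep la ->
  phi_of f (col ord0 (val g)) = f g ord0 ord0.
Proof.
move=> hf; rewrite /phi_of; case: xgetP => [g' _ /= e|h].
  by rewrite (Ind_col hf (oner_neq0 _) (_ : _ = 1 *: col ord0 (val g))) ?scale1r // chi1 scale1r.
by exfalso; exact: (h g).
Qed.

Lemma sec_phi_of f : f \in Ind_pred rep la -> f = sec (phi_of f).
Proof.
move=> hf; apply/funext => g; apply/matrixP => i j.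
by rewrite !ord1 mxE phi_ofE.
Qed.

Lemma homogeneous_phi_of f : f \in Ind_pred rep la -> homogeneous (phi_of f).
Proof.
move=> hf c v c0 v0.
have [g gE] := exists_SL_col0 q_gt0 v0.
have cv0 : c *: v != 0 by rewrite scaler_eq0 negb_or c0.
have [g' gE'] := exists_SL_col0 q_gt0 cv0.
rewrite -gE' -[in RHS]gE !phi_ofE //.
by rewrite (Ind_col hf c0 (_ : _ = c *: col ord0 (val g))) ?mxE // gE' gE.
Qed.

Lemma isec_phi_of f : f \in Ind_pred rep la -> isec (phi_of f).
Proof.
move=> hf; split; last exact: homogeneous_phi_of.
move=> b; apply: smooth_local => v /exists_coord [i vi].
have oU : open [set v : V | v i ord0 != 0].
  rewrite (_ : [set _ | _] = (fun v : V => v i ord0) @^-1` [set r : R | r != 0]) //.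
  by apply: open_comp => [x _|]; [exact: coord_continuous|exact: open_neq].
exists [set v : V | v i ord0 != 0].
(* [gl_ext] evaluates f at the retraction, whose first column is v divided by the determinant of the
   chart; the factor [chi] undoes this division. *)
exists (fun v => reim b (chi (\det (chart i v)) * gl_ext f (chart i v) ord0 ord0)).
have cGL (u : V) : u i ord0 != 0 -> GLset (chart i u).
  by move=> vi'; rewrite /GLset /= det_chart mulf_neq0 ?det_tperm_neq0.
have oGL := open_GL.
split => //.
  have [sf _] : smooth f /\ True by move: hf; rewrite inE => -[].
  have s2 : csmooth (@GLset R q.+1) (fun x => gl_ext f x ord0 ord0) by move=> b'; exact: sf.
  have s1 := csmooth_chi a la oGL (smooth_det oGL) (fun _ h => h).
  exact: (smooth_affine (chart_affine i) (@chart_continuous R q i) cGL (csmoothM oGL s1 s2 b)).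
move=> u ui; congr (reim b _); have [g gE ->] := gl_extE f (cGL u ui).
rewrite -(phi_ofE g hf) gE col0_retract chart_col0.
rewrite (homogeneous_phi_of hf) ?invr_neq0 ?(cGL u ui) //.
  by rewrite chiV ?(cGL u ui) // mulVKf // ?chi_neq0 ?(cGL u ui).
by apply: contraNneq ui => ->; rewrite mxE.
Qed.

End Sections.

(** * Cutting off sections near the axis *)

Section CutSmall.
Variable R : realType.

Lemma sum_decay (T : Type) (F : set_system T) (FF : Filter F) (I : Type) (r : seq I)
    (c t : I -> T -> R) (l : I -> R) :
  (forall i, c i x @[x --> F] --> l i) -> (forall i, t i x @[x --> F] --> (0 : R)) ->
  (\sum_(i <- r) c i x * t i x) @[x --> F] --> (0 : R).
Proof.
move=> hc ht; elim: r => [|i r IH].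
  rewrite (_ : (fun x => _) = fun=> 0); first exact: cvg_cst.
  by apply/funext => x; rewrite big_nil.
rewrite (_ : (fun x => _) = fun x => c i x * t i x + \sum_(j <- r) c j x * t j x); last first.
  by apply/funext => x; rewrite big_cons.
by have := cvgD (cvgM (hc i) (ht i)) IH; rewrite mulr0 addr0; exact.
Qed.

(** The entries of the real 2 x 2 matrix of multiplication by z. *)
Definition mul_coef (b b' : bool) (z : R[i]) : R :=
  if b == b' then complex.Re z else if b then complex.Im z else - complex.Im z.

Lemma reim_mul b (z w : R[i]) :
  reim b (z * w) = \sum_(b' : bool) mul_coef b b' z * reim b' w.
Proof.
rewrite big_bool; case: z w => z1 z2 [w1 w2]; case: b => /=; rewrite /mul_coef /=; ring.
Qed.

Lemma smooth_mul_coef (V : normedModType R) (U : set V) (f : V -> R[i]) b b' :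
  open U -> csmooth U f -> smooth_on U (fun v => mul_coef b b' (f v)).
Proof.
move=> oU sf; rewrite /mul_coef; case: eqP => _; first exact: (sf false).
case: b; first exact: (sf true).
exact: (smoothN oU (sf true)).
Qed.

Variables (q : nat) (a : bool) (la : R[i]).
Local Notation V := 'cV[R]_q.+1.
Local Notation M := 'M[R]_q.+1.
Variables (kap : R^o -> R).
Local Notation Dk i := (iterD (nseq i (1 : R^o)) kap).
Hypothesis kap_smooth : smooth_on setT kap.
Hypothesis kap_bound : forall i, exists C : R, forall s, 0 <= s ->
        `|Dk i s| <= C /\ (1 < s -> Dk i s = 0).

Definition cutoff (e : R) (phi : V -> R[i]) (v : V) : R[i] :=
  real_complex R (kap (e^-1 * ratio v)) * phi v.

Lemma isec_cutoff e phi : isec a la phi -> isec a la (cutoff e phi).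
Proof.
move=> [sp hp]; split; last by move=> c v c0 v0; rewrite /cutoff ratioZ // hp // mulrCA.
have oU := @open_punct R q.
exact: (csmoothM oU (csmooth_real oU (smooth_cut kap_smooth e^-1)) sp).
Qed.

Lemma reim_cutoff b e phi v : reim b (cutoff e phi v) = kap (e^-1 * ratio v) * reim b (phi v).
Proof. by rewrite /cutoff; case: (phi v) => x y; case: b => /=; ring. Qed.

(** As the data are chosen before phi, one expansion covers all the cut off sections while the
    cutoff shrinks. *)
Lemma iterD_gl_comp b w : exists (I : finType) (cs : I -> M -> R) (bs : I -> bool) (ws : I -> seq V),
  [/\ forall i, smooth_on (@GLset R q.+1) (cs i), forall i, (size (ws i) <= size w)%N &
   forall phi, isec a la phi -> forall x i, GLset x ->
     iterD w (gl_comp (sec phi) i b) x =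
     \sum_j cs j x * iterD (ws j) (fun v => reim (bs j) (phi v)) (col ord0 x)].
Proof.
have oU := @open_GL R q.
have cA (h : R) (v x : M) : col ord0 (h *: v + x) = h *: col ord0 v + col ord0 x.
  by apply/matrixP => r s; rewrite !mxE.
have sc b' : smooth_on (@GLset R q.+1) (fun x => mul_coef b b' (chi a la (\det x)^-1)).
  exact: (smooth_mul_coef _ _ oU (csmooth_chi_detV a la)).
have [I1 [c1 [w1 [s1 sub1 e1]]]] := @iterD_mul_affine R M V _ _ cA (@col_continuous R q.+1 q.+1 ord0) (@GLset R q.+1) (@punct R q) _ w oU (sc false) (@col0_neq0 R q).
have [I2 [c2 [w2 [s2 sub2 e2]]]] := @iterD_mul_affine R M V _ _ cA (@col_continuous R q.+1 q.+1 ord0) (@GLset R q.+1) (@punct R q) _ w oU (sc true) (@col0_neq0 R q).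
exists (I1 + I2)%type, (fun j => match j with inl j => c1 j | inr j => c2 j end),
  (fun j => match j with inl _ => false | inr _ => true end),
  (fun j => match j with inl j => w1 j | inr j => w2 j end); split.
- by case.
- by case=> j; [rewrite -(size_map (col ord0) w) size_subseq // sub1|rewrite -(size_map (col ord0) w) size_subseq // sub2].
move=> phi [sp hp] x i x0.
pose T b' (x : M) := mul_coef b b' (chi a la (\det x)^-1) * reim b' (phi (col ord0 x)).
have sT b' : smooth_on (@GLset R q.+1) (T b').
  apply: (smoothM oU (sc b')).
  exact: (smooth_affine cA (@col_continuous R q.+1 q.+1 ord0) (@col0_neq0 R q) (sp b')).
rewrite (iterD_eq w oU (G := fun x => 1 * T false x + 1 * T true x)) //; last first.
  move=> y y0; rewrite /gl_comp (gl_ext_sec hp y0) mxE reim_mul big_bool /T /= !mul1r.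
  by rewrite addrC.
rewrite (iterD_lin 1 1 oU (sT false) (sT true) _ x0) !mul1r.
by rewrite (e1 _ (sp false) x x0) (e2 _ (sp true) x x0) big_sumType.
Qed.

Lemma cutoff_small phi (K : set M) N (d : R) : compact K -> K `<=` @GLset R q.+1 -> 0 < d ->
  isec a la phi -> (forall b, van (@punct R q) (N + (N.+1).*2) (fun v => reim b (phi v))) ->
  \forall e \near (0 : R)^'+, Cinfty_nbhs0 K N d (sec (cutoff e phi)).
Proof.
move=> cK KG d0 ip vp.
(* The words of length at most N form a finite type, so the condition at x is a finite intersection,
   to which the near-covering form of compactness applies. *)
pose P (e : R) (x : M) := forall (t : N.-bseq ('I_q.+1 * 'I_q.+1)) (i : 'I_1) (b : bool),
  `|iterD [seq delta_mx ij.1 ij.2 | ij <- t] (gl_comp (sec (cutoff e phi)) i b) x| < d.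
have h : \forall e \near (0 : R)^'+, K `<=` P e.
  apply: (iffLR (compact_near_coveringP K) cK) => x0 Kx0.
  have Gx0 := KG _ Kx0.
  pose Q (tb : N.-bseq ('I_q.+1 * 'I_q.+1) * bool) (z : M * R) :=
    `|iterD [seq delta_mx ij.1 ij.2 | ij <- tb.1] (gl_comp (sec (cutoff z.2 phi)) ord0 tb.2) z.1| < d.
  suff hQ : forall tb, \forall x \near x0 & e \near (0 : R)^'+, Q tb (x, e).
    rewrite /prop_near2 in hQ *.
    have FF : Filter (filter_prod (nbhs x0) (nbhs (0 : R)^'+)) by apply: filter_prod_filter.
    have hh := @filter_forall _ _ (fun tb x => Q tb (x.1, x.2)) _ FF hQ.
    apply: filterS hh => -[x e] /= hh t i b; rewrite (ord1 i); exact: (hh (t, b)).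
  case=> t b; rewrite /Q /=.
  set w := [seq _ | _ <- _].
  have sw : (size w <= N)%N by rewrite size_map size_bseq.
  have [I [cs [bs [ws [scs hsz e1]]]]] := iterD_gl_comp b w.
  have nG : \forall x \near x0 & e \near (0 : R)^'+, GLset x.
    have nx : \forall x \near x0, GLset x := open_nbhs_nbhs (conj (@open_GL R q) Gx0).
    by near=> x e => /=; near: x.
  have dec : (\sum_j cs j z.1 * iterD (ws j) (fun v => reim (bs j) (cutoff z.2 phi v)) (col ord0 z.1))
     @[z --> filter_prod (nbhs x0) (0 : R)^'+] --> (0 : R).
    apply: (@sum_decay _ _ _ I (index_enum I) (fun j z => cs j z.1)
       (fun j z => iterD (ws j) (fun v => reim (bs j) (cutoff z.2 phi v)) (col ord0 z.1)) (fun j => cs j x0)).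
      move=> j; apply: cvg_comp; first exact: cvg_fst.
      exact: (smooth_diff1 (scs j) Gx0).1.
    move=> j; apply/cvgr0Pnorm_lt => e e0.
    have := cut_decay kap_smooth kap_bound (vp (bs j)) (leq_trans (hsz j) sw) (col0_neq0 Gx0) e0.
    case=> -[A B] /= [nA nB] AB.
    exists ((fun x => col ord0 x) @^-1` A, B) => /=.
      by split => //; exact: (@col_continuous R q.+1 q.+1 ord0 x0 A nA).
    move=> [x y] /= [Ax By].
    have := AB (col ord0 x, y) (conj Ax By) => /=.
    rewrite (_ : (fun v => kap (y^-1 * ratio v) * reim (bs j) (phi v)) = (fun v => reim (bs j) (cutoff y phi v))) //.
    by apply/funext => v; rewrite reim_cutoff.
  have FF : Filter (filter_prod (nbhs x0) (nbhs (0 : R)^'+)) by apply: filter_prod_filter.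
  have hh := (iffLR (cvgr0Pnorm_lt _) dec) d d0.
  rewrite /prop_near2 in nG *.
  have {}hh := hh FF.
  apply: (@filterS _ _ FF _ _ _ (@filterI _ _ FF _ _ nG hh)) => -[x e] /= [Gx].
  by rewrite (e1 _ (isec_cutoff e ip) x ord0 Gx).
apply: filterS h => e KP x Kx w sw i b.
exact: (KP x Kx (Bseq sw)).
Unshelve. all: by end_near. Qed.

End CutSmall.

(** * The functional attached to an intertwining operator *)

Section Coordinates.
Variables (R : realType) (p : nat).
Local Notation V := 'cV[R]_p.+2.

(** The nesting follows the blocks of [diag1_mx] and, inside it, those of [par_M], [par_A] and
    [par_N], so that P' acts blockwise. *)
Definition vec (a : R) (x : 'cV[R]_p) (z : R) : V :=
  castmx (addn1 p.+1, erefl 1%N) (col_mx (col_mx a%:M x : 'cV[R]_(1 + p)) z%:M).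

Definition mid (j : 'I_p) : 'I_p.+2 := cast_ord (addn1 p.+1) (lshift 1 (rshift 1 j)).

Definition cmid (v : V) : 'cV[R]_p := \col_j v (mid j) ord0.

Lemma vec_0 a x z : vec a x z ord0 ord0 = a.
Proof.
rewrite castmxE (_ : cast_ord _ _ = lshift 1 (lshift p ord0 : 'I_(1 + p))); last exact: val_inj.
have e : (col_mx a%:M x : 'cV[R]_(1 + p)) (lshift p ord0) ord0 = a by rewrite col_mxEu mxE eqxx.
by rewrite col_mxEu [cast_ord _ _]ord1; exact: e.
Qed.

Lemma vec_mid a x z j : vec a x z (mid j) ord0 = x j ord0.
Proof.
rewrite castmxE (_ : cast_ord _ _ = lshift 1 (rshift 1 j)); last exact: val_inj.
have e : (col_mx a%:M x : 'cV[R]_(1 + p)) (rshift 1 j) ord0 = x j ord0 by rewrite col_mxEd.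
by rewrite col_mxEu [cast_ord _ _]ord1; exact: e.
Qed.

Lemma vec_max a x z : vec a x z ord_max ord0 = z.
Proof.
rewrite castmxE (_ : cast_ord _ _ = rshift p.+1 ord0); last by apply: val_inj; rewrite /= addn0.
by rewrite col_mxEd mxE [cast_ord _ _]ord1 eqxx mulr1n.
Qed.

Lemma cmid_vec a x z : cmid (vec a x z) = x.
Proof. by apply/matrixP => i j; rewrite ord1 mxE vec_mid. Qed.

Lemma ord_cases (P : 'I_p.+2 -> Prop) : P ord0 -> (forall j, P (mid j)) -> P ord_max ->
  forall i, P i.
Proof.
move=> h0 hm h1 i; rewrite -(cast_ordKV (addn1 p.+1) i).
case: (split_ordP (cast_ord (esym (addn1 p.+1)) i)) => k ->; last first.
  by rewrite (_ : cast_ord _ _ = ord_max) //; apply: val_inj; rewrite /= !ord1 addn0.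
case: (@split_ordP 1 p k) => l ->; last exact: hm.
by rewrite (_ : cast_ord _ _ = ord0) //; apply: val_inj; rewrite /= ord1.
Qed.

Lemma vecE (v : V) : v = vec (v ord0 ord0) (cmid v) (v ord_max ord0).
Proof.
apply/matrixP => i j; rewrite ord1; elim/ord_cases: i => [|k|].
- by rewrite vec_0.
- by rewrite vec_mid mxE.
- by rewrite vec_max.
Qed.

Lemma ord_max_neq0 : ord_max != ord0 :> 'I_p.+2. Proof. by []. Qed.
Lemma mid_neq0 j : mid j != ord0. Proof. by []. Qed.
Lemma mid_neq_max j : mid j != ord_max.
Proof. by rewrite -val_eqE /= add1n eqSS neq_ltn ltn_ord. Qed.
Lemma mid_inj : injective mid.
Proof. by move=> i j /(congr1 val) /= /eqP; rewrite !add1n eqSS => /eqP h; exact: val_inj. Qed.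

Lemma castmx_mul m m' n (e : m = m') (B : 'M[R]_m) (w : 'M[R]_(m, n)) :
  castmx (e, e) B *m castmx (e, erefl n) w = castmx (e, erefl n) (B *m w).
Proof. by case: m' / e; rewrite !castmx_id. Qed.

Lemma diag1_vec (A : 'M[R]_(1 + p)) (a b : R) (x y : 'cV[R]_p) z :
  A *m col_mx a%:M x = col_mx b%:M y -> diag1_mx A *m vec a x z = vec b y z.
Proof.
move=> e; rewrite /diag1_mx castmx_mul mul_block_col !mul0mx mul1mx addr0 add0r.
by rewrite /vec -e.
Qed.

Lemma par_vec (h : 'M[R]_p) t (y : 'rV[R]_p) a x z :
  diag1_mx (par_M h *m par_A p t *m par_N y) *m vec a x z =
  vec (((\det h)^-1 * expR t) * (a + (y *m x) ord0 ord0)) (expR (- (t / p%:R)) *: (h *m x)) z.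
Proof.
apply: diag1_vec; rewrite par_mul_col; congr col_mx.
rewrite [y *m x]mx11_scalar -raddfD /= scale_scalar_mx.
by rewrite !mxE eqxx mulr1n.
Qed.

Lemma det_par (h : 'M[R]_p) t (y : 'rV[R]_p) : (0 < p)%N -> \det h != 0 ->
  par_M h *m par_A p t *m par_N y \in @SLpred R p.+1.
Proof.
move=> p0 h0; rewrite inE !det_mulmx.
have -> : \det (par_M h) = 1 by rewrite /par_M det_ublock det_scalar1 mulVf.
have -> : \det (par_N y) = 1 by rewrite /par_N det_ublock !det1 mulr1.
have -> : \det (par_A p t) = 1.
  rewrite /par_A det_ublock det_scalar1 det_scalar -expRM_natr mulNr divfK ?pnatr_eq0 -?lt0n //.
  by rewrite expRN divff // gt_eqF // expR_gt0.
by rewrite !mulr1.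
Qed.

Lemma diag1_mxM (A B : 'M[R]_p.+1) : diag1_mx (A *m B) = diag1_mx A *m diag1_mx B.
Proof.
rewrite /diag1_mx; move: (addn1 p.+1) => e.
have gen m' (e' : (p.+1 + 1)%N = m') : castmx (e', e') (block_mx (A *m B) 0 0 1%:M) =
  castmx (e', e') (block_mx A 0 0 1%:M) *m castmx (e', e') (block_mx B 0 0 1%:M) :> 'M[R]_m'.
  by case: m' / e'; rewrite !castmx_id mulmx_block !mul0mx !mulmx0 !addr0 !add0r mulmx1.
exact: gen.
Qed.

Lemma diag1M (g h : SL R p.+1) : diag1 (g * h)%g = (diag1 g * diag1 h)%g.
Proof. by apply: val_inj; rewrite /= diag1_mxM. Qed.

Lemma diag1V (g : SL R p.+1) : diag1 g^-1%g = ((diag1 g)^-1)%g.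
Proof.
apply: (mulgI (diag1 g)); rewrite -diag1M !mulgV.
have e : (diag1 1%g * diag1 1%g)%g = diag1 1%g :> SL R p.+2 by rewrite -diag1M mul1g.
by apply: (mulgI (diag1 1%g)); rewrite e mulg1.
Qed.

Lemma diag11 : diag1 1%g = 1%g :> SL R p.+2.
Proof. by rewrite -(mulgV (1%g : SL R p.+1)) diag1M diag1V mulgV. Qed.

End Coordinates.

Section Functional.
Variables (R : realType) (p d : nat) (a : bool) (la : R[i]).
Variables (tau : 'M[R]_p -> 'M[R[i]]_d) (nu : R[i]).
Local Notation V := 'cV[R]_p.+2.
Local Notation rep := (sgn_tensor a (fun _ : 'M[R]_p.+1 => 1%:M : 'M[R[i]]_1)).
Implicit Types (phi psi : V -> R[i]).

Lemma isec_lin c phi psi : isec a la phi -> isec a la psi ->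
  isec a la (fun v => c * phi v + psi v).
Proof.
move=> [s1 h1] [s2 h2]; have oU := @open_punct R p.+1; split.
  exact: (csmoothD oU (csmoothM oU (csmooth_cst c) s1) s2).
by move=> x v x0 v0; rewrite h1 // h2 //; ring.
Qed.

Lemma isecZ c phi : isec a la phi -> isec a la (fun v => c * phi v).
Proof.
move=> [s1 h1]; have oU := @open_punct R p.+1; split.
  exact: (csmoothM oU (csmooth_cst c) s1).
by move=> x v x0 v0; rewrite h1 //; ring.
Qed.

Lemma mulmx_SL_neq0 q (g : SL R q) (v : 'cV[R]_q) : v != 0 -> val g *m v != 0.
Proof.
apply: contra_neq => e; rewrite -(mul1mx v) -(mulVmx (SL_unit g)) -mulmxA e.
by rewrite mulmx0.
Qed.

Lemma isec_act (g : SL R p.+2) phi : isec a la phi -> isec a la (fun v => phi (val g *m v)).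
Proof.
move=> [s h]; split; last first.
  by move=> c v c0 v0; rewrite -scalemxAr h // mulmx_SL_neq0.
have cA (c : R) (v x : V) : val g *m (c *: v + x) = c *: (val g *m v) + val g *m x.
  by rewrite mulmxDr scalemxAr.
have cc : continuous (fun v : V => val g *m v) by apply: linear_mx_continuous.
move=> b; exact: (smooth_affine cA cc (@mulmx_SL_neq0 p.+2 g) (s b)).
Qed.

Definition toInd phi (ip : isec a la phi) : Ind rep la := MkInd (sec_Ind ip).

Variable D : Ind rep la -> Ind tau nu.

(* (D phi)(1) if phi defines a section, and the junk value 0 otherwise. *)
Definition Lam phi : 'cV[R[i]]_d :=
  if pselect (isec a la phi) is left ip then D (toInd ip) 1%g else 0.

Lemma LamE phi (ip : isec a la phi) : Lam phi = D (toInd ip) 1%g.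
Proof.
rewrite /Lam; case: pselect => // ip'.
by congr (Ind_fun (D _) _); exact: val_inj.
Qed.

Hypothesis dD : is_diffop D.

Lemma Lam_lin c phi psi : isec a la phi -> isec a la psi ->
  Lam (fun v => c * phi v + psi v) = c *: Lam phi + Lam psi.
Proof.
move=> i1 i2; have [lD _ _] := dD.
rewrite (LamE (isec_lin c i1 i2)) (LamE i1) (LamE i2).
have -> : toInd (isec_lin c i1 i2) = c *: toInd i1 + toInd i2.
  apply: val_inj; rewrite /= ; apply/funext => g; apply/matrixP => i j.
  by rewrite !mxE.
by rewrite lD.
Qed.

Lemma isec0 : isec a la (fun _ : V => 0).
Proof.
split; first by move=> b; exact: smooth_cst.
by move=> c v _ _; rewrite mulr0.
Qed.

Lemma Lam0 : Lam (fun=> 0) = 0.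
Proof.
have := Lam_lin (-1) isec0 isec0.
rewrite (_ : (fun v : V => -1 * 0 + 0) = fun=> 0) ?scaleN1r ?addNr //.
by apply/funext => v; rewrite mulr0 addr0.
Qed.

Lemma LamZ c phi : isec a la phi -> Lam (fun v => c * phi v) = c *: Lam phi.
Proof.
move=> i1; have := Lam_lin c i1 isec0; rewrite Lam0 addr0 => <-.
by congr Lam; apply/funext => v; rewrite addr0.
Qed.

Lemma Lam_local0 phi : isec a la phi -> (\forall v \near (bvec ord0 : V), phi v = 0) ->
  Lam phi = 0.
Proof.
move=> ip n0; rewrite (LamE ip); have [_ _ supp] := dD.
apply: contrapT => /eqP Dn0.
have s1 : Ind_supp (D (toInd ip)) 1%g by apply: subset_closure.
have := supp (toInd ip) (diag1 1%g) (ex_intro2 _ _ 1%g s1 erefl).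
rewrite diag11 => /(_ (@SLval R p.+2 @^-1` [set x | phi (col ord0 x) = 0])).
case; last by move=> g [/= g1 g2]; move/eqP: g1; apply; apply/matrixP => i j; rewrite !mxE g2.
have cS : continuous (@SLval R p.+2) := @initial_continuous _ _ _.
apply: (cS 1%g [set x | phi (col ord0 x) = 0]).
apply: (@col_continuous R p.+2 p.+2 ord0 1%:M [set v | phi v = 0]).
rewrite (_ : col ord0 1%:M = bvec ord0) //.
by apply/matrixP => i j; rewrite !ord1 !mxE andbT.
Qed.

Lemma Lam_near phi psi : isec a la phi -> isec a la psi ->
  (\forall v \near (bvec ord0 : V), phi v = psi v) -> Lam phi = Lam psi.
Proof.
move=> i1 i2 e; apply/eqP; rewrite -subr_eq0 addrC -scaleN1r -Lam_lin //; apply/eqP.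
apply: Lam_local0; first exact: isec_lin.
by apply: filterS e => v ->; rewrite mulN1r addNr.
Qed.

Lemma Lam_van : exists M, forall phi, isec a la phi ->
  (forall b, van (@punct R p.+1) M (fun v => reim b (phi v))) -> Lam phi = 0.
Proof.
have [_ cD _] := dD.
have K1 : [set (1%:M : 'M[R]_p.+1)] `<=` @GLset R p.+1.
  by move=> x /= ->; rewrite /GLset /= det1 oner_neq0.
have [K [N [eps [cK KG eps0 hK]]]] := cD _ 0%N 1 (@compact_set1 _ _) K1 ltr01.
have gl1 (f : SL R p.+1 -> 'cV[R[i]]_d) : gl_ext f 1%:M = f 1%g.
  have [g gE ->] := gl_extE f (K1 1%:M erefl).
  congr f; apply: val_inj; rewrite gE /sl_retract mul1mx det1 invr1.
  by apply/matrixP => i j; rewrite !mxE if_same.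
have [kap [kap_smooth kap1 kap0 kap_bound]] := exists_cutoff R.
(* The order of vanishing for which [cutoff_small] controls N derivatives. *)
exists (N + (N.+1).*2)%N.
have key phi : isec a la phi -> (forall b, van (@punct R p.+1) (N + (N.+1).*2) (fun v => reim b (phi v))) ->
    forall i b, `|reim b (Lam phi i ord0)| < 1.
  move=> ip vp i b.
  have := cutoff_small kap_smooth kap_bound cK KG eps0 ip vp.
  move=> /(filterI (nbhs_right_gt 0)) /filter_ex [e [/= e0 he]].
  have ie := isec_cutoff kap_smooth e ip.
  have -> : Lam phi = Lam (cutoff kap e phi).
    apply: Lam_near => //.
    have U0 : punct (bvec ord0 : V).
      by apply/eqP => /matrixP /(_ ord0 ord0) /eqP; rewrite !mxE eqxx oner_eq0.
    have [cr _] := smooth_diff1 (@smooth_ratio R p.+1) U0.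
    have r0 : ratio (bvec ord0 : V) = 0.
      by apply: ratio_axis => j j0; rewrite mxE (negbTE j0).
    have : \forall v \near (bvec ord0 : V), ratio v < e / 2.
      by apply: (cvgr_lt _ cr); rewrite r0 divr_gt0.
    apply: filterS => v hv; rewrite /cutoff kap1 ?mul1r //.
    by rewrite ler_pdivrMl // ltW.
  have := hK (toInd ie) he 1%:M erefl [::] isT i b.
  by rewrite /= /gl_comp gl1 -LamE.
move=> phi ip vp; apply/matrixP => i j; rewrite ord1 mxE.
(* The bound 1 of [key] holds for every such section, in particular for e^-1 phi, so that [Lam phi]
   is smaller than any e. *)
have key2 b : reim b (Lam phi i ord0) = 0.
  apply/eqP; rewrite -normr_le0; apply/ler_addgt0Pl => e e0; rewrite addr0.
  have c0 : real_complex R e^-1 * 1 != 0 by rewrite mulr1 fmorph_eq0 invr_eq0 gt_eqF.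
  have reimZ (c : R) z : reim b (real_complex R c * z) = c * reim b z.
    by case: z => x y; case: b => /=; ring.
  have vZ b' : van (@punct R p.+1) (N + (N.+1).*2) (fun v => reim b' (real_complex R e^-1 * phi v)).
    apply: (van_eq (@open_punct R p.+1) _ (van_lin e^-1 0 (@open_punct R p.+1) (vp b') (van0 _ _))) => v _.
    by case: (phi v) => x y; case: b' => /=; ring.
  have := key _ (isecZ (real_complex R e^-1) ip) vZ i b.
  rewrite LamZ // mxE reimZ normrM normfV (gtr0_norm e0) mulrC ltr_pdivrMr // mul1r.
  exact: ltW.
by case: (Lam phi i ord0) (key2 false) (key2 true) => x y /= -> ->.
Qed.

Hypothesis iD : intertwining D.

Lemma Lam_act (g : SL R p.+1) phi (ip : isec a la phi) :
  Lam (fun v => phi (val (diag1 g) *m v)) = D (toInd ip) g.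
Proof.
rewrite (LamE (isec_act (diag1 g) ip)).
have -> : toInd (isec_act (diag1 g) ip) = Ind_action (diag1 g^-1%g) (toInd ip).
  apply: val_inj; apply/funext => x; apply/matrixP => i j; rewrite !mxE diag1V.
  by rewrite invgK SL_valM !colE mulmxA.
by rewrite iD /= /ltrans invgK mulg1.
Qed.

Lemma Lam_par phi (h : 'M[R]_p) (t : R) (y : 'rV[R]_p) : (0 < p)%N ->
  isec a la phi -> h \in @SLpmpred R p ->
  Lam (fun v => phi (vec (((\det h)^-1 * expR t) * (v ord0 ord0 + (y *m cmid v) ord0 ord0))
                         (expR (- (t / p%:R)) *: (h *m cmid v)) (v ord_max ord0))) =
  invmx (cexp (nu * real_complex R t) *: tau h) *m Lam phi.
Proof.
move=> p0 ip hh.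
have h0 : \det h != 0 by have [->|->] := SLpm_det hh; rewrite ?oppr_eq0 oner_eq0.
pose g := MkSL (det_par t y p0 h0).
have := Lam_act g ip.
have -> : (fun v => phi (val (diag1 g) *m v)) = (fun v => phi (vec (((\det h)^-1 * expR t) * (v ord0 ord0 + (y *m cmid v) ord0 ord0))
                         (expR (- (t / p%:R)) *: (h *m cmid v)) (v ord_max ord0))).
  by apply/funext => v; rewrite {1}[v]vecE /= par_vec.
move=> ->; rewrite (LamE ip).
have := IndP (D (toInd ip)); rewrite inE => -[_ hI].
by have := hI 1%g g h t y hh erefl; rewrite mul1g.
Qed.

End Functional.

(** * Polynomials with coefficients indexed by words *)

Section Tensors.
Variables (C : comNzRingType) (I : finType).

(** The sum of a(w) x_(w_1) ... x_(w_n) over the words w of length n. With words in place of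
    exponents, iterated derivatives can serve directly as coefficients. *)
Fixpoint tens n (a : seq I -> C) (x : I -> C) : C :=
  if n is n'.+1 then \sum_i x i * tens n' (fun w => a (i :: w)) x else a [::].

Lemma tens_ext n a b x : (forall w, size w = n -> a w = b w) -> tens n a x = tens n b x.
Proof.
elim: n a b => [|n IH] a b e /=; first exact: e.
by apply: eq_bigr => i _; congr (_ * _); apply: IH => w sw; rewrite e /= ?sw.
Qed.

Lemma eq_tens n a x y : x =1 y -> tens n a x = tens n a y.
Proof.
move=> e; elim: n a => [//|n IH] a /=.
by apply: eq_bigr => i _; rewrite e IH.
Qed.

Lemma tensD n a b x : tens n (fun w => a w + b w) x = tens n a x + tens n b x.
Proof.
elim: n a b => [//|n IH] a b /=.
by rewrite -big_split; apply: eq_bigr => i _; rewrite /= IH mulrDr.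
Qed.

Lemma tensZ n c a x : tens n (fun w => c * a w) x = c * tens n a x.
Proof.
elim: n a => [//|n IH] a /=.
by rewrite mulr_sumr; apply: eq_bigr => i _; rewrite IH mulrCA.
Qed.

Lemma tens0 n x : tens n (fun=> 0) x = 0.
Proof. by elim: n => [//|n IH] /=; rewrite big1 // => i _; rewrite IH mulr0. Qed.

Lemma tens_at0 n a x : (forall i, x i = 0) -> (0 < n)%N -> tens n a x = 0.
Proof. by case: n => [//|n] x0 _ /=; rewrite big1 // => i _; rewrite x0 mul0r. Qed.

End Tensors.

(** * Transversal jets along the axis *)

Section Jets.
Variables (R : realType) (p : nat) (a : bool) (la : R[i]).
Local Notation V := 'cV[R]_p.+2.
Local Notation U0 := (@punct R p.+1).
Implicit Types (phi psi : V -> R[i]).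

Definition edir (k : 'I_p.+1) : V := bvec (lift ord0 k).
Definition ucoord (v : V) (k : 'I_p.+1) : R := v (lift ord0 k) ord0.

Definition e0 : V := bvec ord0.

Lemma e0_punct : U0 e0.
Proof. by apply/eqP => /matrixP /(_ ord0 ord0) /eqP; rewrite !mxE eqxx oner_eq0. Qed.

Lemma e0_axis : on_axis e0.
Proof. by move=> j j0; rewrite mxE (negbTE j0). Qed.

Lemma axisE (v : V) : on_axis v -> v = v ord0 ord0 *: e0.
Proof.
move=> Lv; apply/matrixP => i j; rewrite ord1 !mxE andbT.
have [->|i0] := eqVneq i ord0; first by rewrite mulr1.
by rewrite (Lv i i0); exact: esym (mulr0 _).
Qed.

Lemma derive_invariant (F : V -> R) x w : (\forall h \near (0 : R), F (h *: w + x) = F x) ->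
  'D_w F x = 0.
Proof.
move=> e; apply: cvg_lim => //.
apply: cvg_trans (@cvg_cst _ (0 : R) _ (0 : R)^' _); apply: near_eq_cvg.
by apply: cvg_within; apply: filterS e => h /= ->; rewrite subrr scaler0.
Qed.

Lemma van_of_basis_words m (H : V -> R) : smooth_on U0 H ->
  (forall l : seq 'I_p.+2, (size l < m)%N -> forall v, U0 v -> on_axis v ->
     iterD (map bvec l) H v = 0) -> van U0 m H.
Proof.
have oU := @open_punct R p.+1.
elim: m H => [|m IH] H sH hH; first by split.
apply: (van_succ_basis oU sH); first exact: (hH [::]).
move=> i; apply: IH; first exact: smooth_derive.
move=> l sl v Uv Lv; have := hH (rcons l i) _ v Uv Lv.
by rewrite size_rcons map_rcons -cats1 iterD_cat; apply.
Qed.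

Lemma iterD_homog phi w (c : R) v b : isec a la phi -> c != 0 -> U0 v ->
  c ^+ size w * iterD w (fun v => reim b (phi v)) (c *: v) =
  \sum_b' mul_coef b b' (chi a la c) * iterD w (fun v => reim b' (phi v)) v.
Proof.
have oU := @open_punct R p.+1.
move=> [sp hp] c0 Uv.
have cA (h : R) (u x : V) : c *: (h *: u + x) = h *: (c *: u) + c *: x.
  by rewrite scalerDr !scalerA mulrC.
have UZ (x : V) : U0 x -> U0 (c *: x) by move=> x0; rewrite /punct /= scaler_eq0 negb_or c0.
transitivity (iterD w (fun v => reim b (phi (c *: v))) v).
  rewrite (iterD_affine cA w (fun v => reim b (phi v))).
  have key w1 w2 : iterD (w1 ++ map ( *:%R c) w2) (fun v => reim b (phi v)) (c *: v) =
     c ^+ size w2 * iterD (w1 ++ w2) (fun v => reim b (phi v)) (c *: v).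
    elim: w2 w1 => [|u' w2 IH] w1; first by rewrite mul1r.
    rewrite /= (iterD_scalev w1 _ c u' oU (sp b) (UZ v Uv)).
    by rewrite -(cat_rcons u' w1 (map _ w2)) IH cat_rcons exprS mulrA.
  exact: esym (key [::] w).
rewrite (iterD_eq w oU (G := fun v => \sum_b' mul_coef b b' (chi a la c) * reim b' (phi v))) //.
  exact: (iterD_lin_sum _ (fun b' => mul_coef b b' (chi a la c)) w oU sp Uv).
by move=> x Ux; rewrite hp // reim_mul.
Qed.

(** Homogeneity transports derivatives from e_0 to the other points of the axis, and makes
    derivatives along e_0 redundant, so the transversal derivatives at the single point e_0
    decide. *)
Lemma van_of_jets m phi : isec a la phi ->
  (forall l : seq 'I_p.+1, (size l < m)%N -> forall b,
     iterD (map edir l) (fun v => reim b (phi v)) e0 = 0) ->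
  forall b, van U0 m (fun v => reim b (phi v)).
Proof.
have oU := @open_punct R p.+1.
move=> ip hj b; apply: van_of_basis_words; first exact: ip.1.
move=> l; have [n] := ubnP (size l); elim: n l => // n IH l /[!ltnS] sl lm v Uv Lv.
have v0 : v ord0 ord0 != 0.
  by apply: contraNneq Uv => h; rewrite (axisE Lv) h scale0r.
(* If e_0 is one of the directions, it is moved outermost by symmetry. The shorter word gives a
   function that vanishes along the axis by induction, so its derivative along e_0 is 0. *)
have [l0|l0] := boolP (ord0 \in l).
  have [l' pl] : exists l', perm_eq l (ord0 :: l') by exists (rem ord0 l); exact: perm_to_rem.
  rewrite (iterD_perm oU (ip.1 b) Uv (perm_map bvec pl)) /=.
  apply: derive_invariant.
  have sz : size l = (size l').+1 by rewrite (perm_size pl).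
  have hz u : U0 u -> on_axis u -> iterD (map bvec l') (fun v => reim b (phi v)) u = 0.
    by apply: IH; [rewrite -sz | apply: leq_trans lm; rewrite sz].
  have nz : \forall h \near (0 : R), `|h| < `|v ord0 ord0|.
    by apply: nbhs0_lt; rewrite normr_gt0.
  apply: filterS nz => h hh; rewrite !hz //.
    apply: contra_ltN hh => /eqP /matrixP /(_ ord0 ord0); rewrite !mxE eqxx mulr1 => /eqP.
    by rewrite addr_eq0 => /eqP ->; rewrite normrN.
  by move=> j j0; rewrite !mxE (negbTE j0) mulr0 add0r Lv.
have [l' el] : exists l', l = map (lift ord0) l'.
  elim: l l0 {sl lm} => [|i l IHl]; first by exists [::].
  rewrite inE negb_or => /andP[i0 /IHl [l' ->]].
  by case: (unliftP ord0 i) i0 => [k ->|->] //; exists (k :: l').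
rewrite el -map_comp (axisE Lv).
apply: (mulfI (expf_neq0 (size (map edir l')) v0)).
rewrite mulr0 (iterD_homog _ _ ip v0 e0_punct) big1 // => b' _.
by rewrite hj ?mulr0 // -(size_map (lift ord0) l') -el.
Qed.

End Jets.

(** * Test sections and Taylor expansion *)

Section Tests.
Variables (R : realType) (p : nat) (a : bool) (la : R[i]).
Local Notation V := 'cV[R]_p.+2.
Local Notation U0 := (@punct R p.+1).
Local Notation chi := (chi a la).
Implicit Types (phi psi Q : V -> R[i]).

Definition bump : R^o -> R := sval (cid (exists_cutoff R)).

Lemma bump_smooth : smooth_on setT bump.
Proof. by rewrite /bump; case: cid => k [h1 h2 h3 h4] /=. Qed.

Lemma bump1 s : s <= 2^-1 -> bump s = 1.
Proof. by rewrite /bump; case: cid => k [h1 h2 h3 h4] /=; exact: h2. Qed.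

Lemma bump0 s : 1 <= s -> bump s = 0.
Proof. by rewrite /bump; case: cid => k [h1 h2 h3 h4] /=; exact: h3. Qed.

(** The condition means v_0^2 < rho2. It holds near each nonzero point of the hyperplane v_0 = 0,
    where the power of v_0 in the test sections is singular. *)
Lemma bump_far (v : V) : nrm2 v < 2 * rho2 v -> bump (2 * ratio v) = 0.
Proof.
move=> h; have n0 : 0 < nrm2 v.
  have := rho2_le_nrm2 v; have := rho2_ge0 v => h1 h2; rewrite lt_neqAle (le_trans h1 h2) andbT.
  by apply: contraTneq h => e; rewrite -e -leNgt (_ : rho2 v = 0) ?mulr0 //; apply/le_anti; rewrite h1 e h2.
by rewrite bump0 // /ratio mulrA ler_pdivlMr // mul1r ltW.
Qed.

Lemma far_of_coord0 (v : V) : v != 0 -> v ord0 ord0 = 0 -> nrm2 v < 2 * rho2 v.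
Proof.
move=> v0 h; have n0 := nrm2_gt0 v0.
by rewrite rho2E h expr0n subr0 ltr_pMl // ltr1n.
Qed.

Lemma open_far : open [set v : V | nrm2 v < 2 * rho2 v].
Proof.
rewrite (_ : [set _ | _] = (fun v : V => 2 * rho2 v - nrm2 v) @^-1` [set r : R | 0 < r]).
  have sm : smooth_on setT (fun v : V => 2 * rho2 v - nrm2 v) :=
    smoothB openT (smoothZ 2 openT (smooth_rho2 openT)) (smooth_nrm2 openT).
  apply: open_comp => [x _|]; last exact: open_gt.
  by have [] := smooth_diff1 sm (Logic.I : setT x).
by apply/seteqP; split => v /=; rewrite subr_gt0.
Qed.

Definition hfun n Q := csmooth setT Q /\
  forall (c : R) v, Q (c *: v) = real_complex R c ^+ n * Q v.

Lemma hfun0 n : hfun n (fun=> 0).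
Proof. by split=> [|c v]; [exact: csmooth_cst|rewrite mulr0]. Qed.

Lemma hfunD n Q Q' : hfun n Q -> hfun n Q' -> hfun n (fun v => Q v + Q' v).
Proof.
move=> [s h] [s' h']; split; first exact: (csmoothD openT s s').
by move=> c v; rewrite h h' mulrDr.
Qed.

Lemma hfun_sum n (I : Type) (r : seq I) (Qs : I -> V -> R[i]) :
  (forall i, hfun n (Qs i)) -> hfun n (fun v => \sum_(i <- r) Qs i v).
Proof.
move=> h; elim: r => [|i r IH].
  by rewrite (_ : (fun v => _) = fun=> 0); [exact: hfun0|apply/funext => v; rewrite big_nil].
rewrite (_ : (fun v => _) = fun v => Qs i v + \sum_(j <- r) Qs j v); first exact: hfunD.
by apply/funext => v; rewrite big_cons.
Qed.

Lemma hfunM n n' Q Q' : hfun n Q -> hfun n' Q' -> hfun (n + n') (fun v => Q v * Q' v).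
Proof.
move=> [s h] [s' h']; split; first exact: (csmoothM openT s s').
by move=> c v; rewrite h h' exprD mulrACA.
Qed.

Lemma hfun_cst c : hfun 0 (fun=> c).
Proof. by split=> [|x v]; [exact: csmooth_cst|rewrite mul1r]. Qed.

Lemma hfun_coord i : hfun 1 (fun v => real_complex R (v i ord0)).
Proof.
split; first exact: (csmooth_real openT (coord_smooth i openT)).
by move=> c v; rewrite mxE rmorphM.
Qed.

Lemma hfunX n Q : hfun 1 Q -> hfun n (fun v => Q v ^+ n).
Proof.
move=> h; elim: n => [|n IH]; first exact: (hfun_cst 1).
rewrite (_ : (fun v => _) = fun v => Q v * Q v ^+ n); first exact: (hfunM h IH).
by apply/funext => v; rewrite exprS.
Qed.

Lemma hfun_tens (I : finType) n (b : seq I -> R[i]) (xs : I -> V -> R[i]) :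
  (forall i, hfun 1 (xs i)) -> hfun n (fun v => tens n b (fun i => xs i v)).
Proof.
move=> h; elim: n b => [|n IH] b /=; first exact: hfun_cst.
by apply: hfun_sum => i; exact: (hfunM (h i) (IH _)).
Qed.

(* The section which near e_0 is the product of Q, homogeneous of degree n, and of
   a power of v_0. *)
Definition tst n Q (v : V) : R[i] :=
  real_complex R (bump (2 * ratio v)) *
  (chi (v ord0 ord0) * real_complex R (v ord0 ord0) ^- n) * Q v.

Lemma isec_tst n Q : hfun n Q -> isec a la (tst n Q).
Proof.
move=> [sQ hQ]; split; last first.
  move=> c v c0 v0; rewrite /tst ratioZ // hQ mxE.
  have [h|h] := eqVneq (v ord0 ord0) 0.
    have e : bump (2 * ratio v) = 0 by apply: bump_far; exact: (far_of_coord0 v0 h).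
    by rewrite e !rmorph0 !mul0r mulr0.
  rewrite chiM // rmorphM exprMn invfM.
  have c0' : real_complex R c ^+ n != 0 by rewrite expf_neq0 // fmorph_eq0.
  by field; rewrite c0' expf_neq0 // fmorph_eq0.
move=> b; apply: smooth_local => v Uv.
have [h|h] := eqVneq (v ord0 ord0) 0.
  exists [set v : V | nrm2 v < 2 * rho2 v], (fun=> 0); split => //.
  - exact: open_far.
  - exact: far_of_coord0.
  - exact: smooth_cst.
  - by move=> u /= /bump_far e; rewrite /tst e !mul0r; case: (b).
have oU : open ([set v : V | v ord0 ord0 != 0]).
  rewrite (_ : [set _ | _] = (fun v : V => v ord0 ord0) @^-1` [set r : R | r != 0]) //.
  by apply: open_comp => [x _|]; [exact: coord_continuous|exact: open_neq].
have sU : [set v : V | v ord0 ord0 != 0] `<=` U0.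
  by move=> u /=; apply: contraNneq => ->; rewrite mxE.
exists [set v : V | v ord0 ord0 != 0], (fun v => reim b (tst n Q v)); split=> //.
have s1 := csmooth_real oU (smooth_sub sU (smooth_cut bump_smooth 2)).
have s2 := csmooth_chi a la oU (coord_smooth ord0 oU) (fun _ h => h).
have s3 : csmooth [set v : V | v ord0 ord0 != 0] (fun v => real_complex R (v ord0 ord0) ^- n).
  have s4 := csmooth_real oU (smoothX n oU (smooth_inv oU (coord_smooth ord0 oU) (fun _ h => h))).
  apply: (csmooth_eq oU _ s4) => u u0.
  by rewrite -exprVn rmorphXn fmorphV.
have s5 : csmooth [set v : V | v ord0 ord0 != 0] Q.
  by move=> b'; apply: smooth_sub (sQ b').
exact: (csmoothM oU (csmoothM oU s1 (csmoothM oU s2 s3)) s5 b).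
Qed.

Lemma tstZ n c Q v : tst n (fun v => c * Q v) v = c * tst n Q v.
Proof. by rewrite /tst mulrCA. Qed.

Lemma tst_near n Q (c : R) : c != 0 -> \forall v \near (c *: (e0 R p)),
  tst n Q v = chi (v ord0 ord0) * real_complex R (v ord0 ord0) ^- n * Q v.
Proof.
move=> c0.
have Uc : U0 (c *: e0 R p) by rewrite /punct /= scaler_eq0 negb_or c0; exact: e0_punct.
have [cr _] := smooth_diff1 (@smooth_ratio R p.+1) Uc.
have r0 : ratio (c *: e0 R p) = 0 by rewrite ratioZ // ratio_axis //; exact: e0_axis.
have : \forall v \near (c *: e0 R p), ratio v < 2^-1 / 2.
  by apply: (cvgr_lt _ cr); rewrite r0 divr_gt0.
apply: filterS => v hv; rewrite /tst bump1 ?mul1r //.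
by rewrite -ler_pdivlMl // mulrC ltW.
Qed.

Lemma derive_coord i w (v : V) : 'D_w (fun v : V => v i ord0 : R) v = w i ord0.
Proof.
apply: cvg_lim => //; apply: cvg_trans (@cvg_cst _ (w i ord0) _ (0 : R)^' _).
apply: near_eq_cvg; near=> h.
have h0 : h != 0 by near: h; exact: nbhs_dnbhs_neq.
by rewrite /= !mxE addrK [_ *: _]mulrA mulVf // mul1r.
Unshelve. all: by end_near. Qed.

Lemma iterD_const_dir U (A G : V -> R) l : open U -> smooth_on U A -> smooth_on U G ->
  (forall k (h : R) v, A (h *: edir R k + v) = A v) ->
  forall v, U v -> iterD (map (@edir R p) l) (fun v => A v * G v) v =
    A v * iterD (map (@edir R p) l) G v.
Proof.
move=> oU sA sG hA; elim: l => [//|k l IH] v Uv /=.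
have e : \forall u \near v, iterD (map (@edir R p) l) (fun v => A v * G v) u =
    A u * iterD (map (@edir R p) l) G u.
  by have := open_nbhs_nbhs (conj oU Uv); apply: filterS => u Uu; exact: IH.
rewrite (near_eq_derive _ e).
rewrite (derive_fM _ (smooth_diff1 sA Uv) (smooth_diff1 (smooth_iterD _ sG) Uv)).
have -> : 'D_(edir R k) A v = 0.
  by apply: derive_invariant; apply: filterE => h; exact: hA.
by rewrite mul0r addr0.
Qed.

Lemma open_pos : open [set v : V | 0 < v ord0 ord0].
Proof.
rewrite (_ : [set _ | _] = (fun v : V => v ord0 ord0) @^-1` [set r : R | 0 < r]) //.
by apply: open_comp => [x _|]; [exact: coord_continuous|exact: open_gt].
Qed.

Lemma csmooth_weight n : csmooth [set v : V | 0 < v ord0 ord0]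
  (fun v => chi (v ord0 ord0) * real_complex R (v ord0 ord0) ^- n).
Proof.
have oU := open_pos.
have n0 (v : V) : 0 < v ord0 ord0 -> v ord0 ord0 != 0 by move=> h; rewrite gt_eqF.
apply: (csmoothM oU (csmooth_chi a la oU (coord_smooth ord0 oU) n0)).
have s4 := csmooth_real oU (smoothX n oU (smooth_inv oU (coord_smooth ord0 oU) n0)).
by apply: (csmooth_eq oU _ s4) => u u0; rewrite -exprVn rmorphXn fmorphV.
Qed.

(** Near e_0 the bump is 1 and the remaining weight depends on v_0 only: it is constant in the
    transversal directions and equals 1 at e_0. *)
Lemma iterD_tst n Q l b : hfun n Q ->
  iterD (map (@edir R p) l) (fun v => reim b (tst n Q v)) (e0 R p) =
  iterD (map (@edir R p) l) (fun v => reim b (Q v)) (e0 R p).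
Proof.
move=> [sQ hQ]; have oU := open_pos.
have U1 : (e0 R p) ord0 ord0 = 1 by rewrite !mxE eqxx.
have Ue : 0 < (e0 R p) ord0 ord0 by rewrite U1 ltr01.
pose W (v : V) := chi (v ord0 ord0) * real_complex R (v ord0 ord0) ^- n.
have sW : csmooth [set v : V | 0 < v ord0 ord0] W := csmooth_weight n.
have sQ' b' : smooth_on [set v : V | 0 < v ord0 ord0] (fun v => reim b' (Q v)).
  exact: smooth_sub (sQ b').
have sA b' := smooth_mul_coef b b' oU sW.
have W1 : W (e0 R p) = 1 by rewrite /W U1 chi1 rmorph1 expr1n invr1 mul1r.
have e : \forall v \near (e0 R p), reim b (tst n Q v) =
    \sum_b' 1 * (mul_coef b b' (W v) * reim b' (Q v)).
  have := tst_near n Q (oner_neq0 R); rewrite scale1r; apply: filterS => v ->.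
  by rewrite reim_mul; apply: eq_bigr => b' _; rewrite mul1r.
rewrite (nbhs_singleton (iterD_near _ e)).
rewrite (iterD_lin_sum _ (fun=> 1) _ oU (fun b' => smoothM oU (sA b') (sQ' b')) Ue).
have key b' := iterD_const_dir l oU (sA b') (sQ' b') _ Ue.
rewrite (eq_bigr (fun b' => mul_coef b b' 1 * iterD (map (@edir R p) l) (fun v => reim b' (Q v)) (e0 R p))).
  by rewrite big_bool /mul_coef; case: (b) => /=; rewrite mul1r ?oppr0 ?mul0r ?addr0 ?add0r.
move=> b' _; rewrite mul1r key ?W1 // => b1 k h v; rewrite /W.
have -> : (h *: edir R k + v) ord0 ord0 = v ord0 ord0 by rewrite !mxE /= mulr0 add0r.
by [].
Qed.

Lemma smooth_tens U n (b : seq 'I_p.+1 -> R) : open U -> smooth_on U (fun v : V => tens n b (ucoord v)).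
Proof.
move=> oU; elim: n b => [|n IH] b; first exact: smooth_cst.
apply: (smooth_sum _ oU) => i; apply: (smoothM oU _ (IH _)).
exact: (coord_smooth _ oU).
Qed.

Definition symm (T : Type) (I : eqType) (b : seq I -> T) := forall w w', perm_eq w w' -> b w = b w'.

Lemma symm_cons (T : Type) (I : eqType) (b : seq I -> T) i : symm b -> symm (fun w => b (i :: w)).
Proof. by move=> sb w w' e; apply: sb; rewrite perm_cons. Qed.

Lemma derive_tens n (b : seq 'I_p.+1 -> R) j (v : V) : symm b ->
  'D_(edir R j) (fun v : V => tens n b (ucoord v)) v =
  n%:R * tens n.-1 (fun w => b (j :: w)) (ucoord v).
Proof.
have oT : open (setT : set V) := openT.
elim: n b v => [|n IH] b v sb; first by rewrite mul0r derive_cst.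
have dc i : diff1 (fun v : V => ucoord v i) v := smooth_diff1 (coord_smooth (lift ord0 i) oT) I.
have dt i : diff1 (fun v : V => tens n (fun w => b (i :: w)) (ucoord v)) v := smooth_diff1 (smooth_tens n _ oT) I.
rewrite derive_fsum; last by move=> i; exact: (diff1M (dc i) (dt i)).
rewrite (eq_bigr (fun i => ucoord v i * (n%:R * tens n.-1 (fun w => b (j :: i :: w)) (ucoord v)) +
    (i == j)%:R * tens n (fun w => b (i :: w)) (ucoord v))); last first.
  move=> i _; rewrite (derive_fM _ (dc i) (dt i)) IH; last exact: symm_cons.
  rewrite /ucoord derive_coord !mxE andbT (inj_eq lift_inj); congr (_ * (_ * _) + _).
  by apply: tens_ext => w _; apply: sb; exact/permPl/(perm_catCA [:: i] [:: j] w).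
rewrite big_split /= [X in _ + X](bigD1 j) //= eqxx mul1r [X in _ + (_ + X)]big1; last first.
  by move=> i /negbTE ->; rewrite mul0r.
rewrite addr0 -natr1 mulrDl mul1r; congr (_ + _).
case: n {IH dt} => [|n]; first by rewrite mul0r big1 // => i _; rewrite mul0r mulr0.
by rewrite /= mulr_sumr; apply: eq_bigr => i _; rewrite mulrCA.
Qed.

Lemma symm_cat (T : Type) (I : eqType) (b : seq I -> T) l : symm b -> symm (fun w => b (l ++ w)).
Proof. by move=> sb w w' e; apply: sb; rewrite perm_cat2l. Qed.

Lemma iterD_tens n (b : seq 'I_p.+1 -> R) l (v : V) : symm b ->
  iterD (map (@edir R p) l) (fun v : V => tens n b (ucoord v)) v =
  (n ^_ (size l))%:R * tens (n - size l) (fun w => b (l ++ w)) (ucoord v).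
Proof.
have oT : open (setT : set V) := openT.
move=> sb; elim: l v => [|j l IH] v /=; first by rewrite ffactn0 mul1r subn0.
rewrite (_ : iterD _ _ = fun v => (n ^_ (size l))%:R * tens (n - size l) (fun w => b (l ++ w)) (ucoord v)).
  have dt := smooth_diff1 (smooth_tens (n - size l) (fun w => b (l ++ w)) oT) (Logic.I : setT v).
  rewrite (derive_fM _ (diff1_cst _ _) dt) derive_cst mul0r addr0 derive_tens; last exact: symm_cat.
  rewrite /cst mulrA -natrM ffactnSr subnS; congr (_ * _).
  by apply: tens_ext => w _; apply: sb; rewrite -cat1s perm_catCA.
by apply/funext.
Qed.

Lemma ucoord_e0 k : ucoord (e0 R p) k = 0.
Proof. by rewrite /ucoord !mxE. Qed.

Lemma jet_tens n (b : seq 'I_p.+1 -> R) l : symm b ->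
  iterD (map (@edir R p) l) (fun v : V => tens n b (ucoord v)) (e0 R p) =
  if size l == n then n`!%:R * b l else 0.
Proof.
move=> sb; rewrite iterD_tens //; case: (ltngtP (size l) n) => [h|h|->].
- by rewrite tens_at0 ?mulr0 ?subn_gt0 // => i; exact: ucoord_e0.
- by rewrite ffact_small ?mul0r.
- by rewrite subnn ffactnn /= cats0.
Qed.

Lemma reim_tens b0 n (b : seq 'I_p.+1 -> R[i]) (v : V) :
  reim b0 (tens n b (fun k => real_complex R (ucoord v k))) =
  tens n (fun w => reim b0 (b w)) (ucoord v).
Proof.
elim: n b => [//|n IH] b /=.
have reimZ (c : R) z : reim b0 (real_complex R c * z) = c * reim b0 z.
  by case: z => x y; case: (b0) => /=; ring.
have reim_sum (r : seq 'I_p.+1) (F : 'I_p.+1 -> R[i]) :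
    reim b0 (\sum_(i <- r) F i) = \sum_(i <- r) reim b0 (F i).
  elim: r => [|i r IHr]; first by rewrite !big_nil; case: (b0).
  by rewrite !big_cons -IHr; case: (F i) (\sum_(_ <- _) _) => ? ? [? ?]; case: (b0).
by rewrite reim_sum; apply: eq_bigr => i _; rewrite reimZ IH.
Qed.

Definition jet phi (w : seq 'I_p.+1) : R[i] :=
  Complex (iterD (map (@edir R p) w) (fun v => reim false (phi v)) (e0 R p))
          (iterD (map (@edir R p) w) (fun v => reim true (phi v)) (e0 R p)).

Lemma reim_jet b phi w : reim b (jet phi w) = iterD (map (@edir R p) w) (fun v => reim b (phi v)) (e0 R p).
Proof. by case: b. Qed.

Definition upoly n (b : seq 'I_p.+1 -> R[i]) (v : V) := tens n b (fun k => real_complex R (ucoord v k)).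

Lemma hfun_upoly n b : hfun n (upoly n b).
Proof. by apply: hfun_tens => i; exact: hfun_coord. Qed.

(** The jets are symmetric in their letters, so that n derivatives of the summand of degree n return
    each coefficient n! times; hence the inverse factorial. *)
Definition taylor M phi (v : V) : R[i] :=
  \sum_(n < M) real_complex R (n`!%:R)^-1 * tst n (upoly n (jet phi)) v.

Lemma isec_sum (I : Type) (r : seq I) (c : I -> R[i]) (F : I -> V -> R[i]) :
  (forall i, isec a la (F i)) -> isec a la (fun v => \sum_(i <- r) c i * F i v).
Proof.
move=> h; elim: r => [|i r IH].
  by rewrite (_ : (fun v => _) = fun=> 0); [exact: isec0|apply/funext => v; rewrite big_nil].
rewrite (_ : (fun v => _) = fun v => c i * F i v + \sum_(j <- r) c j * F j v); first exact: isec_lin.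
by apply/funext => v; rewrite big_cons.
Qed.

Lemma isec_taylor M phi : isec a la (taylor M phi).
Proof. by apply: isec_sum => n; apply: isec_tst; exact: hfun_upoly. Qed.

Lemma taylor_rem M phi b : isec a la phi ->
  van U0 M (fun v => reim b (phi v + (-1) * taylor M phi v)).
Proof.
move=> ip; have oU := @open_punct R p.+1.
have ir : isec a la (fun v => phi v + (-1) * taylor M phi v).
  have := isec_lin (-1) (isec_taylor M phi) ip.
  by rewrite (_ : (fun v => _ + phi v) = fun v => phi v + -1 * taylor M phi v) //; apply/funext => v; rewrite addrC.
apply: (van_of_jets ir) => l lM {}b.
have reimZ (c : R) z : reim b (real_complex R c * z) = c * reim b z.
  by case: z => x y; case: (b) => /=; ring.
have reimD z w : reim b (z + w) = reim b z + reim b w.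
  by case: z w => ? ? [? ?]; case: (b).
have reim_sum (r : seq 'I_M) (F : 'I_M -> R[i]) :
    reim b (\sum_(i <- r) F i) = \sum_(i <- r) reim b (F i).
  elim: r => [|i r IHr]; first by rewrite !big_nil; case: (b).
  by rewrite !big_cons reimD IHr.
have sT (n : 'I_M) : smooth_on U0 (fun v => reim b (tst n (upoly n (jet phi)) v)).
  by have [h _] := isec_tst (hfun_upoly n (jet phi)); exact: h.
pose G v := \sum_(n < M) (n`!%:R)^-1 * reim b (tst n (upoly n (jet phi)) v) : R.
have e v : reim b (phi v + -1 * taylor M phi v) = 1 * reim b (phi v) + (-1) * G v.
  rewrite reimD (_ : -1 = real_complex R (-1)); last by rewrite rmorphN rmorph1.
  by rewrite reimZ mul1r /taylor reim_sum; congr (_ + _ * _); apply: eq_bigr => n _; rewrite reimZ.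
have sG : smooth_on U0 G by apply: (smooth_sum _ oU) => n; exact: (smoothZ _ oU (sT n)).
rewrite (iterD_eq (map (@edir R p) l) oU (fun v _ => e v) (@e0_punct R p)).
rewrite (iterD_lin 1 (-1) oU (ip.1 b) sG _ (@e0_punct R p)) mul1r mulN1r.
rewrite (iterD_lin_sum _ _ _ oU sT (@e0_punct R p)).
have sj : symm (jet phi).
  move=> w w' pw; rewrite /jet.
  by rewrite !(iterD_perm oU (ip.1 _) (@e0_punct R p) (perm_map (@edir R p) pw)).
rewrite (eq_bigr (fun n : 'I_M => if n == Ordinal lM then reim b (jet phi l) else 0)); last first.
  move=> n _; rewrite iterD_tst; last exact: hfun_upoly.
  rewrite (_ : (fun v => reim b (upoly n (jet phi) v)) =
      fun v => tens n (fun w => reim b (jet phi w)) (ucoord v)); last first.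
    by apply/funext => v; rewrite /upoly reim_tens.
  rewrite jet_tens; last by move=> w w' /sj ->.
  rewrite -val_eqE /= eq_sym; case: eqP => _; last by rewrite mulr0.
  by rewrite mulKf // pnatr_eq0 -lt0n fact_gt0.
by rewrite -big_mkcond big_pred1_eq reim_jet subrr.
Qed.

End Tests.

(** * Homogeneous polynomial functions *)

Section PolynomialFunctions.
Variables (R : realType) (p : nat).
Local Notation C := R[i].
Local Notation W := 'cV[C]_p.
Implicit Types (q r : W -> C).

Definition cx (x : 'cV[R]_p) : W := map_mx (real_complex R) x.

Lemma cxE x j : cx x j ord0 = real_complex R (x j ord0).
Proof. by rewrite mxE. Qed.

(* Homogeneous polynomial functions of degree n (see homog_polyE), in a form which
   is suited to induction on n. *)
Fixpoint hpoly n q : Prop :=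
  if n is n'.+1 then exists qs : 'I_p -> W -> C,
    (forall i, hpoly n' (qs i)) /\ q = fun y => \sum_i y i ord0 * qs i y
  else exists c, q = fun=> c.

Lemma hpoly0 n : hpoly n (fun=> 0).
Proof.
elim: n => [|n IH]; first by exists 0.
exists (fun _ _ => 0); split=> //; apply/funext => y.
by rewrite big1 // => i _; rewrite mulr0.
Qed.

Lemma hpoly_lin n c q r : hpoly n q -> hpoly n r -> hpoly n (fun y => c * q y + r y).
Proof.
elim: n q r => [|n IH] q r /=.
  by move=> [x ->] [x' ->]; exists (c * x + x').
move=> [qs [hq ->]] [rs [hr ->]]; exists (fun i y => c * qs i y + rs i y); split=> [i|].
  exact: IH.
apply/funext => y; rewrite mulr_sumr -big_split /=; apply: eq_bigr => i _.
by rewrite mulrDr mulrCA.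
Qed.

Lemma hpolyZ n c q : hpoly n q -> hpoly n (fun y => c * q y).
Proof.
move=> h; have := hpoly_lin c h (hpoly0 n).
by rewrite (_ : (fun y => _ + 0) = fun y => c * q y) //; apply/funext => y; rewrite addr0.
Qed.

Lemma hpolyD n q r : hpoly n q -> hpoly n r -> hpoly n (fun y => q y + r y).
Proof.
move=> hq hr; have := hpoly_lin 1 hq hr.
by rewrite (_ : (fun y => _ + _) = fun y => q y + r y) //; apply/funext => y; rewrite mul1r.
Qed.

Lemma hpoly_sum n (I : Type) (s : seq I) (f : I -> W -> C) :
  (forall i, hpoly n (f i)) -> hpoly n (fun y => \sum_(i <- s) f i y).
Proof.
move=> h; elim: s => [|i s IH].
  rewrite (_ : (fun y => _) = fun=> 0); first exact: hpoly0.
  by apply/funext => y; rewrite big_nil.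
rewrite (_ : (fun y => _) = fun y => f i y + \sum_(j <- s) f j y); first exact: hpolyD.
by apply/funext => y; rewrite big_cons.
Qed.

Lemma hpoly_coord n j q : hpoly n q -> hpoly n.+1 (fun y => y j ord0 * q y).
Proof.
move=> h; exists (fun i => if i == j then q else fun=> 0); split=> [i|].
  by case: eqP => // _; exact: hpoly0.
apply/funext => y; rewrite (bigD1 j) //= eqxx big1 ?addr0 // => i /negbTE ->.
by rewrite mulr0.
Qed.

Lemma hpolyM n m q r : hpoly n q -> hpoly m r -> hpoly (n + m) (fun y => q y * r y).
Proof.
elim: n q => [|n IH] q /=; first by move=> [c ->] h; exact: hpolyZ.
move=> [qs [hq ->]] h; exists (fun i y => qs i y * r y); split=> [i|]; first exact: IH.
by apply/funext => y; rewrite mulr_suml; apply: eq_bigr => i _; rewrite mulrA.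
Qed.

Lemma hpolyX m q : hpoly 1 q -> hpoly m (fun y => q y ^+ m).
Proof.
move=> h; elim: m => [|m IH]; first by exists 1.
rewrite (_ : (fun y => _) = fun y => q y * q y ^+ m); first exact: (hpolyM h IH).
by apply/funext => y; rewrite exprS.
Qed.

Lemma hpoly_prod m (I : Type) (s : seq I) (k : I -> nat) (f : I -> W -> C) :
  (forall i, hpoly (k i) (f i)) -> \sum_(i <- s) k i = m ->
  hpoly m (fun y => \prod_(i <- s) f i y).
Proof.
move=> h <-; elim: s => [|i s IH].
  by rewrite big_nil; exists 1; apply/funext => y; rewrite big_nil.
rewrite big_cons (_ : (fun y => _) = fun y => f i y * \prod_(j <- s) f j y).
  exact: (hpolyM (h i) IH).
by apply/funext => y; rewrite big_cons.
Qed.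

Lemma hpoly_coord1 j : hpoly 1 (fun y => y j ord0).
Proof.
have := @hpoly_coord 0 j (fun=> 1) (ex_intro _ 1 erefl).
by rewrite (_ : (fun y : W => y j ord0 * 1) = fun y => y j ord0) //; apply/funext => y; rewrite mulr1.
Qed.

Lemma hpoly_form (f : 'rV[C]_p) : hpoly 1 (fun y => (f *m y) ord0 ord0).
Proof.
rewrite (_ : (fun y : W => _) = fun y : W => \sum_i f ord0 i * y i ord0).
  by apply: (@hpoly_sum 1) => i; apply: hpolyZ; exact: hpoly_coord1.
by apply/funext => y; rewrite mxE.
Qed.

Lemma hpoly_comp n (A : 'M[C]_p) q : hpoly n q -> hpoly n (fun y => q (A *m y)).
Proof.
elim: n q => [|n IH] q /=; first by move=> [c ->]; exists c.
move=> [qs [hq ->]].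
apply: (@hpoly_sum n.+1) => i; rewrite -add1n; apply: hpolyM (IH _ (hq i)).
rewrite (_ : (fun y => _) = fun y => (row i A *m y) ord0 ord0); first exact: hpoly_form.
by apply/funext => y; rewrite -row_mul [RHS]mxE.
Qed.

Lemma hpoly_scale n q c y : hpoly n q -> q (c *: y) = c ^+ n * q y.
Proof.
elim: n q => [|n IH] q /=; first by move=> [x ->]; rewrite mul1r.
move=> [qs [hq ->]]; rewrite mulr_sumr; apply: eq_bigr => i _.
by rewrite (IH _ (hq i)) mxE exprS mulrACA.
Qed.

Lemma hpoly_poly n q (f : 'I_p -> {poly C}) : hpoly n q ->
  exists P : {poly C}, forall s, q (\col_i (f i).[s]) = P.[s].
Proof.
elim: n q => [|n IH] q /=; first by move=> [c ->]; exists c%:P => s; rewrite hornerC.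
move=> [qs [hq ->]]; have {}IH i := IH _ (hq i).
have [Ps hP] := choice IH; exists (\sum_i f i * Ps i) => s.
by rewrite horner_sum; apply: eq_bigr => i _; rewrite hP mxE hornerM.
Qed.

Lemma poly_real_zero (P : {poly C}) :
  (forall s : R, 0 < s -> P.[real_complex R s] = 0) -> P = 0.
Proof.
move=> h; apply: contrapT => /eqP P0.
pose s := [seq real_complex R (i.+1)%:R | i <- iota 0 (size P)].
have hs : uniq s.
  rewrite map_inj_uniq ?iota_uniq // => i j /(fmorph_inj (real_complex R)) /eqP.
  by rewrite eqr_nat => /eqP [].
have hr : all (root P) s.
  by apply/allP => _ /mapP[i _ ->]; rewrite /root h ?ltr0Sn.
by have := max_poly_roots P0 hr hs; rewrite size_map size_iota ltnn.
Qed.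

(** On the curve s |-> Re y + s Im y the polynomial vanishes for real s, hence identically, and s =
    i gives its value at y. *)
Lemma hpoly_real_zero n q : hpoly n q -> (forall x, q (cx x) = 0) -> q = fun=> 0.
Proof.
move=> hq h; apply/funext => y.
pose f i : {poly C} := (real_complex R (complex.Re (y i ord0)))%:P +
  'X * (real_complex R (complex.Im (y i ord0)))%:P.
have [P hP] := hpoly_poly f hq.
have P0 : P = 0.
  apply: poly_real_zero => s _; rewrite -hP.
  rewrite -[RHS](h (\col_i (complex.Re (y i ord0) + s * complex.Im (y i ord0)))).
  congr q; apply/colP => i; rewrite !mxE /f !hornerE.
  by rewrite rmorphD rmorphM.
transitivity (P.[Complex 0 1]); last by rewrite P0 horner0.
rewrite -hP; congr q; apply/colP => i; rewrite !mxE /f !hornerE.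
by case: (y i ord0) => u v /=; apply/eqP; rewrite eq_complex /=; apply/andP; split; apply/eqP; ring.
Qed.

Lemma homog_polyE n (q : W -> R[i]^o) : homog_poly n q <-> hpoly n q.
Proof.
split.
  move=> [[P hP] ->] /=.
  (* Homogeneity fixes the degree of the monomials in the support only; elsewhere the factor is set
     to 0, so that every summand has degree n. *)
  have -> : (fun v : W => mpoly.meval (fun i => v i ord0) P) =
      fun v : W => \sum_(m <- mpoly.msupp P) mpoly.mcoeff m P *
        (if m \in mpoly.msupp P then \prod_i v i ord0 ^+ (mpoly.fun_of_multinom m i) else 0).
    by apply/funext => v; rewrite mpoly.mevalE !big_seq; apply: eq_bigr => m ->.
  apply: hpoly_sum => m; apply: hpolyZ; case: (boolP (m \in mpoly.msupp P)) => hm; last exact: hpoly0.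
  apply: (hpoly_prod (k := fun i => mpoly.fun_of_multinom m i)) => [i|].
    by apply: hpolyX; exact: hpoly_coord1.
  by rewrite -mpoly.mdegE; exact: (mpoly.dhomog_mf hP).
elim: n q => [|n IH] q /=.
  move=> [c ->].
  have h := mpoly.dhomogZ c (mpoly.dhomog1 (n := p) C mpoly.mdeg).
  exists (mpoly.DHomog h); apply/funext => v /=.
  by rewrite mpoly.mevalZ mpoly.meval1 mulr1.
move=> [qs [hq ->]].
have [Ps hP] := choice (fun i => IH _ (hq i)).
have h : (\sum_i mpoly.mpolyX C (mpoly.mnm1 i) * mpoly.mpoly_of_dhomog (Ps i)) \is
    mpoly.ishomog1 n.+1 mpoly.mdeg.
  apply: (big_ind (fun x => x \is mpoly.ishomog1 n.+1 mpoly.mdeg)) => [|x y hx hy|i _]; first exact: mpoly.dhomog0.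
    exact: mpoly.dhomogD.
  rewrite -add1n; apply: mpoly.dhomogM; last by case: (Ps i).
  by rewrite mpoly.dhomogX; apply/eqP; exact: mpoly.mdeg1.
exists (mpoly.DHomog h); apply/funext => v /=.
rewrite (big_morph _ (mpoly.mevalD _) (mpoly.meval0 _)); apply: eq_bigr => i _.
by rewrite mpoly.mevalM mpoly.mevalXU hP.
Qed.
End PolynomialFunctions.

(** * Covariant functionals *)

Section CovariantFunctionals.
Variables (R : realType) (p d : nat) (a : bool) (la : R[i]).
Variables (tau : 'M[R]_p -> 'M[R[i]]_d) (nu : R[i]).
Local Notation V := 'cV[R]_p.+2.
Local Notation C := R[i].
Local Notation rep := (sgn_tensor a (fun _ : 'M[R]_p.+1 => 1%:M : 'M[R[i]]_1)).
Implicit Types (phi : V -> C) (q r : 'cV[C]_p -> C) (L : (V -> C) -> 'cV[C]_d).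

Definition par_act (h : 'M[R]_p) (t : R) (y : 'rV[R]_p) phi (v : V) : C :=
  phi (vec (((\det h)^-1 * expR t) * (v ord0 ord0 + (y *m cmid v) ord0 ord0))
           (expR (- (t / p%:R)) *: (h *m cmid v)) (v ord_max ord0)).

(** These are the properties of [Lam D] that the classification uses. They pass to linear
    combinations, so that differences of two functionals can be analysed in the same way. *)
Definition covariant L := [/\
  forall c phi phi', isec a la phi -> isec a la phi' ->
    L (fun v => c * phi v + phi' v) = c *: L phi + L phi',
  forall phi phi', isec a la phi -> isec a la phi' ->
    (\forall v \near (bvec ord0 : V), phi v = phi' v) -> L phi = L phi',
  exists M, forall phi, isec a la phi ->
    (forall b, van (@punct R p.+1) M (fun v => reim b (phi v))) -> L phi = 0 &
  forall phi h t y, isec a la phi -> h \in @SLpmpred R p ->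
    L (par_act h t y phi) = invmx (cexp (nu * real_complex R t) *: tau h) *m L phi].

Lemma covariant_Lam (D : Ind rep la -> Ind tau nu) : (0 < p)%N ->
  is_diffop D -> intertwining D -> covariant (Lam D).
Proof.
move=> p0 dD iD; split.
- by move=> c phi phi'; exact: Lam_lin.
- by move=> phi phi'; exact: Lam_near.
- exact: Lam_van.
- by move=> phi h t y; exact: Lam_par.
Qed.

Lemma covariant_lin c L L' : covariant L -> covariant L' ->
  covariant (fun phi => c *: L phi + L' phi).
Proof.
move=> [l1 n1 [M1 v1] p1] [l2 n2 [M2 v2] p2]; split.
- move=> e phi phi' ip ip'; rewrite l1 // l2 // !scalerDr !scalerA (mulrC c e).
  by rewrite -!addrA; congr (_ + _); rewrite addrCA.
- by move=> phi phi' ip ip' e; rewrite (n1 _ _ ip ip' e) (n2 _ _ ip ip' e).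
- exists (maxn M1 M2) => phi ip h; rewrite v1 // ?v2 // ?scaler0 ?addr0 // => b.
    exact: (van_le (leq_maxr _ _) (h b)).
  exact: (van_le (leq_maxl _ _) (h b)).
- by move=> phi h t y ip hh; rewrite p1 // p2 // mulmxDr scalemxAr.
Qed.

Variable L : (V -> C) -> 'cV[C]_d.
Hypothesis covL : covariant L.

Lemma cov_lin c phi phi' : isec a la phi -> isec a la phi' ->
  L (fun v => c * phi v + phi' v) = c *: L phi + L phi'.
Proof. by case: covL => h _ _ _; exact: h. Qed.

Lemma cov_near phi phi' : isec a la phi -> isec a la phi' ->
  (\forall v \near (bvec ord0 : V), phi v = phi' v) -> L phi = L phi'.
Proof. by case: covL => _ h _ _; exact: h. Qed.

Lemma cov_par phi h t y : isec a la phi -> h \in @SLpmpred R p ->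
  L (par_act h t y phi) = invmx (cexp (nu * real_complex R t) *: tau h) *m L phi.
Proof. by case: covL => _ _ _; apply. Qed.

Lemma cov0 : L (fun=> 0) = 0.
Proof.
have i0 := @isec0 R p a la.
have := cov_lin (-1) i0 i0; rewrite scaleN1r addNr => <-.
by congr L; apply/funext => v; rewrite mulr0 addr0.
Qed.

Lemma covZ c phi : isec a la phi -> L (fun v => c * phi v) = c *: L phi.
Proof.
move=> ip; have := cov_lin c ip (@isec0 R p a la); rewrite cov0 addr0 => <-.
by congr L; apply/funext => v; rewrite addr0.
Qed.

Lemma cov_sum (I : Type) (s : seq I) (c : I -> C) (F : I -> V -> C) :
  (forall i, isec a la (F i)) ->
  L (fun v => \sum_(i <- s) c i * F i v) = \sum_(i <- s) c i *: L (F i).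
Proof.
move=> h; elim: s => [|i s IH].
  rewrite big_nil -cov0; congr L.
  by apply/funext => v; rewrite big_nil.
rewrite big_cons -IH -cov_lin //; last exact: isec_sum.
by congr L; apply/funext => v; rewrite big_cons.
Qed.

Lemma cov_taylor : exists M, forall phi, isec a la phi ->
  L phi = \sum_(n < M) real_complex R (n`!%:R)^-1 *: L (tst a la n (upoly n (jet phi))).
Proof.
case: covL => _ _ [M hM] _; exists M => phi ip.
have iT := isec_taylor a la M phi.
rewrite -(cov_sum _ (fun n : 'I_M => real_complex R (n`!%:R)^-1)); last first.
  by move=> n; apply: isec_tst; exact: hfun_upoly.
have e : (fun v => phi v + -1 * taylor a la M phi v) = (fun v => -1 * taylor a la M phi v + phi v).
  by apply/funext => v; rewrite addrC.
have ir : isec a la (fun v => phi v + (-1) * taylor a la M phi v).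
  by rewrite e; exact: isec_lin.
have := hM _ ir (fun b => taylor_rem M b ip).
rewrite e cov_lin // scaleN1r addrC => /eqP; rewrite subr_eq0 => /eqP ->.
by congr L.
Qed.

(* q(x') z^m, where v = (v_0, x', z). *)
Definition Qf m q (v : V) : C := q (cx (cmid v)) * real_complex R (v ord_max ord0) ^+ m.

Lemma hfun_Qf l m q : hpoly l q -> hfun (l + m) (Qf m q).
Proof.
move=> h; apply: (hfunM (Q := fun v => q (cx (cmid v)))
  (Q' := fun v => real_complex R (v ord_max ord0) ^+ m)); last exact: (hfunX m (hfun_coord R ord_max)).
elim: l q h => [|l IH] q /=; first by move=> [c ->]; exact: hfun_cst.
move=> [qs [hq ->]]; apply: hfun_sum => i; rewrite -add1n; apply: hfunM (IH _ (hq i)).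
rewrite (_ : (fun v => _) = fun v : V => real_complex R (v (mid i) ord0)); first exact: (hfun_coord R).
by apply/funext => v; rewrite !mxE.
Qed.

Definition psi l m q := L (tst a la (l + m) (Qf m q)).

Lemma isec_psi l m q : hpoly l q -> isec a la (tst a la (l + m) (Qf m q)).
Proof. by move=> h; apply: isec_tst; exact: hfun_Qf. Qed.

Lemma psi_lin l m c q r : hpoly l q -> hpoly l r ->
  psi l m (fun y => c * q y + r y) = c *: psi l m q + psi l m r.
Proof.
move=> hq hr; rewrite /psi -cov_lin; try exact: isec_psi.
by congr L; apply/funext => v; rewrite /tst /Qf; ring.
Qed.

Lemma psi0 l m : psi l m (fun=> 0) = 0.
Proof.
rewrite /psi -cov0; congr L.
by apply/funext => v; rewrite /tst /Qf mul0r mulr0.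
Qed.

Lemma psiZ l m c q : hpoly l q -> psi l m (fun y => c * q y) = c *: psi l m q.
Proof.
move=> h; rewrite /psi -covZ; last exact: isec_psi.
by congr L; apply/funext => v; rewrite /tst /Qf; ring.
Qed.

Lemma psi_sum l m (I : Type) (s : seq I) (f : I -> 'cV[C]_p -> C) :
  (forall i, hpoly l (f i)) ->
  psi l m (fun y => \sum_(i <- s) f i y) = \sum_(i <- s) psi l m (f i).
Proof.
move=> h; elim: s => [|i s IH].
  by rewrite big_nil -(psi0 l m); congr psi; apply/funext => y; rewrite big_nil.
rewrite big_cons -IH -[psi _ _ (f i)]scale1r -psi_lin //; last exact: hpoly_sum.
by congr psi; apply/funext => y; rewrite big_cons mul1r.
Qed.

Lemma eq_psi_real l m q r : (forall x, q (cx x) = r (cx x)) -> psi l m q = psi l m r.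
Proof. by move=> h; congr (L _); apply/funext => v; rewrite /tst /Qf h. Qed.

(** A coordinate other than v_0 is either some x'_j or z. The factors of [upoly] are absorbed one at
    a time into q or into the power of z, until only products q(x') z^m remain. *)
Lemma tst_upoly0 n b l m q : hpoly l q ->
  (forall l' m' q', (l' + m' = n + (l + m))%N -> hpoly l' q' -> psi l' m' q' = 0) ->
  L (tst a la (n + (l + m)) (fun v => upoly n b v * Qf m q v)) = 0.
Proof.
elim: n b l m q => [|n IH] b l m q hq h0.
  rewrite (_ : tst _ _ _ _ = fun v => b [::] * tst a la (l + m) (Qf m q) v).
    by rewrite covZ; [rewrite [L _](h0 l m) ?scaler0|exact: isec_psi].
  by apply/funext => v; rewrite -tstZ.
have e v : tst a la (n.+1 + (l + m)) (fun v => upoly n.+1 b v * Qf m q v) v =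
    \sum_k 1 * tst a la (n.+1 + (l + m)) (fun v => upoly n (fun w => b (k :: w)) v *
       (real_complex R (ucoord v k) * Qf m q v)) v.
  rewrite /tst /upoly /= mulr_suml mulr_sumr; apply: eq_bigr => k _.
  by rewrite mul1r; congr (_ * _); rewrite mulrAC mulrC mulrA mulrC.
have hk (k : 'I_p.+1) : exists l' m' q', [/\ hpoly l' q', (l' + m' = (l + m).+1)%N &
    forall v, real_complex R (ucoord v k) * Qf m q v = Qf m' q' v].
  have [i ei] : exists i, i = lift ord0 k by exists (lift ord0 k).
  elim/ord_cases: i ei => [||].
  - by move=> /eqP; rewrite (negbTE (neq_lift _ _)).
  - move=> j ej; exists l.+1, m, (fun y : 'cV[C]_p => y j ord0 * q y); split=> //; first exact: hpoly_coord.
    by move=> v; rewrite /Qf /ucoord -ej cxE mxE mulrA.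
  - move=> ej; exists l, m.+1, q; split=> //; first by rewrite addnS.
    by move=> v; rewrite /Qf /ucoord -ej exprS mulrCA.
rewrite (_ : tst _ _ _ _ = fun v => \sum_k 1 * tst a la (n.+1 + (l + m)) (fun v => upoly n (fun w => b (k :: w)) v *
       (real_complex R (ucoord v k) * Qf m q v)) v); last by apply/funext => v; exact: e.
rewrite cov_sum => [|k].
  rewrite big1 // => k _; rewrite scale1r.
  have [l' [m' [q' [hq' el ev]]]] := hk k.
  rewrite (_ : (fun v => _ * _) = fun v => upoly n (fun w => b (k :: w)) v * Qf m' q' v).
    rewrite addSnnS -el; apply: IH => // l2 m2 q2 e2; apply: h0.
    by rewrite e2 el addSnnS.
  by apply/funext => v; rewrite ev.
apply: isec_tst; rewrite addSnnS; apply: hfunM; first exact: hfun_upoly.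
rewrite -add1n; apply: hfunM; [exact: (hfun_coord R)|exact: hfun_Qf].
Qed.

Lemma cov_upoly0 n b :
  (forall l' m' q', (l' + m' = n)%N -> hpoly l' q' -> psi l' m' q' = 0) ->
  L (tst a la n (upoly n b)) = 0.
Proof.
move=> h0; have h1 : hpoly 0 (fun _ : 'cV[C]_p => 1) by exists 1.
have := @tst_upoly0 n b 0 0 _ h1; rewrite !addn0 => /(_ h0) <-.
by congr L; apply/funext => v; rewrite /tst /Qf; ring.
Qed.

Lemma cov_eq0 : (forall l m q, hpoly l q -> psi l m q = 0) ->
  forall phi, isec a la phi -> L phi = 0.
Proof.
move=> h0 phi ip; have [M ->] := cov_taylor => //.
by rewrite big1 // => n _; rewrite cov_upoly0 ?scaler0 // => l m q _; exact: h0.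
Qed.

Lemma isec_par_act h t y phi : h \in @SLpmpred R p -> (0 < p)%N ->
  isec a la phi -> isec a la (par_act h t y phi).
Proof.
move=> hh p0 ip.
have dh : \det h != 0 by have [->|->] := SLpm_det hh; rewrite ?oppr_eq0 oner_eq0.
have := isec_act (diag1 (MkSL (det_par t y p0 dh))) ip.
rewrite (_ : (fun v => _) = par_act h t y phi) //; apply/funext => v /=.
by rewrite /par_act {1}(vecE v) par_vec.
Qed.

Lemma SLpm_det_neq0 (h : 'M[R]_p) : h \in @SLpmpred R p -> \det h != 0.
Proof. by move=> hh; have [->|->] := SLpm_det hh; rewrite ?oppr_eq0 oner_eq0. Qed.

(** The factors arise from the test section: v_0 is scaled by c, which contributes chi(c) c^-(l+m),
    and x' by e^(-t/p), which contributes its l-th power. *)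
Lemma psi_par l m q h t : hpoly l q -> h \in @SLpmpred R p -> (0 < p)%N ->
  let c := (\det h)^-1 * expR t in
  (chi a la c * real_complex R c ^- (l + m) * real_complex R (expR (- (t / p%:R))) ^+ l) *:
    psi l m (fun y => q (map_mx (real_complex R) h *m y)) =
  invmx (cexp (nu * real_complex R t) *: tau h) *m psi l m q.
Proof.
move=> hq hh p0 c; have ip := isec_psi m hq.
have dh := SLpm_det_neq0 hh.
have c0 : c != 0 by rewrite mulf_neq0 ?invr_eq0 // gt_eqF ?expR_gt0.
have hq' := hpoly_comp (map_mx (real_complex R) h) hq.
rewrite /psi -(cov_par t 0 ip hh) -covZ; last exact: isec_psi.
apply: cov_near; [by apply: isecZ; exact: isec_psi|exact: isec_par_act|].
pose Af (v : V) : V := diag1_mx (par_M h *m par_A p t *m par_N 0) *m v.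
have AE (v : V) : Af v = vec (c * (v ord0 ord0)) (expR (- (t / p%:R)) *: (h *m cmid v)) (v ord_max ord0).
  by rewrite /Af {1}(vecE v) par_vec mul0mx (mxE _ _ ord0 ord0) addr0.
have Ae0 : Af (e0 R p) = c *: e0 R p.
  have e1 : e0 R p ord0 ord0 = 1 by rewrite !mxE eqxx.
  have e2 : cmid (e0 R p) = 0 by apply/colP => j; rewrite !mxE.
  have e3 : e0 R p ord_max ord0 = 0 by rewrite !mxE.
  rewrite AE e1 e2 e3 mulmx0 scaler0; apply/colP => i.
  elim/ord_cases: i => [|j|]; rewrite ?vec_0 ?vec_mid ?vec_max mxE.
  - by rewrite e1.
  - by rewrite mxE !mxE mulr0.
  - by rewrite e3 mulr0.
have cA : Af @ (e0 R p) --> (c *: e0 R p : V).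
  rewrite -Ae0; apply: linear_mx_continuous => k u v.
  by rewrite /Af mulmxDr scalemxAr.
have n1 : nbhs (e0 R p) [set v | tst a la (l + m) (Qf m q) (Af v) = chi a la ((Af v) ord0 ord0) *
   real_complex R ((Af v) ord0 ord0) ^- (l + m) * Qf m q (Af v)] := cA _ (tst_near a la (l + m) (Qf m q) c0).
have n2 := tst_near a la (l + m) (Qf m (fun y => q (map_mx (real_complex R) h *m y))) (oner_neq0 R).
rewrite scale1r in n2.
have n3 : nbhs (e0 R p) [set v : V | v ord0 ord0 != 0].
  have := @coord_continuous R p.+2 1 ord0 ord0 (e0 R p) [set r : R | r != 0].
  apply; apply: open_nbhs_nbhs; split; first exact: open_neq.
  by rewrite /= !mxE eqxx oner_eq0.
apply: filterS (filterI n1 (filterI n2 n3)) => v [e [E2 v0]].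
rewrite {}E2.
rewrite /par_act mul0mx (mxE _ _ ord0 ord0) addr0 -/c -AE e AE vec_0 (chiM a la c0 v0) [real_complex R (c * _)](rmorphM (real_complex R) c (v ord0 ord0)) exprMn invfM.
rewrite /Qf cmid_vec vec_max.
have -> : cx (expR (- (t / p%:R)) *: (h *m cmid v)) =
   real_complex R (expR (- (t / p%:R))) *: (map_mx (real_complex R) h *m cx (cmid v)).
  by rewrite /cx map_mxZ map_mxM.
rewrite (hpoly_scale _ _ hq).
by ring.
Qed.

End CovariantFunctionals.

Section Representations.
Variables (R : realType) (k d : nat).
Local Notation C := R[i].

Lemma SL_inv_mem (g : 'M[R]_k) : g \in @SLpred R k -> invmx g \in @SLpred R k.
Proof. by rewrite !inE det_inv => /eqP ->; rewrite invr1. Qed.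

Lemma SLpm_of_SL (g : 'M[R]_k) : g \in @SLpred R k -> g \in @SLpmpred R k.
Proof. by rewrite !inE => /eqP ->; rewrite normr1. Qed.

Lemma SL_unitmx (g : 'M[R]_k) : g \in @SLpred R k -> g \in unitmx.
Proof. by rewrite inE unitmxE => /eqP ->; exact: unitr1. Qed.

Lemma rep_invmx (rho : 'M[R]_k -> 'M[C]_d) g : is_rep (@SLpred R k) rho ->
  g \in @SLpred R k -> invmx (rho g) = rho (invmx g).
Proof.
move=> [r1 rM _] hg.
have e : rho g *m rho (invmx g) = 1%:M.
  by rewrite -rM ?SL_inv_mem // mulmxV ?SL_unitmx.
have [ug _] := mulmx1_unit e.
by rewrite -[RHS]mul1mx -(mulVmx ug) -mulmxA e mulmx1.
Qed.

(** A row space of maximal rank inside S exhausts S. This turns the image of psi_(l,m), given as a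
    set, into the matrix that [irreducible] quantifies over. *)
Lemma linear_closed_rowspace (S : set 'rV[C]_d) :
  S 0 -> (forall c u v, S u -> S v -> S (c *: u + v)) ->
  exists U : 'M[C]_d, forall v, (v <= U)%MS <-> S v.
Proof.
move=> S0 SL.
pose Q n := `[< exists U : 'M[C]_d, (forall v : 'rV_d, (v <= U)%MS -> S v) /\ \rank U = n >].
have Q0 : exists n, Q n.
  exists 0%N; apply/asboolP; exists 0; split; last exact: mxrank0.
  by move=> v; rewrite submx0 => /eqP ->.
have Qb n : Q n -> (n <= d)%N by move=> /asboolP[U [_ <-]]; exact: rank_leq_col.
case: (ex_maxnP Q0 Qb) => n /asboolP[U [hU rU]] nmax.
exists U => v; split=> [|Sv]; first exact: hU.
apply: contrapT => nv.
have : (\rank (U + v)%MS <= n)%N.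
  apply: nmax; apply/asboolP; exists (U + v)%MS; split=> // w /sub_addsmxP[[u1 u2] ->] /=.
  rewrite addrC (mx11_scalar u2) mul_scalar_mx; apply: SL => //.
  by apply: hU; exact: submxMl.
rewrite -rU => h; apply: nv.
have := (mxrank_leqif_sup (addsmxSl U v)).2.
rewrite eqn_leq h mxrankS ?addsmxSl //= => /esym hs.
by apply: submx_trans hs; exact: addsmxSr.
Qed.

End Representations.

(** * Injectivity of psi_(l,m) *)

Section PsiInjective.
Variables (R : realType) (p d : nat) (a : bool) (la : R[i]).
Variables (tau : 'M[R]_p -> 'M[R[i]]_d) (nu : R[i]).
Local Notation V := 'cV[R]_p.+2.
Local Notation C := R[i].
Local Notation W := 'cV[C]_p.
Variable L : (V -> C) -> 'cV[C]_d.
Hypothesis covL : covariant a la tau nu L.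
Hypothesis p0 : (0 < p)%N.
Implicit Types q r : W -> C.
Local Notation psi := (psi a la L).

(** The polynomial r collects the factors split off from q. Each coordinate of (s + E) x is s x_j +
    (E x)_j, and moving its two terms into r keeps l + k constant. *)
Lemma psi_comp_poly l k m q r (E : 'M[C]_p) i : hpoly l q -> hpoly k r ->
  exists P : {poly C}, forall s,
    psi (l + k) m (fun x => q ((s%:M + E) *m x) * r x) i ord0 = P.[s].
Proof.
elim: l k q r => [|l IH] k q r /=.
  move=> [c ->] hr; exists (psi k m (fun x => c * r x) i ord0)%:P => s.
  by rewrite hornerC.
move=> [qs [hq ->]] hr.
have h1 j : hpoly k.+1 (fun x => x j ord0 * r x) by exact: hpoly_coord.
have h2 j : hpoly k.+1 (fun x => (row j E *m x) ord0 ord0 * r x).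
  by rewrite -add1n; apply: hpolyM => //; exact: hpoly_form.
have [P1 hP1] := choice (fun j => IH _ _ _ (hq j) (h1 j)).
have [P2 hP2] := choice (fun j => IH _ _ _ (hq j) (h2 j)).
exists (\sum_j ('X * P1 j + P2 j)) => s.
rewrite horner_sum addSnnS.
have hh (t : W -> C) j : hpoly k.+1 t -> hpoly (l + k.+1) (fun x => qs j ((s%:M + E) *m x) * t x).
  by move=> ht; apply: hpolyM => //; exact: hpoly_comp.
rewrite (_ : (fun x => _) = fun x => \sum_j (s * (qs j ((s%:M + E) *m x) * (x j ord0 * r x)) +
    qs j ((s%:M + E) *m x) * ((row j E *m x) ord0 ord0 * r x))).
  rewrite (psi_sum covL) => [|j]; last by apply: hpoly_lin; apply: hh.
  rewrite summxE; apply: eq_bigr => j _.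
  rewrite (psi_lin covL); [|exact: hh|exact: hh].
  by rewrite !mxE hP1 hP2 !hornerE.
apply/funext => x; rewrite mulr_suml; apply: eq_bigr => j _.
have -> : ((s%:M + E) *m x) j ord0 = s * x j ord0 + (row j E *m x) ord0 ord0.
  by rewrite mulmxDl mul_scalar_mx -row_mul !mxE.
by ring.
Qed.

Definition form (y : 'rV[R]_p) (x : W) : C := (map_mx (real_complex R) y *m x) ord0 ord0.

Lemma hpoly_form1 y : hpoly 1 (form y).
Proof. exact: hpoly_form. Qed.

Lemma form_deltaD y j (s : R) x : form (y + s *: delta_mx ord0 j) x = form y x + real_complex R s * x j ord0.
Proof.
rewrite /form map_mxD map_mxZ map_delta_mx mulmxDl -scalemxAl -rowE !mxE; congr (_ + _).
Qed.

Lemma psi_form_step n k m r j : hpoly k r ->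
  (forall y, psi (n.+1 + k) m (fun x => form y x ^+ n.+1 * r x) = 0) ->
  forall y, psi (n + k.+1) m (fun x => form y x ^+ n * (x j ord0 * r x)) = 0.
Proof.
move=> hr h0 y; apply/colP => i; rewrite [RHS]mxE.
pose T (t : 'I_n.+2) (x : W) := form y x ^+ (n.+1 - t) * (x j ord0) ^+ t * r x.
have hT t : hpoly (n.+1 + k) (T t).
  have := hpolyM (hpolyM (hpolyX (n.+1 - t) (hpoly_form1 y)) (hpolyX t (hpoly_coord1 R j))) hr.
  by rewrite subnK // -ltnS.
(* [inord] extends the coefficients to all of nat, as [\poly] expects; only t < n + 2 matters. *)
pose c (t : nat) := (psi (n.+1 + k) m (T (inord t)) i ord0 *+ 'C(n.+1, t)).
pose P := \poly_(t < n.+2) c t.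
have P0 : P = 0.
  apply: poly_real_zero => s _; rewrite horner_poly.
  have e0 : psi (n.+1 + k) m (fun x => form (y + s *: delta_mx ord0 j) x ^+ n.+1 * r x) i ord0 = 0.
    by rewrite h0 mxE.
  rewrite -[RHS]e0 (_ : (fun x => _) = fun x => \sum_(t < n.+2) (real_complex R s ^+ t *+ 'C(n.+1, t)) * T t x).
    rewrite (psi_sum covL) => [|t]; last exact: hpolyZ.
    rewrite summxE; apply: eq_bigr => t _; rewrite (psiZ covL) // mxE /c inord_val.
    by rewrite !mulrnAl mulrC.
  apply/funext => x; rewrite form_deltaD exprDn mulr_suml; apply: eq_bigr => t _.
  rewrite /T exprMn !mulrnAl; congr (_ *+ _).
  have gen (A B D G : C) : A * (B * D) * G = B * (A * D * G) by ring.
  exact: gen.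
have : P`_1 = 0 by rewrite P0 coef0.
rewrite coef_poly /= /c bin1 => /eqP; rewrite mulrn_eq0 /= => /eqP <-.
rewrite addSnnS; congr (psi _ _ _ _ _); apply/funext => x.
by rewrite /T inordK // subn1 /= expr1 mulrA.
Qed.

Lemma psi_form_zero l m : (forall y, psi l m (fun x => form y x ^+ l) = 0) ->
  forall q, hpoly l q -> psi l m q = 0.
Proof.
(* The coordinate factors of q are moved into r one by one, with a polarisation step for each. *)
have gen n k q r : hpoly n q -> hpoly k r ->
    (forall y, psi (n + k) m (fun x => form y x ^+ n * r x) = 0) ->
    psi (n + k) m (fun x => q x * r x) = 0.
  elim: n k q r => [|n IH] k q r /=.
    move=> [c ->] hr /(_ 0); rewrite (psiZ covL) //.
    rewrite (_ : (fun x => _ * _) = r) => [->|]; first by rewrite scaler0.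
    by apply/funext => x; rewrite mul1r.
  move=> [qs [hq ->]] hr h0.
  rewrite (_ : (fun x => _) = fun x => \sum_j qs j x * (x j ord0 * r x)).
    rewrite addSnnS (psi_sum covL) => [|j].
      rewrite big1 // => j _; apply: IH => //; first exact: hpoly_coord.
      exact: psi_form_step.
    by apply: hpolyM => //; exact: hpoly_coord.
  by apply/funext => x; rewrite mulr_suml; apply: eq_bigr => j _; rewrite mulrCA mulrA.
move=> h0 q hq.
have h1 : hpoly 0 (fun _ : W => 1) by exists 1.
have e f : (fun x : W => f x * 1) = f :> (W -> C) by apply/funext => x; rewrite mulr1.
have := gen l 0 _ _ hq h1; rewrite addn0 e; apply=> y.
by rewrite e.
Qed.

Lemma psi_GL0 l m q (h : 'M[R]_p) : hpoly l q -> psi l m q = 0 -> \det h != 0 ->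
  psi l m (fun x => q (map_mx (real_complex R) h *m x)) = 0.
Proof.
move=> hq q0 dh.
(* The p-th root of |det h|: dividing h by s brings it into SL^{+-}, and by homogeneity of q the
   division costs only a scalar. *)
pose s := expR (ln `|\det h| / p%:R).
have s0 : s != 0 by rewrite gt_eqF ?expR_gt0.
have hh : s^-1 *: h \in @SLpmpred R p.
  have dh' : 0 < `|\det h| by rewrite normr_gt0.
  rewrite inE detZ normrM normrX normfV (ger0_norm (expR_ge0 _)) exprVn -expRM_natr.
  rewrite divfK; last by rewrite pnatr_eq0 -lt0n.
  by rewrite lnK ?posrE // mulVf // gt_eqF.
have := psi_par covL m 0 hq hh p0; rewrite q0 mulmx0 => /eqP; rewrite scaler_eq0.
have n0 c : c != 0 -> chi a la c * real_complex R c ^- (l + m) != 0.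
  by move=> c0; rewrite mulf_neq0 ?chi_neq0 // invr_eq0 expf_neq0 // fmorph_eq0.
rewrite mul0r oppr0 expR0 mulr1 rmorph1 expr1n mulr1 (negbTE (n0 _ _)) /=; last first.
  by rewrite invr_eq0; exact: SLpm_det_neq0 hh.
move=> /eqP e; rewrite -[RHS](scaler0 _ (real_complex R s ^+ l)) -e -(psiZ covL); last exact: hpoly_comp.
congr (psi _ _ _); apply/funext => x.
rewrite -(hpoly_scale _ _ hq); congr q.
by rewrite scalemxAl -map_mxZ scalerA divff // scale1r.
Qed.

(* q o (s + e y^T) is in the GL(p)-orbit of q up to a scalar for generic s, is
   polynomial in s, and equals q(e) (y x)^l at s = 0. *)
Lemma psi_inj l m q e : hpoly l q -> psi l m q = 0 -> q (cx e) != 0 ->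
  forall r, hpoly l r -> psi l m r = 0.
Proof.
move=> hq q0 qe; apply: psi_form_zero => y; apply/colP => i; rewrite [RHS]mxE.
pose E := e *m y; pose Ec := map_mx (real_complex R) E.
have h1 : hpoly 0 (fun _ : W => 1) by exists 1.
have [P hP] := psi_comp_poly m Ec i hq h1.
(* Its value at s is det(s + E). The polynomial P vanishes wherever this is nonzero, so P * cp
   vanishes for all s > 0; as [cp] is monic, P itself is 0. *)
pose cp := map_poly (real_complex R) (char_poly (- E)).
have cpP s : cp.[real_complex R s] = real_complex R (\det (s%:M + E)).
  rewrite horner_map /char_poly -horner_evalE -det_map_mx; congr (real_complex R (\det _)).
  apply/matrixP => u v; rewrite !mxE.
  rewrite -[LHS]/(('X *+ (u == v) - (- \sum_j e u j * y j v)%:P).[s]).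
  by rewrite hornerD hornerN hornerMn hornerX hornerC opprK.
have PP : P * cp = 0.
  apply: poly_real_zero => s _; rewrite hornerM cpP -hP addn0.
  have [->|dh] := eqVneq (\det (s%:M + E)) 0; first by rewrite rmorph0 mulr0.
  have := psi_GL0 hq q0 dh; rewrite map_mxD map_scalar_mx => /colP/(_ i); rewrite [RHS]mxE => e0.
  rewrite (_ : (fun x => _ * 1) = fun x => q (((real_complex R s)%:M + Ec) *m x)).
    by rewrite e0 mul0r.
  by apply/funext => x; rewrite mulr1.
have P0 : P = 0.
  move/eqP: PP; rewrite mulf_eq0 => /orP[/eqP //|]; rewrite map_poly_eq0.
  by rewrite (negbTE (monic_neq0 (char_poly_monic _))).
have := hP 0; rewrite P0 horner0 addn0.
rewrite (_ : (fun x => _) = fun x => q (cx e) * form y x ^+ l).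
  rewrite (psiZ covL); last by apply: hpolyX; exact: hpoly_form1.
  by rewrite mxE => /eqP; rewrite mulf_eq0 (negbTE qe) => /eqP.
apply/funext => x; rewrite mulr1 raddf0 add0r /Ec map_mxM -mulmxA mulrC -(hpoly_scale _ _ hq).
by congr q; rewrite /form {1}[map_mx _ y *m x]mx11_scalar mul_mx_scalar.
Qed.

End PsiInjective.

Section Exponential.
Variable R : realType.

Lemma cexp_real (x : R) : cexp (real_complex R x) = real_complex R (expR x).
Proof. by rewrite /cexp /= cos0 sin0 -[Complex 1 0]/(1 : R[i]) mulr1. Qed.

Lemma cexp_neq0 (z : R[i]) : cexp z != 0.
Proof.
have e : cexp z * cexp (- z) = 1 by rewrite -cexpD subrr cexp0.
by apply/eqP => h; move: e; rewrite h mul0r => /eqP; rewrite eq_sym oner_eq0.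
Qed.

Lemma cexpN (z : R[i]) : cexp (- z) = (cexp z)^-1.
Proof. by apply: (mulfI (cexp_neq0 z)); rewrite -cexpD subrr cexp0 divff ?cexp_neq0. Qed.

Lemma cexp_eq1 (z : R[i]) : (forall t, cexp (z * real_complex R t) = 1) -> z = 0.
Proof.
case: z => x y h.
have h1 t : expR (x * t) * cos (y * t) = 1 /\ expR (x * t) * sin (y * t) = 0.
  have := h t; rewrite /cexp.
  have -> : Complex x y * real_complex R t = Complex (x * t) (y * t).
    by apply/eqP; rewrite eq_complex /= !mulr0 subr0 add0r mulrC eqxx /= mulrC.
  by move=> /(congr1 (fun z => (complex.Re z, complex.Im z))) [] /=; rewrite !mul0r subr0 addr0.
have y0 : y = 0.
  (* At t = pi / y the cosine is -1, against the positivity of the exponential. *)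
  apply: contrapT => /eqP y0; have [] := h1 (pi / y).
  have -> : y * (pi / y) = pi by rewrite mulrC divfK.
  by rewrite cospi => e _; have := expR_gt0 (x * (pi / y)); lra.
have [] := h1 1; rewrite y0 mul0r cos0 !mulr1 => e _.
have -> : x = 0 by apply: expR_inj; rewrite e expR0.
by [].
Qed.

Lemma chi_expR a la (t : R) : chi a la (expR t) = cexp (- la * real_complex R t).
Proof. by rewrite /chi gtr0_sg ?expR_gt0 // rmorph1 expr1n mul1r gtr0_norm ?expR_gt0 // expRK. Qed.

End Exponential.

(** * Torus weights of polynomials *)

Section Weights.
Variables (R : realType) (p : nat) (j0 j1 : 'I_p).
Hypothesis j01 : j0 != j1.
Local Notation C := R[i].
Implicit Types q : 'cV[C]_p -> C.

Definition torus_row (s : R) : 'rV[R]_p := \row_j (if j == j0 then s else if j == j1 then s^-1 else 1).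
Definition torus (s : R) : 'M[R]_p := diag_mx (torus_row s).

Lemma torusE s (x : 'cV[R]_p) j : (torus s *m x) j ord0 = torus_row s ord0 j * x j ord0.
Proof. by rewrite /torus mul_diag_mx mxE. Qed.

Lemma torus_SL s : s != 0 -> torus s \in @SLpred R p.
Proof.
move=> s0; rewrite inE det_diag (bigD1 j0) //= (bigD1 j1) /=; last by rewrite eq_sym.
rewrite !mxE !eqxx (eq_sym j1) (negbTE j01) mulrA divff // mul1r big1 // => j /andP[h1 h2].
by rewrite mxE (negbTE h1) (negbTE h2).
Qed.

(* The weights of the torus on the polynomials of degree l are at most l, and that
   of x_(j0)^l is the only one equal to l. *)
Lemma hpoly_weight l l' q : hpoly l q ->
  (forall s x, 0 < s -> q (cx (torus s *m x)) = real_complex R s ^+ l' * q (cx x)) ->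
  ((l < l')%N -> forall x, q (cx x) = 0) /\
  (l = l' -> forall x, q (cx x) = q (cx (delta_mx j0 ord0)) * real_complex R (x j0 ord0) ^+ l).
Proof.
move=> hq hw.
(* The entries of u (torus(u^-1) x) as polynomials in u: the entry at j0 is constant, and the others
   vanish at u = 0, where only x_(j0) survives. *)
pose f (x : 'cV[R]_p) j : {poly C} :=
  (if j == j0 then 1 else if j == j1 then 'X^2 else 'X) * (real_complex R (x j ord0))%:P.
have hf x : exists P : {poly C}, (forall u : R, 0 < u ->
    P.[real_complex R u] = real_complex R u ^+ l * real_complex R u ^- l' * q (cx x)) /\
    P.[0] = q (cx (delta_mx j0 ord0)) * real_complex R (x j0 ord0) ^+ l.
  have [P hP] := hpoly_poly (f x) hq; exists P; split=> [u u0|].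
    have u1 : u != 0 by rewrite gt_eqF.
    rewrite -hP -mulrA -exprVn -fmorphV -hw ?invr_gt0 // -(hpoly_scale _ _ hq).
    congr q; apply/colP => j; rewrite [LHS]mxE [RHS]mxE cxE torusE mxE /f hornerM hornerC rmorphM mulrA; congr (_ * _).
    case: (j == j0); first by rewrite hornerC -rmorphM divff // rmorph1.
    case: (j == j1); last by rewrite hornerX rmorph1 mulr1.
    by rewrite hornerXn invrK expr2.
  rewrite -hP mulrC -(hpoly_scale _ _ hq); congr q; apply/colP => j; rewrite !mxE /f hornerM hornerC.
  have [->|h] := eqVneq j j0; first by rewrite hornerC rmorph1 mul1r mulr1.
  by case: (j == j1); rewrite ?hornerXn ?hornerX ?expr0n /= mul0r rmorph0 mulr0.
split=> [ll|ll] x; have [P [hP P0]] := hf x.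
  (* The identity P(u) = u^(l - l') q(x) for u > 0, cleared of the negative exponent; at u = 0 it
     reads q(x) = 0. *)
  pose Q := 'X^(l' - l) * P - (q (cx x))%:P.
  have Q0 : Q = 0.
    apply: poly_real_zero => s s0; rewrite /Q hornerD hornerN hornerC hornerM hornerXn hP //.
    have s1 : real_complex R s ^+ l' != 0 by rewrite expf_neq0 // fmorph_eq0 gt_eqF.
    by rewrite !mulrA -exprD subnK ?(ltnW ll) // divff // mul1r subrr.
  have : Q.[0] = 0 by rewrite Q0 horner0.
  rewrite /Q hornerD hornerN hornerC hornerM hornerXn expr0n subn_eq0 leqNgt ll /= mul0r add0r.
  by move=> /eqP; rewrite oppr_eq0 => /eqP.
pose Q := P - (q (cx x))%:P.
have Q0 : Q = 0.
  apply: poly_real_zero => s s0; rewrite /Q hornerD hornerN hornerC hP // -ll.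
  have s1 : real_complex R s ^+ l != 0 by rewrite expf_neq0 // fmorph_eq0 gt_eqF.
  by rewrite divff // mul1r subrr.
have : Q.[0] = 0 by rewrite Q0 horner0.
by rewrite /Q hornerD hornerN hornerC P0 => /eqP; rewrite subr_eq0 => /eqP ->.
Qed.

End Weights.

(** * Consequences of irreducibility *)

Section Irreducible.
Variables (R : realType) (p d : nat) (a : bool) (la : R[i]).
Variables (tau varpi : 'M[R]_p -> 'M[R[i]]_d) (nu : R[i]).
Local Notation V := 'cV[R]_p.+2.
Local Notation C := R[i].
Local Notation W := 'cV[C]_p.
Hypothesis rv : is_rep (@SLpred R p) varpi.
Hypothesis iv : irreducible (@SLpred R p) varpi.
Hypothesis tauE : {in @SLpred R p, tau =1 varpi}.
Variables (j0 j1 : 'I_p).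
Hypothesis j01 : j0 != j1.
Implicit Types q r : W -> C.
Local Notation covariant := (covariant a la tau nu).
Local Notation psi := (psi a la).

Let p0 : (0 < p)%N := leq_ltn_trans (leq0n j0) (ltn_ord j0).

Definition active (L : (V -> C) -> 'cV[C]_d) l m := exists2 q, hpoly l q & psi L l m q <> 0.

Lemma SL1 : 1%:M \in @SLpred R p.
Proof. by rewrite inE det1. Qed.

Lemma tau1 : tau 1%:M = 1%:M.
Proof. by rewrite tauE ?SL1 //; case: rv. Qed.

Lemma psi_SL L l m q h : covariant L -> hpoly l q -> h \in @SLpred R p ->
  psi L l m (fun x => q (map_mx (real_complex R) h *m x)) = varpi (invmx h) *m psi L l m q.
Proof.
move=> covL hq hh; have := psi_par covL m 0 hq (SLpm_of_SL hh) p0; cbv zeta.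
have dh : \det h = 1 by apply/eqP; move: hh; rewrite inE.
rewrite dh invr1 mul0r oppr0 expR0 mulr1 chi1 rmorph1 !expr1n invr1 !mulr1 scale1r => ->.
by rewrite rmorph0 mulr0 cexp0 scale1r tauE // (rep_invmx rv).
Qed.

Lemma active_inj L l m q : covariant L -> active L l m -> hpoly l q -> psi L l m q = 0 ->
  q = fun=> 0.
Proof.
move=> covL [r hr r0] hq q0; apply: (hpoly_real_zero hq) => e.
by apply: contrapT => /eqP qe; apply: r0; exact: (psi_inj covL p0 hq q0 qe).
Qed.

Lemma active_nu L l m : covariant L -> active L l m ->
  nu = la + (l + m)%:R + l%:R / p%:R.
Proof.
move=> covL [q hq q0].
(* The action of A' on a nonzero vector psi(q) gives the equality of two exponentials for all t, and
   [cexp_eq1] compares their exponents. *)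
suff : la + (l + m)%:R + l%:R / p%:R - nu = 0 by move/eqP; rewrite subr_eq0 => /eqP.
apply: cexp_eq1 => t.
have := psi_par covL m t hq (SLpm_of_SL SL1) p0; cbv zeta.
rewrite det1 invr1 mul1r tau1 scalemx1 invmx_scalar mul_scalar_mx map_mx1.
rewrite (_ : (fun x => q (1%:M *m x)) = q); last by apply/funext => x; rewrite mul1mx.
have -> : real_complex R (expR t) ^- (l + m) = cexp (real_complex R (- ((l + m)%:R * t))).
  by rewrite cexp_real expRN expRM_natl fmorphV rmorphXn.
have -> : real_complex R (expR (- (t / p%:R))) ^+ l = cexp (real_complex R (l%:R * - (t / p%:R))).
  by rewrite cexp_real expRM_natl rmorphXn.
rewrite -cexpN chi_expR -!cexpD => e.
have {}e : cexp (- la * real_complex R t + real_complex R (- ((l + m)%:R * t)) +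
   real_complex R (l%:R * - (t / p%:R))) = cexp (- (nu * real_complex R t)).
  apply/eqP; rewrite -subr_eq0; apply: contrapT => /negP h; apply: q0; apply/eqP.
  have := e => /eqP; rewrite -subr_eq0 -scalerBl scaler_eq0 (negbTE h).
  by [].
apply: (mulIf (cexp_neq0 (- la * real_complex R t + real_complex R (- ((l + m)%:R * t)) +
   real_complex R (l%:R * - (t / p%:R))))).
rewrite mul1r [RHS]e -cexpD; congr cexp.
rewrite mulrN !rmorphN !rmorphM /= fmorphV !rmorph_nat.
by ring.
Qed.

Lemma active_surj L l m : covariant L -> active L l m ->
  forall v, exists2 q, hpoly l q & psi L l m q = v.
Proof.
move=> covL [q1 hq1 q10].
(* The image of psi, transposed because [irreducible] describes subspaces by row spaces. *)
pose S (u : 'rV[C]_d) := exists2 q, hpoly l q & psi L l m q = u^T.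
have [U hU] : exists U : 'M[C]_d, forall v, (v <= U)%MS <-> S v.
  apply: linear_closed_rowspace.
    by exists (fun=> 0); [exact: hpoly0|rewrite (psi0 covL) trmx0].
  move=> c u v [q hq eq] [r hr er]; exists (fun y => c * q y + r y); first exact: hpoly_lin.
  by rewrite (psi_lin covL) // eq er linearP.
have [_ /(_ U)] := iv; case.
- move=> g hg; apply/row_subP => i; apply/hU.
  have /hU[q hq eq] := row_sub i U.
  exists (fun x => q (map_mx (real_complex R) (invmx g) *m x)); first exact: hpoly_comp.
  by rewrite (psi_SL m covL hq) ?SL_inv_mem // eq invmxK row_mul trmx_mul trmxK.
- move=> U0; case: q10; have /hU : S (psi L l m q1)^T by exists q1; rewrite ?trmxK.
  by rewrite U0 submx0 => /eqP /(congr1 trmx); rewrite trmxK trmx0.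
- move=> fU v; have /hU[q hq eq] : (v^T <= U)%MS by exact: submx_full.
  by exists q; rewrite // eq trmxK.
Qed.

Definition qtop l : W -> C := fun y => y j0 ord0 ^+ l.

Lemma hpoly_qtop l : hpoly l (qtop l).
Proof. by apply: hpolyX; exact: hpoly_coord1. Qed.

Lemma qtop_neq0 l : qtop l (cx (delta_mx j0 ord0)) != 0.
Proof. by rewrite /qtop !mxE !eqxx rmorph1 expr1n oner_eq0. Qed.

Lemma qtop_torus l s x : qtop l (map_mx (real_complex R) (torus j0 j1 s) *m x) = real_complex R s ^+ l * qtop l x.
Proof.
rewrite /qtop /torus map_diag_mx mul_diag_mx !mxE eqxx exprMn //.
Qed.

(* Schur's lemma, on the highest weight vector. *)
Lemma active_pair L L' l m l' m' : covariant L -> covariant L' ->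
  active L l m -> active L' l' m' ->
  (l' <= l)%N /\ (l = l' -> exists c, psi L' l m' (qtop l) = c *: psi L l m (qtop l)).
Proof.
move=> cL cL' aL aL'.
have [q hq eq] := active_surj cL aL (psi L' l' m' (qtop l')).
have ht s : 0 < s -> torus j0 j1 s \in @SLpred R p by move=> s0; apply: torus_SL => //; exact: lt0r_neq0.
(* By injectivity of psi_(l,m), the weight l' of the vector psi_(l',m')(x_(j0)^l') passes to its
   preimage q. *)
have hw s x : 0 < s -> q (cx (torus j0 j1 s *m x)) = real_complex R s ^+ l' * q (cx x).
  move=> s0; pose T := map_mx (real_complex R) (torus j0 j1 s).
  have hqT : hpoly l (fun x => q (T *m x)) by exact: hpoly_comp.
  have hz : hpoly l (fun x => - real_complex R s ^+ l' * q x + q (T *m x)).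
    by apply: hpoly_lin.
  have z0 : psi L l m (fun x => - real_complex R s ^+ l' * q x + q (T *m x)) = 0.
    rewrite (psi_lin cL) // (psi_SL _ cL) ?ht // eq -(psi_SL _ cL') ?ht //; last exact: hpoly_qtop.
    have -> : (fun x => qtop l' (T *m x)) = fun x => real_complex R s ^+ l' * qtop l' x.
      by apply/funext => y; exact: qtop_torus.
    by rewrite (psiZ cL'); [rewrite scaleNr addNr|exact: hpoly_qtop].
  have := active_inj cL aL hz z0 => /(congr1 (fun f => f (cx x))) /eqP.
  by rewrite mulNr addrC subr_eq0 /T /cx -map_mxM => /eqP.
have [w1 w2] := hpoly_weight hq hw; split.
  rewrite leqNgt; apply/negP => /w1 q0.
  have e0 : psi L' l' m' (qtop l') = 0 by rewrite -eq (hpoly_real_zero hq q0) (psi0 cL).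
  have := active_inj cL' aL' (hpoly_qtop l') e0 => /(congr1 (fun f => f (cx (delta_mx j0 ord0)))) /eqP.
  by rewrite (negbTE (qtop_neq0 l')).
move=> ll; have := w2 ll => hx; exists (q (cx (delta_mx j0 ord0))).
rewrite {1}ll {1}[in qtop _]ll -eq -(psiZ cL); last exact: hpoly_qtop.
by apply: eq_psi_real => x; rewrite hx /qtop cxE.
Qed.

End Irreducible.

Section ComplexPowers.
Variables (R : realType) (V : normedModType R).

Lemma reim_cexp (z : R[i]) b (s : R) : reim b (cexp (z * real_complex R s)) =
  expR (complex.Re z * s) * (if b then sin (complex.Im z * s) else cos (complex.Im z * s)).
Proof.
case: z => c e; rewrite /cexp.
have -> : Complex c e * real_complex R s = Complex (c * s) (e * s).
  by apply/eqP; rewrite eq_complex /=; apply/andP; split; apply/eqP; ring.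
by case: b => /=; ring.
Qed.

Lemma is_derive_cexp (z : R[i]) b (x : R^o) :
  is_derive x (1 : R^o) (fun s : R^o => reim b (cexp (z * real_complex R s)))
    (reim b (z * cexp (z * real_complex R x))).
Proof.
have dl k : is_derive x (1 : R^o) (fun s : R^o => k * s) k.
  have h := @is_deriveZ R R^o R^o id k x 1 1 (is_derive_id _ _).
  by apply: is_derive_eq h _; rewrite /GRing.scale /= mulr1.
have dE c : is_derive x (1 : R^o) (fun s : R^o => expR (c * s)) (expR (c * x) * c).
  exact: (@is_derive1_comp R (@expR R) _ x _ _ (is_derive_expR _) (dl c)).
have dC e : is_derive x (1 : R^o) (fun s : R^o => cos (e * s)) (- sin (e * x) * e).
  exact: (@is_derive1_comp R (@cos R) _ x _ _ (is_derive_cos _) (dl e)).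
have dS e : is_derive x (1 : R^o) (fun s : R^o => sin (e * s)) (cos (e * x) * e).
  exact: (@is_derive1_comp R (@sin R) _ x _ _ (is_derive_sin _) (dl e)).
have eR := reim_cexp z true x; have eI := reim_cexp z false x.
have e : reim b (z * cexp (z * real_complex R x)) = if b then
   complex.Re z * reim true (cexp (z * real_complex R x)) + complex.Im z * reim false (cexp (z * real_complex R x))
   else complex.Re z * reim false (cexp (z * real_complex R x)) - complex.Im z * reim true (cexp (z * real_complex R x)).
  by move: (cexp (z * real_complex R x)) => A; case: A (z) => ? ? [? ?]; case: (b).
rewrite e eR eI; rewrite (_ : (fun s : R^o => _) = fun s : R^o =>
  expR (complex.Re z * s) * (if b then sin (complex.Im z * s) else cos (complex.Im z * s))).
  case: b {e} => /=.
    apply: is_derive_eq (is_deriveM (dE (complex.Re z)) (dS (complex.Im z))) _.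
    by rewrite /GRing.scale /=; ring.
  apply: is_derive_eq (is_deriveM (dE (complex.Re z)) (dC (complex.Im z))) _.
  by rewrite /GRing.scale /=; ring.
by apply/funext => s; exact: reim_cexp.
Qed.

Lemma derive_cpow (z : R[i]) b (U : set V) (F : V -> R) v w : open U -> smooth_on U F ->
  (forall v, U v -> 0 < F v) -> U v ->
  'D_w (fun v => reim b (cexp (z * real_complex R (ln (F v))))) v =
  reim b (z * cexp (z * real_complex R (ln (F v)))) * ((F v)^-1 * 'D_w F v).
Proof.
move=> oU sF F0 Uv.
have dln := is_derive1_ln (F0 v Uv).
have [d1 e1] := diff1_comp1 (diff1_is_derive dln) (smooth_diff1 sF Uv).
have dg := is_derive_cexp z b (ln (F v)).
have [_ ->] := @diff1_comp1 R V (fun s : R^o => reim b (cexp (z * real_complex R s)))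
  (fun v => ln (F v)) v (diff1_is_derive dg) d1.
rewrite e1; have [_ ->] := dg.
by have [_ ->] := dln.
Qed.

Lemma cpowE (z : R[i]) k (r : R) : 0 < r ->
  chi false z r * real_complex R r ^- k = cexp (- (z + k%:R) * real_complex R (ln r)).
Proof.
move=> r0; rewrite /chi mul1r (gtr0_norm r0).
have -> : real_complex R r ^- k = cexp (real_complex R (- (k%:R * ln r))).
  by rewrite cexp_real expRN expRM_natl lnK // fmorphV rmorphXn.
rewrite -cexpD rmorphN rmorphM rmorph_nat; congr cexp; ring.
Qed.

End ComplexPowers.

Section ComplexVanishing.
Variables (R : realType) (q : nat).
Local Notation V := 'cV[R]_q.+1.
Implicit Types (U : set V) (f g : V -> R[i]).

Definition cvan U m f := forall b, van U m (fun v => reim b (f v)).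

Lemma cvanM U m m' f g : open U -> cvan U m f -> cvan U m' g ->
  cvan U (m + m') (fun v => f v * g v).
Proof.
move=> oU vf vg b.
have vM b1 b2 := vanM oU (leqnn _) (vf b1) (vg b2).
case: b.
  apply: (van_eq oU _ (van_lin 1 1 oU (vM false true) (vM true false))) => v _.
  by case: (f v) (g v) => ? ? [? ?] /=; ring.
apply: (van_eq oU _ (van_lin 1 (-1) oU (vM false false) (vM true true))) => v _.
by case: (f v) (g v) => ? ? [? ?] /=; ring.
Qed.

Lemma van_0 U F : smooth_on U F -> van U 0 F.
Proof. by move=> h; split. Qed.

Lemma cvan_cst U c : cvan U 0 (fun=> c).
Proof. by move=> b; apply: van_0; exact: smooth_cst. Qed.

Lemma cvan_sum U m (I : Type) (r : seq I) (F : I -> V -> R[i]) : open U ->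
  (forall i, cvan U m (F i)) -> cvan U m (fun v => \sum_(i <- r) F i v).
Proof.
move=> oU h b; have := van_sum r oU (fun i => h i b); apply: van_eq => // v _.
elim: r => [|i r IH]; first by rewrite !big_nil; case: b.
by rewrite !big_cons -IH; case: (F i v) (\sum_(_ <- _) _) => ? ? [? ?]; case: (b).
Qed.

Lemma cvan_coord U i : open U -> i != ord0 -> cvan U 1 (fun v => real_complex R (v i ord0)).
Proof.
move=> oU i0 b; have s := csmooth_real oU (coord_smooth i oU) b.
apply: van_succ => // [v Uv av|w].
  by rewrite av // rmorph0; case: b {s}.
by apply: van_0; exact: (smooth_derive w s).
Qed.

Lemma cvanX U m f : open U -> cvan U 1 f -> cvan U m (fun v => f v ^+ m).
Proof.
move=> oU h; elim: m => [|m IH]; first exact: cvan_cst.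
rewrite -add1n (_ : (fun v => _) = fun v => f v * f v ^+ m); first exact: cvanM.
by apply/funext => v; rewrite exprS.
Qed.

End ComplexVanishing.

(** * The condition imposed by N'_+ *)

Section UnipotentCondition.
Variables (R : realType) (p d : nat) (a : bool) (la : R[i]).
Variables (tau : 'M[R]_p -> 'M[R[i]]_d) (nu : R[i]).
Local Notation V := 'cV[R]_p.+2.
Local Notation C := R[i].
Local Notation W := 'cV[C]_p.
Variable y : 'rV[R]_p.

Let F1 (v : V) : R := v ord0 ord0 + (y *m cmid v) ord0 ord0.
Let U : set V := [set v : V | 0 < v ord0 ord0] `&` [set v : V | 0 < F1 v].

Lemma smooth_F1 U' : open U' -> smooth_on U' F1.
Proof.
move=> oU; rewrite (_ : F1 = fun v : V => v ord0 ord0 + \sum_j y ord0 j * v (mid j) ord0).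
  apply: (smoothD oU (coord_smooth _ oU)); apply: (smooth_sum _ oU) => j.
  exact: (smoothZ _ oU (coord_smooth _ oU)).
by apply/funext => v; rewrite /F1 mxE; congr (_ + _); apply: eq_bigr => j _; rewrite mxE.
Qed.

Let oU : open U.
Proof.
apply: openI; first exact: open_pos.
rewrite (_ : [set _ | _] = F1 @^-1` [set r : R | 0 < r]) //.
apply: open_comp => [x _|]; last exact: open_gt.
by have [] := smooth_diff1 (smooth_F1 openT) (Logic.I : setT x).
Qed.

Lemma derive_F1 w v : 'D_w F1 v = F1 w.
Proof.
apply: cvg_lim => //; apply: cvg_trans (@cvg_cst _ (F1 w) _ (0 : R)^' _).
apply: near_eq_cvg; near=> h.
have h0 : h != 0 by near: h; exact: nbhs_dnbhs_neq.
rewrite /= /F1; have -> : cmid (h *: w + v) = h *: cmid w + cmid v.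
  by apply/colP => j; rewrite !mxE.
rewrite mulmxDr -scalemxAr !mxE opprD addrACA addrK addrA.
by rewrite addrA addrK -mulrDr [_ *: _]mulrA mulVf // mul1r.
Unshelve. all: by end_near. Qed.

Lemma cvan_Qf l m (q : W -> C) : hpoly l q -> cvan U (l + m) (Qf m q).
Proof.
move=> hq; apply: cvanM => //; last first.
  by apply: (cvanX m oU); apply: cvan_coord => //; exact: ord_max_neq0.
elim: l q hq => [|l IH] q /=; first by move=> [c ->]; exact: cvan_cst.
move=> [qs [hq ->]]; apply: cvan_sum => // i; rewrite -[l.+1]add1n; apply: cvanM => //; last exact: IH.
rewrite (_ : (fun v => _) = fun v : V => real_complex R (v (mid i) ord0)).
  by apply: cvan_coord => //; exact: mid_neq0.
by apply/funext => v; rewrite !mxE.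
Qed.

Let pw (z : C) (r : R) := cexp (- z * real_complex R (ln r)).

(* The first order Taylor remainder of r ^ -z at r = v_0, with increment y x'. *)
Lemma cvan_bracket (z : C) : cvan U 2 (fun v =>
  pw z (F1 v) + - pw z (v ord0 ord0) +
  z * (real_complex R (F1 v - v ord0 ord0) * (pw z (v ord0 ord0) * real_complex R (v ord0 ord0)^-1))).
Proof.
have pwE r : 0 < r -> pw z r = chi false z r.
  by move=> r0; rewrite /pw /chi mul1r gtr0_norm.
have n1 v : U v -> F1 v != 0 by move=> [_ h]; exact: lt0r_neq0.
have n0 v : U v -> v ord0 ord0 != 0 by move=> [h _]; exact: lt0r_neq0.
have s1 : csmooth U (fun v => pw z (F1 v)).
  apply: (csmooth_eq oU _ (csmooth_chi false z oU (smooth_F1 oU) n1)) => v [_ h].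
  exact: pwE.
have s0 : csmooth U (fun v => pw z (v ord0 ord0)).
  apply: (csmooth_eq oU _ (csmooth_chi false z oU (coord_smooth ord0 oU) n0)) => v [h _].
  exact: pwE.
have s2 : csmooth U (fun v => z * (pw z (v ord0 ord0) * real_complex R (v ord0 ord0)^-1)).
  apply: (csmoothM oU (csmooth_cst z)); apply: (csmoothM oU s0).
  exact: (csmooth_real oU (smooth_inv oU (coord_smooth ord0 oU) n0)).
have sY : smooth_on U (fun v => F1 v - v ord0 ord0) := smoothB oU (smooth_F1 oU) (coord_smooth ord0 oU).
move=> b.
pose g1 v := reim b (pw z (F1 v)); pose g0 (v : V) := reim b (pw z (v ord0 ord0)).
pose g2 (v : V) := reim b (z * (pw z (v ord0 ord0) * real_complex R (v ord0 ord0)^-1)).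
pose G v := (g1 v + (-1) * g0 v) + (F1 v - v ord0 ord0) * g2 v.
have sG : smooth_on U G.
  exact: (smoothD oU (smoothD oU (s1 b) (smoothZ (-1) oU (s0 b))) (smoothM oU sY (s2 b))).
have F1a v : on_axis v -> F1 v = v ord0 ord0.
  move=> av; rewrite /F1 mxE big1 ?addr0 // => j _.
  by rewrite mxE av ?mulr0 //; exact: mid_neq0.
apply: (van_eq oU (G := G)) => [v Uv|].
  rewrite /G /g1 /g0 /g2; move: (pw z (F1 v)) (pw z _) (F1 v - _) => A B Y.
  by case: A B (z) => ? ? [? ?] [? ?]; case: (b) => /=; ring.
apply: van_succ => // [v Uv av|w].
  by rewrite /G /g1 /g0 F1a // subrr mul0r addr0 mulN1r subrr.
apply: van_succ; first exact: smooth_derive.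
  move=> v Uv av.
  have d1 := smooth_diff1 (s1 b) Uv; have d0 := smooth_diff1 (s0 b) Uv.
  have d2 := smooth_diff1 (s2 b) Uv; have dY := smooth_diff1 sY Uv.
  rewrite (derive_fD _ (diff1D d1 (diff1M (diff1_cst (-1) v) d0)) (diff1M dY d2)).
  rewrite (derive_fD _ d1 (diff1M (diff1_cst (-1) v) d0)).
  rewrite (derive_fM _ (diff1_cst (-1) v) d0) (derive_fM _ dY d2) derive_cst.
  rewrite [in X in _ + X](_ : F1 v - v ord0 ord0 = 0); last by rewrite F1a // subrr.
  have -> : 'D_w (fun v => F1 v - v ord0 ord0) v = F1 w - w ord0 ord0.
    rewrite (_ : (fun v => _) = fun v : V => F1 v + (-1) * v ord0 ord0).
      have dF := smooth_diff1 (smooth_F1 oU) Uv; have dc := smooth_diff1 (coord_smooth ord0 oU) Uv.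
      rewrite (derive_fD _ dF (diff1M (diff1_cst (-1) v) dc)) (derive_fM _ (diff1_cst (-1) v) dc).
      by rewrite derive_cst derive_F1 derive_coord mul0r addr0 mulN1r.
    by apply/funext => u; rewrite mulN1r.
  (* On the axis both powers have the base r = v_0, so their derivatives along w differ by -z
     r^(-z-1) (F1 w - w_0), which the third term cancels. *)
  rewrite (derive_cpow (- z) b w oU (smooth_F1 oU) (fun v h => h.2) Uv).
  rewrite (derive_cpow (- z) b w oU (coord_smooth ord0 oU) (fun v h => h.1) Uv).
  rewrite derive_F1 derive_coord F1a // /g2 /pw /cst.
  move: (cexp _) (v ord0 ord0)^-1 (F1 w) (w ord0 ord0) => A r r1 r2.
  by case: A (z) => ? ? [? ?]; case: (b) => /=; ring.
by move=> w'; apply: van_0; do 2!apply: smooth_derive.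
Qed.

Hypothesis p0 : (0 < p)%N.

Lemma par_act_unipotent phi (v : V) :
  par_act 1%:M 0 y phi v = phi (vec (F1 v) (cmid v) (v ord_max ord0)).
Proof.
by rewrite /par_act det1 invr1 mul1r expR0 mul1r mul0r oppr0 expR0 scale1r mul1mx.
Qed.

(* The test section of q(x') z^m, translated by an element of N'_+, minus its first
   order expansion. *)
Definition unip_rem l m (q : W -> C) (v : V) :=
  -1 * tst a la (l + m) (Qf m q) v + ((la + (l + m)%:R) *
    tst a la (l.+1 + m) (Qf m (fun x => form y x * q x)) v +
    par_act 1%:M 0 y (tst a la (l + m) (Qf m q)) v).

Lemma hpoly_formM l (q : W -> C) : hpoly l q -> hpoly l.+1 (fun x => form y x * q x).
Proof. by move=> h; rewrite -add1n; apply: hpolyM => //; exact: hpoly_form1. Qed.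

Lemma isec_unip_rem l m (q : W -> C) : hpoly l q -> isec a la (unip_rem l m q).
Proof.
move=> hq; apply: isec_lin; first exact: isec_psi.
apply: isec_lin; first by apply: isec_psi; exact: hpoly_formM.
apply: isec_par_act => //; last exact: isec_psi.
by rewrite inE det1 normr1.
Qed.

Lemma unip_rem_near l m (q : W -> C) : hpoly l q -> \forall v \near e0 R p,
  unip_rem l m q v = (pw (la + (l + m)%:R) (F1 v) + - pw (la + (l + m)%:R) (v ord0 ord0) +
  (la + (l + m)%:R) * (real_complex R (F1 v - v ord0 ord0) *
     (pw (la + (l + m)%:R) (v ord0 ord0) * real_complex R (v ord0 ord0)^-1))) * Qf m q v.
Proof.
move=> hq.
have e1 : e0 R p ord0 ord0 = 1 by rewrite !mxE eqxx.
have e2 : cmid (e0 R p) = 0 by apply/colP => j; rewrite !mxE.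
have Ue : U (e0 R p) by rewrite /U /= /F1 e1 e2 mulmx0 (mxE _ _ ord0 ord0) addr0 ltr01.
pose Af (v : V) : V := diag1_mx (par_M 1%:M *m par_A p 0 *m par_N y) *m v.
have AE (v : V) : Af v = vec (F1 v) (cmid v) (v ord_max ord0).
  rewrite /Af {1}(vecE v) par_vec det1 invr1 mul1r expR0 mul1r mul0r oppr0 expR0 scale1r mul1mx.
  by [].
have Ae0 : Af (e0 R p) = e0 R p.
  by rewrite AE [RHS]vecE e2 /F1 e1 e2 mulmx0 (mxE _ _ ord0 ord0) addr0.
have cA : Af @ (e0 R p) --> (e0 R p : V).
  rewrite -{2}Ae0; apply: linear_mx_continuous => k u v.
  by rewrite /Af mulmxDr scalemxAr.
have n2 (Q : V -> C) n : nbhs (e0 R p) [set v | tst a la n Q v =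
    chi a la (v ord0 ord0) * real_complex R (v ord0 ord0) ^- n * Q v].
  by have := tst_near a la n Q (oner_neq0 R); rewrite scale1r.
have n1 : nbhs (e0 R p) [set v | tst a la (l + m) (Qf m q) (Af v) = chi a la ((Af v) ord0 ord0) *
   real_complex R ((Af v) ord0 ord0) ^- (l + m) * Qf m q (Af v)] := cA _ (n2 (Qf m q) (l + m)%N).
have n4 := n2 (Qf m q) (l + m)%N.
have n5 := n2 (Qf m (fun x => form y x * q x)) (l.+1 + m)%N.
have n3 : nbhs (e0 R p) U by exact: open_nbhs_nbhs.
have chiE r : 0 < r -> chi a la r = chi false la r by move=> r0; rewrite /chi gtr0_sg // rmorph1 expr1n mul1r.
apply: filterS (filterI (filterI n1 n4) (filterI n5 n3)) => v [[E1 E4] [E5 [v0 f0]]].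
rewrite /unip_rem par_act_unipotent -AE {}E1 {}E4 {}E5.
have pwE k r : 0 < r -> chi false la r * real_complex R r ^- k = pw (la + k%:R) r by exact: cpowE.
have pwS k r : 0 < r -> chi false la r * real_complex R r ^- k.+1 = real_complex R r^-1 * pw (la + k%:R) r.
  by move=> r0; rewrite exprS invfM mulrCA pwE // fmorphV.
rewrite AE vec_0 !chiE // addSn pwS // !pwE // /Qf cmid_vec vec_max fmorphV.
have -> : form y (cx (cmid v)) = real_complex R (F1 v - v ord0 ord0).
  by rewrite /form /cx -map_mxM /F1 addrC addKr mxE.
have gen (A B D E F G H : C) : -1 * (B * (E * F)) + (H * (G * B * (D * E * F)) + A * (E * F)) =
  (A - B + H * (D * (B * G))) * (E * F) by ring.
exact: gen.
Qed.

(** Near e_0 the remainder is the bracket of [cvan_bracket], of order 2, times q(x') z^m, of order l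
    + m. The jets at e_0 suffice by [van_of_jets]. *)
Lemma van_unip_rem l m (q : W -> C) : hpoly l q ->
  forall b, van (@punct R p.+1) (l + m).+2 (fun v => reim b (unip_rem l m q v)).
Proof.
move=> hq; apply: (van_of_jets (isec_unip_rem m hq)) => w sw b.
have e1 : e0 R p ord0 ord0 = 1 by rewrite !mxE eqxx.
have e2 : cmid (e0 R p) = 0 by apply/colP => j; rewrite !mxE.
have Ue : U (e0 R p) by rewrite /U /= /F1 e1 e2 mulmx0 (mxE _ _ ord0 ord0) addr0 ltr01.
have n1 : \forall v \near e0 R p, reim b (unip_rem l m q v) = reim b (
  (pw (la + (l + m)%:R) (F1 v) + - pw (la + (l + m)%:R) (v ord0 ord0) +
  (la + (l + m)%:R) * (real_complex R (F1 v - v ord0 ord0) *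
     (pw (la + (l + m)%:R) (v ord0 ord0) * real_complex R (v ord0 ord0)^-1))) * Qf m q v).
  by have := unip_rem_near m hq; apply: filterS => v ->.
rewrite (nbhs_singleton (iterD_near _ n1)).
have [_ h] := cvanM oU (cvan_bracket (la + (l + m)%:R)) (cvan_Qf m hq) b.
by apply: h => //; [rewrite size_map|exact: e0_axis].
Qed.

End UnipotentCondition.

(** * Uniqueness and the conditions on the parameters *)

Section Classification.
Variables (R : realType) (p d : nat) (a : bool) (la : R[i]).
Variables (tau varpi : 'M[R]_p -> 'M[R[i]]_d) (nu : R[i]).
Local Notation V := 'cV[R]_p.+2.
Local Notation C := R[i].
Local Notation W := 'cV[C]_p.
Hypothesis rv : is_rep (@SLpred R p) varpi.
Hypothesis iv : irreducible (@SLpred R p) varpi.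
Hypothesis tauE : {in @SLpred R p, tau =1 varpi}.
Variables (j0 j1 : 'I_p).
Hypothesis j01 : j0 != j1.
Implicit Types q r : W -> C.
Local Notation covariant := (covariant a la tau nu).
Local Notation psi := (psi a la).
Local Notation active := (active a la).
Local Notation qtop := (qtop j0).

Let p0 : (0 < p)%N := leq_ltn_trans (leq0n j0) (ltn_ord j0).

Lemma active_unique L L' l m l' m' : covariant L -> covariant L' ->
  active L l m -> active L' l' m' -> l = l' /\ m = m'.
Proof.
move=> cL cL' aL aL'.
have [h1 _] := active_pair rv iv tauE j01 cL cL' aL aL'.
have [h2 _] := active_pair rv iv tauE j01 cL' cL aL' aL.
have el : l = l' by apply/eqP; rewrite eqn_leq h1 h2.
split=> //; have := active_nu rv tauE j0 cL aL; rewrite (active_nu rv tauE j0 cL' aL') -el.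
move=> /addIr /addrI /eqP; rewrite eqr_nat => /eqP /addnI /esym.
by [].
Qed.

Lemma active_exists L phi : covariant L -> isec a la phi -> L phi <> 0 ->
  exists l m, active L l m.
Proof.
move=> cL ip Lp; apply: contrapT => h; apply: Lp.
apply: (cov_eq0 cL) => // l m q hq; apply: contrapT => q0.
by apply: h; exists l, m, q.
Qed.

Lemma active_qtop L l m : covariant L -> active L l m -> psi L l m (qtop l) <> 0.
Proof.
move=> cL aL e0; have := active_inj j0 cL aL (hpoly_qtop R j0 l) e0.
by move=> /(congr1 (fun f => f (cx (delta_mx j0 ord0)))) /eqP; rewrite (negbTE (qtop_neq0 R j0 l)).
Qed.

(** The scalar c is chosen so that L' - c L kills [qtop l]. Were this difference nonzero, it would
    be active at the same pair (l, m), by [active_unique], and hence nonzero on [qtop l], by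
    injectivity. *)
Lemma cov_unique L L' phi0 : covariant L -> covariant L' -> isec a la phi0 -> L phi0 <> 0 ->
  exists c, forall phi, isec a la phi -> L' phi = c *: L phi.
Proof.
move=> cL cL' i0 L0.
have [l [m aL]] := active_exists cL i0 L0.
have [h|h] := pselect (forall phi, isec a la phi -> L' phi = 0).
  by exists 0 => phi ip; rewrite h // scale0r.
have [phi1 i1 L1] : exists2 phi, isec a la phi & L' phi <> 0.
  apply: contrapT => h1; apply: h => phi ip; apply: contrapT => h2.
  by apply: h1; exists phi.
have [l' [m' aL']] := active_exists cL' i1 L1.
have [el em] := active_unique cL cL' aL aL'; rewrite -{l'}el -{m'}em in aL' *.
have [_ /(_ erefl)[c ec]] := active_pair rv iv tauE j01 cL cL' aL aL'.
exists c => phi ip.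
have cD := covariant_lin (- c) cL cL'.
have Z0 : (fun phi => - c *: L phi + L' phi) phi = 0.
  apply: contrapT => hz.
  have [l2 [m2 aD]] := active_exists cD ip hz.
  have [el em] := active_unique cL cD aL aD; rewrite -el -em in aD.
  have := active_qtop cD aD; apply.
  by rewrite /psi -/(psi L' l m (qtop l)) -/(psi L l m (qtop l)) ec scaleNr addNr.
by move: Z0 => /= /eqP; rewrite addrC scaleNr subr_eq0 => /eqP.
Qed.

(** As (l, m) is the only active pair, psi_(l-1,m) is 0 and covariance also annihilates the
    translated test section. Of its expansion there remains (la + l + m - 1) psi_(l,m)(x_(j0)^l) =
    0. *)
Lemma active_shift L l m : covariant L -> active L l m -> (0 < l)%N -> la + (l + m)%:R = 1.
Proof.
case: l => [//|l] cL aL _.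
pose y : 'rV[R]_p := delta_mx ord0 j0; pose q : W -> C := qtop l.
have hq : hpoly l q := hpoly_qtop R j0 l.
have eq1 : (fun x => form y x * q x) = qtop l.+1.
  apply/funext => x; rewrite /q /qtop exprS; congr (_ * _).
  by rewrite /form map_delta_mx -rowE mxE.
have q0 : psi L l m q = 0.
  apply: contrapT => h.
  have aL' : active L l m by exists q.
  by have [] := active_unique cL cL aL aL' => /eqP; rewrite -[X in _ == X]addn0 -addn1 eqn_add2l.
have i1 := isec_unip_rem a la y p0 m hq.
have hv := van_unip_rem a la y p0 m hq.
have Lr : L (unip_rem a la y l m q) = 0.
  have [M hM] := cov_taylor cL; rewrite hM // big1 // => n _.
  suff -> : L (tst a la n (upoly n (jet (unip_rem a la y l m q)))) = 0 by rewrite scaler0.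
  (* Below degree l + m + 2 the jet of the remainder vanishes. From there on no pair is active,
     since the active one has degree l + m + 1. *)
  have [nl|nl] := ltnP n (l + m).+2.
    rewrite -(cov0 cL); congr L; apply/funext => v; rewrite /tst /upoly.
    rewrite (tens_ext (b := fun=> 0)) ?tens0 ?mulr0 // => w sw.
    rewrite /jet; apply/eqP; rewrite eq_complex /=; apply/andP; split; apply/eqP.
      by apply: (hv false).2; rewrite ?size_map ?sw //; [exact: e0_punct|exact: e0_axis].
    by apply: (hv true).2; rewrite ?size_map ?sw //; [exact: e0_punct|exact: e0_axis].
  apply: (cov_upoly0 cL) => l2 m2 q2 e2 hq2; apply: contrapT => h2.
  have aL2 : active L l2 m2 by exists q2.
  have [el em] := active_unique cL cL aL aL2.
  by move: nl; rewrite -e2 -el -em addSn ltnn.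
have iA : isec a la (tst a la (l + m) (Qf m q)) by exact: isec_psi.
have iB : isec a la (tst a la (l.+1 + m) (Qf m (fun x => form y x * q x))).
  by apply: isec_psi; exact: hpoly_formM.
have S1 : 1%:M \in @SLpmpred R p by rewrite inE det1 normr1.
have iP := isec_par_act 0 y S1 p0 iA.
move: Lr; rewrite /unip_rem (cov_lin cL) //; last exact: isec_lin.
rewrite (cov_lin cL) // (cov_par cL) //.
rewrite -/(psi L l m q) -/(psi L l.+1 m (fun x => form y x * q x)) q0 mulmx0 scaler0 add0r addr0 eq1.
move=> /eqP; rewrite scaler_eq0 => /orP[|/eqP /(active_qtop cL aL)//].
by rewrite addSn -natr1 addrA => /eqP ->; rewrite add0r.
Qed.

(** The isomorphism is the inverse of psi_(l,m), bijective by [active_inj] and [active_surj]. *)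
Lemma active_poly L l m : covariant L -> active L l m -> is_poly l (@SLpred R p) varpi.
Proof.
move=> cL aL.
have psi_eq q r : hpoly l q -> hpoly l r -> psi L l m q = psi L l m r -> q = r.
  move=> hq hr e; have hz := hpoly_lin (-1) hr hq.
  have z0 : psi L l m (fun y => -1 * r y + q y) = 0.
    by rewrite (psi_lin cL) // e scaleN1r addNr.
  apply/funext => y; have := active_inj j0 cL aL hz z0 => /(congr1 (fun f => f y)) /eqP.
  by rewrite mulN1r addrC subr_eq0 => /eqP.
have sj := active_surj rv iv tauE j0 cL aL.
pose T v : W -> R[i]^o := s2val (cid2 (sj v)).
have hT v : hpoly l (T v) by exact: s2valP (cid2 (sj v)).
have eT v : psi L l m (T v) = v by exact: s2valP' (cid2 (sj v)).
have lT : linear T.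
  move=> c u v; apply: psi_eq => //; first exact: (hpoly_lin c (hT u) (hT v)).
  by rewrite eT (psi_lin cL m c (hT u) (hT v)) !eT.
pose Tl : {linear 'cV[C]_d -> (W -> R[i]^o)} :=
  HB.pack T (GRing.isLinear.Build _ _ _ _ T lT).
exists Tl; split.
- by move=> u v e; rewrite -(eT u) -(eT v); congr psi.
- apply/seteqP; split=> [q [v _ <-]|q]; first by apply/homog_polyE; exact: hT.
  by move=> /homog_polyE hq; exists (psi L l m q) => //; apply: psi_eq.
- move=> g hg v; apply: psi_eq; first exact: hT.
    exact: (hpoly_comp _ (hT v)).
  rewrite [LHS]eT -{1}(eT v) /poly_act -map_invmx.
  by rewrite (psi_SL rv tauE j0 m cL (hT v)) ?SL_inv_mem // invmxK.
Qed.

End Classification.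

(** * The sign beta *)

Section Parity.
Variables (R : realType) (p d : nat) (a b : bool) (la nu : R[i]).
Variables (varpi vpm : 'M[R]_p -> 'M[R[i]]_d).
Local Notation V := 'cV[R]_p.+2.
Local Notation C := R[i].
Local Notation W := 'cV[C]_p.
Hypothesis rv : is_rep (@SLpred R p) varpi.
Hypothesis iv : irreducible (@SLpred R p) varpi.
Hypothesis ext : extends_to_SLpm varpi vpm.
Variables (j0 j1 : 'I_p).
Hypothesis j01 : j0 != j1.
Local Notation tau := (sgn_tensor b vpm).
Local Notation psi := (psi a la).

Let p0 : (0 < p)%N := leq_ltn_trans (leq0n j0) (ltn_ord j0).

Lemma sgn_tensor_SL : {in @SLpred R p, tau =1 varpi}.
Proof.
move=> g hg; have [_ e _ _] := ext; rewrite /sgn_tensor -e //.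
by move: hg; rewrite inE => /eqP ->; rewrite sgr1 rmorph1 expr1n scale1r.
Qed.

Definition reflection : 'M[R]_p := diag_mx (\row_j (if j == j1 then -1 else 1)).

Lemma det_reflection : \det reflection = -1.
Proof.
rewrite det_diag (bigD1 j1) //= mxE eqxx big1 ?mulr1 // => j /negbTE h.
by rewrite mxE h.
Qed.

Lemma reflection_top l (x : W) : qtop j0 l (map_mx (real_complex R) reflection *m x) = qtop j0 l x.
Proof.
by rewrite /qtop /reflection map_diag_mx mul_diag_mx !mxE (negbTE j01) rmorph1 mul1r.
Qed.

Lemma reflectionK : reflection *m reflection = 1%:M.
Proof.
rewrite /reflection mulmx_diag; apply/matrixP => i j; rewrite !mxE.
by case: (i == j1) => //=; case: (i == j) => //=; rewrite ?mulrN1 ?opprK ?mul1r // !mulr1n.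
Qed.

Lemma reflection_SLpm : reflection \in @SLpmpred R p.
Proof. by rewrite inE det_reflection normrN1. Qed.

(** [T'] is the isomorphism over SL^{+-} that [extends_to_SLpm] provides; it need not be the inverse
    of psi. By its torus weight, T'(psi(x_(j0)^l)) is on real points a nonzero multiple of x_(j0)^l.
    The reflection in x_(j1) fixes x_(j0)^l, and comparing its action through psi and through T'
    forces the sign to be 1. *)
Lemma active_parity L l m : covariant a la tau nu L -> active a la L l m -> b = a (+) odd (m + l).
Proof.
move=> cL aL.
have [[v1 vM _] vE _ /(_ l) pE] := ext.
have tauE := sgn_tensor_SL.
have [T' [injT rT T'E]] := pE (active_poly rv iv tauE j0 cL aL).
pose q0 : W -> C := qtop j0 l; have hq0 : hpoly l q0 := hpoly_qtop R j0 l.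
pose q : W -> C := T' (psi L l m q0).
have hq : hpoly l q by apply/homog_polyE; rewrite -rT; exists (psi L l m q0).
have hw s x : 0 < s -> q (cx (torus j0 j1 s *m x)) = real_complex R s ^+ l * q (cx x).
  move=> s0; pose h := torus j0 j1 s.
  have hh : h \in @SLpred R p by apply: torus_SL => //; exact: lt0r_neq0.
  have hi := SL_inv_mem hh.
  have := T'E (invmx h) (SLpm_of_SL hi) (psi L l m q0).
  rewrite vE // -(psi_SL rv tauE j0 m cL hq0) //.
  have -> : (fun x => q0 (map_mx (real_complex R) h *m x)) = fun x => real_complex R s ^+ l * q0 x.
    by apply/funext => y; exact: qtop_torus.
  rewrite (psiZ cL) // linearZ => /(congr1 (fun f => f (cx x))).
  rewrite /poly_act -map_invmx invmxK => e.
  by rewrite /q /cx map_mxM -e.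
have [_ /(_ erefl) qE] := hpoly_weight hq hw.
have qe : q (cx (delta_mx j0 ord0)) != 0.
  apply/eqP => h; have : psi L l m q0 <> 0 := active_qtop cL aL; apply.
  apply: injT; rewrite linear0; apply: (hpoly_real_zero hq) => x.
  by rewrite qE h mul0r.
have := psi_par cL m 0 hq0 reflection_SLpm p0; cbv zeta.
have -> : (fun y => q0 (map_mx (real_complex R) reflection *m y)) = q0.
  by apply/funext => y; exact: reflection_top.
rewrite det_reflection mul0r oppr0 expR0 mulr1 rmorph1 expr1n mulr1 rmorph0 mulr0 cexp0 scale1r.
rewrite /sgn_tensor det_reflection invrN1 ltr0_sg ?oppr_lt0 ?ltr01 //.
have vv : vpm reflection *m vpm reflection = 1%:M.
  by rewrite -vM ?reflection_SLpm // reflectionK.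
have chi1 : chi a la (-1) = (-1) ^+ a.
  by rewrite /chi ltr0_sg ?oppr_lt0 ?ltr01 // normrN1 ln1 rmorph0 mulr0 cexp0 mulr1 rmorphN1.
rewrite chi1 !rmorphN1 -exprVn invrN1 -exprD => e.
have ub : (-1) ^+ b *: vpm reflection \in unitmx.
  rewrite unitmxZ; first by have [] := mulmx1_unit vv.
  by rewrite unitrX // unitrN unitr1.
have e2 : psi L l m q0 = (-1) ^+ (a + (l + m) + b) *: (vpm reflection *m psi L l m q0).
  have := congr1 (mulmx ((-1) ^+ b *: vpm reflection)) e.
  rewrite mulmxA mulmxV // mul1mx => {1}<-.
  by rewrite -scalemxAr -scalemxAl !scalerA -exprD.
have := congr1 (fun f => f (cx (delta_mx j0 ord0))) (T'E _ reflection_SLpm (psi L l m q0)).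
have ri : invmx reflection = reflection.
  have [u _] := mulmx1_unit reflectionK.
  by rewrite -[LHS]mulmx1 -reflectionK mulKmx.
rewrite /poly_act -map_invmx ri /cx -map_mxM.
have -> : reflection *m delta_mx j0 ord0 = delta_mx j0 ord0 :> 'cV[R]_p.
  apply/colP => j; rewrite mul_diag_mx !mxE; case: eqP => [->|_]; last by rewrite mul1r.
  by rewrite eq_sym (negbTE j01) mulr0.
rewrite -/(cx _) => e3.
have : q (cx (delta_mx j0 ord0)) = (-1) ^+ (a + (l + m) + b) * q (cx (delta_mx j0 ord0)).
  by rewrite {1}/q e2 linearZ /= -[X in _ = _ * X]e3.
rewrite -signr_odd; case: (boolP (odd _)) => [_|ev _].
  rewrite expr1 mulN1r => /eqP; rewrite -subr_eq0 opprK -mulr2n mulrn_eq0 /=.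
  by rewrite (negbTE qe).
by move: ev; rewrite !oddD; case: (a) (b) (odd l) (odd m) => [] [] [] [].
Qed.

End Parity.

(** * Construction of the operators *)

Section ComplexJets.
Variables (R : realType) (V : normedModType R).
Local Notation C := R[i].
Implicit Types (phi psi : V -> C) (w : seq V) (U : set V).

Definition iterDC w phi (v : V) : C :=
  Complex (iterD w (fun v => reim false (phi v)) v) (iterD w (fun v => reim true (phi v)) v).

Lemma reim_iterDC b w phi v : reim b (iterDC w phi v) = iterD w (fun v => reim b (phi v)) v.
Proof. by case: b. Qed.

Lemma reim_inj (z z' : C) : (forall b, reim b z = reim b z') -> z = z'.
Proof. by case: z z' => x y [x' y'] h; have := h false; have := h true => /= -> ->. Qed.

Lemma reimD b (z z' : C) : reim b (z + z') = reim b z + reim b z'.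
Proof. by case: z z' => ? ? [? ?]; case: b. Qed.

Lemma reim_realM b c (z : C) : reim b (real_complex R c * z) = c * reim b z.
Proof. by case: z => ? ?; case: b => /=; ring. Qed.

Lemma reim_sum b (I : Type) (r : seq I) (F : I -> C) :
  reim b (\sum_(i <- r) F i) = \sum_(i <- r) reim b (F i).
Proof.
elim: r => [|i r IHr]; first by rewrite !big_nil; case: b.
by rewrite !big_cons reimD IHr.
Qed.

Lemma iterDC_perm U w w' phi v : open U -> csmooth U phi -> U v -> perm_eq w w' ->
  iterDC w phi v = iterDC w' phi v.
Proof. by move=> oU sp Uv h; rewrite /iterDC !(iterD_perm oU (sp _) Uv h). Qed.

Lemma iterDC_eq U w phi psi v : open U -> (forall v, U v -> phi v = psi v) -> U v ->
  iterDC w phi v = iterDC w psi v.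
Proof.
move=> oU h Uv; apply: reim_inj => b; rewrite !reim_iterDC.
by apply: (iterD_eq w oU _ Uv) => u Uu; rewrite h.
Qed.

Lemma iterDC_lin U w c phi psi v : open U -> csmooth U phi -> csmooth U psi -> U v ->
  iterDC w (fun v => c * phi v + psi v) v = c * iterDC w phi v + iterDC w psi v.
Proof.
move=> oU sp sq Uv; apply: reim_inj => b; rewrite reimD reim_mul !reim_iterDC.
have sM : smooth_on U (fun v => \sum_b' mul_coef b b' c * reim b' (phi v)).
  by apply: (smooth_sum _ oU) => b'; exact: (smoothZ _ oU (sp b')).
have e u : reim b (c * phi u + psi u) =
    1 * (\sum_b' mul_coef b b' c * reim b' (phi u)) + 1 * reim b (psi u).
  by rewrite reimD reim_mul !mul1r.
rewrite (iterD_eq w oU (fun u _ => e u) Uv) (iterD_lin 1 1 oU sM (sq b) _ Uv) !mul1r.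
congr (_ + _); rewrite (iterD_lin_sum _ _ _ oU sp Uv).
by apply: eq_bigr => b' _; rewrite reim_iterDC.
Qed.

Lemma iterDC_sumv U phi v w1 w2 (I : Type) (r : seq I) (c : I -> R) (e : I -> V) :
  open U -> csmooth U phi -> U v ->
  iterDC (w1 ++ (\sum_(i <- r) c i *: e i) :: w2) phi v =
  \sum_(i <- r) real_complex R (c i) * iterDC (w1 ++ e i :: w2) phi v.
Proof.
move=> oU sp Uv; apply: reim_inj => b.
rewrite reim_iterDC (iterD_sumv _ _ _ _ _ oU (sp b) Uv) reim_sum.
by apply: eq_bigr => i _; rewrite reim_realM reim_iterDC.
Qed.

Lemma iterDC_scalev U phi v w1 w2 (c : R) e : open U -> csmooth U phi -> U v ->
  iterDC (w1 ++ (c *: e) :: w2) phi v = real_complex R c * iterDC (w1 ++ e :: w2) phi v.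
Proof.
move=> oU sp Uv; apply: reim_inj => b.
by rewrite reim_realM !reim_iterDC (iterD_scalev _ _ _ _ oU (sp b) Uv).
Qed.

Lemma iterDC_addv U phi v w1 w2 e e' : open U -> csmooth U phi -> U v ->
  iterDC (w1 ++ (e + e') :: w2) phi v = iterDC (w1 ++ e :: w2) phi v + iterDC (w1 ++ e' :: w2) phi v.
Proof.
move=> oU sp Uv; pose f (b : bool) := if b then e' else e.
have := @iterDC_sumv U phi v w1 w2 bool [:: false; true] (fun=> 1) f oU sp Uv.
by rewrite !big_cons !big_nil !addr0 !scale1r !rmorph1 !mul1r.
Qed.

Lemma iterDC_nseq_scale U phi v n w (c : R) e : open U -> csmooth U phi -> U v ->
  iterDC (nseq n (c *: e) ++ w) phi v = real_complex R c ^+ n * iterDC (nseq n e ++ w) phi v.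
Proof.
move=> oU sp Uv; elim: n w => [|n IH] w; first by rewrite mul1r.
rewrite /= -cat1s -(cat0s ([:: _] ++ _)) (iterDC_scalev _ _ _ _ oU sp Uv) cat0s.
rewrite (iterDC_perm (w' := nseq n (c *: e) ++ e :: w) oU sp Uv).
  rewrite IH exprS -mulrA; congr (_ * (_ * _)).
  by apply: (iterDC_perm oU sp Uv); rewrite perm_catC /= perm_cons perm_catC.
by rewrite perm_sym perm_catC /= perm_cons perm_catC.
Qed.

(** By multilinearity and symmetry in the directions, the sum over all words collapses to repeated
    derivatives in one direction. *)
Lemma tens_iterDC U phi v l (I : finType) (bm : I -> V) (x : I -> R) u :
  open U -> csmooth U phi -> U v ->
  tens l (fun w : seq I => iterDC (map bm w ++ u) phi v) (fun i => real_complex R (x i)) =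
  iterDC (nseq l (\sum_i x i *: bm i) ++ u) phi v.
Proof.
move=> oU sp Uv; elim: l u => [//|l IH] u /=.
have pe e : perm_eq (e :: nseq l (\sum_i x i *: bm i) ++ u) (nseq l (\sum_i x i *: bm i) ++ e :: u).
  by rewrite perm_sym perm_catC /= perm_cons perm_catC.
rewrite (iterDC_perm oU sp Uv (pe _)) (iterDC_sumv _ _ _ _ _ oU sp Uv).
apply: eq_bigr => i _; congr (_ * _); rewrite -IH; apply: tens_ext => w _.
by apply: (iterDC_perm oU sp Uv); rewrite perm_sym perm_catC /= perm_cons perm_catC.
Qed.

End ComplexJets.

Section AffineJets.
Variables (R : realType) (V' V : normedModType R) (A : V' -> V).
Hypothesis hA : forall (h : R) v x, A (h *: v + x) = h *: A v + A x.

Lemma iterDC_linear w (phi : V -> R[i]) v : iterDC w (fun x => phi (A x)) v = iterDC (map A w) phi (A v).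
Proof.
have e b := iterD_affine hA w (fun v => reim b (phi v)).
by rewrite /iterDC (e false) (e true).
Qed.

End AffineJets.

(** * Derivatives of homogeneous functions and Bol's lemma *)

Section HomogeneousJets.
Variables (R : realType) (p : nat) (a : bool) (la : R[i]).
Local Notation V := 'cV[R]_p.+2.
Local Notation C := R[i].
Local Notation U0 := (@punct R p.+1).
Implicit Types (phi : V -> C).

Lemma iterDC_homog phi w (c : R) v : isec a la phi -> c != 0 -> U0 v ->
  iterDC w phi (c *: v) = chi a la c * real_complex R c ^- size w * iterDC w phi v.
Proof.
move=> ip c0 Uv.
have cn : real_complex R c ^+ size w != 0 by rewrite expf_neq0 // fmorph_eq0.
apply: (mulfI cn); rewrite [RHS]mulrA mulrCA divff // mulr1; apply: reim_inj => b.
rewrite -rmorphXn reim_realM reim_mul reim_iterDC (iterD_homog w b ip c0 Uv).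
by apply: eq_bigr => b' _; rewrite reim_iterDC.
Qed.

(* Derivatives of order k - 1 of a homogeneous function of degree k - 1 are
   constant along rays. *)
Lemma iterDC_ray phi w (c : R) : isec a la phi -> c != 0 -> la + (size w)%:R = 0 ->
  iterDC (e0 R p :: w) phi (c *: e0 R p) = 0.
Proof.
move=> ip c0 hw; apply: reim_inj => b; rewrite reim_iterDC /= (_ : reim b 0 = 0); last by case: b.
apply: derive_invariant.
have pc : 0 < `|c| by rewrite normr_gt0.
have : nbhs (0 : R) [set h | - `|c| < h < `|c|].
  apply: filterS (nbhsx_ballx (0 : R) _ pc) => h.
  by rewrite /ball /= sub0r normrN ltr_norml.
apply: filterS => h hh.
have s0 : 0 < h / c + 1.
  have : `|h / c| < 1 by rewrite normrM normfV ltr_pdivrMr ?normr_gt0 // mul1r ltr_norml.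
  by rewrite ltr_norml => /andP[h1 _]; rewrite -ltrBlDr sub0r.
rewrite -!reim_iterDC; congr reim.
have -> : h *: e0 R p + c *: e0 R p = (h / c + 1) *: (c *: e0 R p).
  by rewrite scalerA mulrDl divfK // mul1r scalerDl.
have Uc : U0 (c *: e0 R p) by rewrite /punct /= scaler_eq0 negb_or c0; exact: e0_punct.
rewrite (iterDC_homog _ ip _ Uc) ?gt_eqF //.
rewrite (_ : chi a la _ = chi false la (h / c + 1)); last by rewrite /chi gtr0_sg // rmorph1 expr1n.
by rewrite cpowE // hw oppr0 mul0r cexp0 mul1r.
Qed.

(* The derivatives of order l of a homogeneous function of degree l - 1 are
   invariant under translation of the direction along the base point. *)
Lemma bol_invariance phi l u (r k c : R) e : isec a la phi -> c != 0 ->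
  (l = 0%N \/ la + (l + size u)%:R = 1) ->
  iterDC (nseq l (r *: e + k *: e0 R p) ++ u) phi (c *: e0 R p) =
  real_complex R r ^+ l * iterDC (nseq l e ++ u) phi (c *: e0 R p).
Proof.
move=> ip c0 h; have oU := @open_punct R p.+1.
have Uc : U0 (c *: e0 R p) by rewrite /punct /= scaler_eq0 negb_or c0; exact: e0_punct.
rewrite -(iterDC_nseq_scale l u r e oU ip.1 Uc).
case: l h => [//|l [//|h]].
(* One direction at a time loses its e_0 part. The other derivatives have order l + size u, which is
   -la, as [iterDC_ray] requires. *)
have step i j : (i + j = l)%N ->
  iterDC (nseq i.+1 (r *: e + k *: e0 R p) ++ nseq j (r *: e) ++ u) phi (c *: e0 R p) =
  iterDC (nseq i (r *: e + k *: e0 R p) ++ nseq j.+1 (r *: e) ++ u) phi (c *: e0 R p).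
  move=> ij.
  have pe x : perm_eq (nseq i (r *: e + k *: e0 R p) ++ x :: nseq j (r *: e) ++ u)
      (x :: nseq i (r *: e + k *: e0 R p) ++ nseq j (r *: e) ++ u).
    by rewrite perm_catC /= perm_cons perm_catC.
  rewrite -[nseq i.+1 _ ++ _]/(_ :: nseq i _ ++ _) -(iterDC_perm oU ip.1 Uc (pe _)).
  rewrite (iterDC_addv _ _ _ _ oU ip.1 Uc) (iterDC_scalev _ _ _ (e0 R p) oU ip.1 Uc).
  rewrite (iterDC_perm oU ip.1 Uc (pe (e0 R p))) iterDC_ray ?mulr0 ?addr0 //.
  rewrite !size_cat !size_nseq addnA ij.
  by move: h; rewrite addSn -natr1 addrA => /eqP; rewrite -subr_eq0 addrK => /eqP.
have gen j : (j <= l.+1)%N ->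
  iterDC (nseq l.+1 (r *: e + k *: e0 R p) ++ u) phi (c *: e0 R p) =
  iterDC (nseq (l.+1 - j) (r *: e + k *: e0 R p) ++ nseq j (r *: e) ++ u) phi (c *: e0 R p).
  elim: j => [|j IH] hj; first by rewrite subn0.
  rewrite (IH (ltnW hj)) -step.
    by rewrite -subSn.
  by rewrite subSS subnK.
by have := gen l.+1 (leqnn _); rewrite subnn.
Qed.

End HomogeneousJets.

Section SymbolFunctional.
Variables (R : realType) (p d : nat) (a b : bool) (la nu : R[i]) (l m : nat).
Local Notation V := 'cV[R]_p.+2.
Local Notation C := R[i].
Local Notation W := 'cV[C]_p.
Local Notation U0 := (@punct R p.+1).
Variable vpm : 'M[R]_p -> 'M[C]_d.
Hypothesis rpm : is_rep (@SLpmpred R p) vpm.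
Variable T : {linear 'cV[C]_d -> (W -> R[i]^o)}.
Hypothesis injT : injective T.
Hypothesis rangeT : range T = @homog_poly R p l.
Hypothesis TE : forall g, g \in @SLpmpred R p -> forall v, T (vpm g *m v) = poly_act g (T v).
Hypothesis p0 : (0 < p)%N.
Hypothesis hb : b = a (+) odd (m + l).
Hypothesis hnu : nu = la + (l + m)%:R + l%:R / p%:R.
Hypothesis hbol : l = 0%N \/ la + (l + m)%:R = 1.
Implicit Types (phi : V -> C) (q : W -> C).

Definition bmid (i : 'I_p) : V := bvec (mid i).
Definition bmax : V := bvec ord_max.

Definition symbol phi (w : seq 'I_p) : C := iterDC (map bmid w ++ nseq m bmax) phi (e0 R p).

Definition tpoly (c : seq 'I_p -> C) (y : W) : C := tens l c (fun i => y i ord0).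

Lemma hpoly_tens n (c : seq 'I_p -> C) : hpoly n (fun y : W => tens n c (fun i => y i ord0)).
Proof.
elim: n c => [|n IH] c; first by exists (c [::]).
by exists (fun i y => tens n (fun w => c (i :: w)) (fun i => y i ord0)).
Qed.

Lemma hpoly_tpoly c : hpoly l (tpoly c).
Proof. exact: hpoly_tens. Qed.

(** The inverse of T on polynomials of degree l, with the default value 0 outside the range;
    linearity is available on [hpoly l] only. *)
Definition Tinv q : 'cV[C]_d := xget 0 [set v | T v = q].

Lemma TinvK q : hpoly l q -> T (Tinv q) = q.
Proof.
move=> /homog_polyE; rewrite -rangeT => -[v _ ev].
exact: (@xgetPex _ 0 [set v | T v = q] (ex_intro _ v ev)).
Qed.

Lemma Tinv_lin c q r : hpoly l q -> hpoly l r ->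
  Tinv (fun y => c * q y + r y) = c *: Tinv q + Tinv r.
Proof.
move=> hq hr; apply: injT; rewrite linearP !TinvK //.
exact: hpoly_lin.
Qed.

(* T^-1 of the polynomial y |-> D_y^l D_(e_n)^m phi (e_0); see tpoly_real. *)
Definition symb_fun phi := Tinv (tpoly (symbol phi)).

Lemma T_symb_fun phi : T (symb_fun phi) = tpoly (symbol phi).
Proof. by rewrite TinvK //; exact: hpoly_tpoly. Qed.

Lemma symb_fun_lin c phi phi' : isec a la phi -> isec a la phi' ->
  symb_fun (fun v => c * phi v + phi' v) = c *: symb_fun phi + symb_fun phi'.
Proof.
move=> ip ip'; rewrite -Tinv_lin; try exact: hpoly_tpoly.
congr Tinv; apply/funext => y; rewrite /tpoly -tensZ -tensD; apply: tens_ext => w _.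
exact: (iterDC_lin _ _ (@open_punct R p.+1) ip.1 ip'.1 (@e0_punct R p)).
Qed.

Lemma eq_symb_fun phi phi' : (forall v, U0 v -> phi v = phi' v) -> symb_fun phi = symb_fun phi'.
Proof.
move=> h; congr Tinv; apply/funext => y; apply: tens_ext => w _.
exact: (iterDC_eq _ (@open_punct R p.+1) h (@e0_punct R p)).
Qed.

Lemma sum_bmid (u : 'cV[R]_p) : \sum_i u i ord0 *: bmid i = vec 0 u 0.
Proof.
apply/colP => k; rewrite summxE; elim/ord_cases: k => [|j|].
- rewrite vec_0 big1 // => i _; rewrite !mxE eq_sym (negbTE (mid_neq0 _)) mulr0 //.
- rewrite vec_mid (bigD1 j) //= !mxE !eqxx mulr1 big1 ?addr0 // => i ij.
  by rewrite !mxE (inj_eq (@mid_inj p)) eq_sym (negbTE ij) mulr0.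
- rewrite vec_max big1 // => i _; rewrite !mxE eq_sym (negbTE (mid_neq_max _)) mulr0 //.
Qed.

Lemma tpoly_real phi u : isec a la phi ->
  tpoly (symbol phi) (cx u) = iterDC (nseq l (vec 0 u 0) ++ nseq m bmax) phi (e0 R p).
Proof.
move=> ip; rewrite -sum_bmid -(tens_iterDC _ _ _ _ (@open_punct R p.+1) ip.1 (@e0_punct R p)).
by apply: eq_tens => i; rewrite cxE.
Qed.

Lemma e0_vec : e0 R p = vec 1 0 0.
Proof.
apply/colP => k; elim/ord_cases: k => [|j|].
- by rewrite vec_0 !mxE eqxx.
- by rewrite vec_mid !mxE.
- by rewrite vec_max !mxE.
Qed.

Lemma bmax_vec : bmax = vec 0 0 1.
Proof.
apply/colP => k; elim/ord_cases: k => [|j|].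
- by rewrite vec_0 !mxE.
- by rewrite vec_mid !mxE (negbTE (mid_neq_max _)).
- by rewrite vec_max !mxE !eqxx.
Qed.

(** The total scalar by which the Levi part of P' acts, with s for [det h]: the signs cancel by [hb]
    and the exponents of t by [hnu]. *)
Lemma parity_weight (s : R) t : s = 1 \/ s = -1 ->
  cexp (nu * real_complex R t) * real_complex R (Num.sg s) ^+ b *
  (real_complex R (expR (- (t / p%:R))) ^+ l *
   (chi a la (s^-1 * expR t) * real_complex R (s^-1 * expR t) ^- (l + m))) = 1.
Proof.
move=> hs.
have s0 : s^-1 != 0 by case: hs => ->; rewrite invr_eq0 ?oppr_eq0 oner_eq0.
have et : expR t != 0 by rewrite gt_eqF ?expR_gt0.
have chis : chi a la s^-1 = real_complex R s ^+ a.
  case: hs => ->; first by rewrite invr1 chi1 rmorph1 expr1n.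
  by rewrite invrN1 /chi ltr0_sg ?oppr_lt0 ?ltr01 // normrN1 ln1 rmorph0 mulr0 cexp0 mulr1.
have sV : s^-1 = s by case: hs => ->; rewrite ?invrN1 ?invr1.
have sgs : Num.sg s = s by case: hs => ->; rewrite ?sgr1 // sgrN1.
rewrite (chiM a la s0 et) chis chi_expR sgs sV rmorphM exprMn invfM.
have -> : real_complex R (expR t) ^- (l + m) = cexp (real_complex R (- ((l + m)%:R * t))).
  by rewrite cexp_real expRN expRM_natl fmorphV rmorphXn.
have -> : real_complex R (expR (- (t / p%:R))) ^+ l = cexp (real_complex R (l%:R * - (t / p%:R))).
  by rewrite cexp_real expRM_natl rmorphXn.
have -> : real_complex R s ^- (l + m) = real_complex R s ^+ (l + m).
  by rewrite -exprVn -fmorphV sV.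
have par : real_complex R s ^+ b * (real_complex R s ^+ a * real_complex R s ^+ (l + m)) = 1.
  rewrite -!exprD; case: hs => ->; first by rewrite rmorph1 expr1n.
  by rewrite rmorphN1 -signr_odd hb !(oddD, oddb); case: (a) (odd l) (odd m) => [] [] [].
have ex : cexp (nu * real_complex R t) * (cexp (real_complex R (l%:R * - (t / p%:R))) *
    (cexp (- la * real_complex R t) * cexp (real_complex R (- ((l + m)%:R * t))))) = 1.
  rewrite -!cexpD hnu -[RHS](cexp0 R); congr cexp.
  by rewrite mulrN !rmorphN !rmorphM /= fmorphV !rmorph_nat; ring.
move: par ex; move: (_ ^+ b) (_ ^+ a) (_ ^+ (l + m)) (cexp (nu * _)) (cexp (- la * _)).
move=> A B D E F; move: (cexp _) (cexp _) => G H par ex.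
transitivity ((A * (B * D)) * (E * (H * (F * G)))); first by ring.
by rewrite par ex mul1r.
Qed.

Lemma symb_fun_par phi h t y : isec a la phi -> h \in @SLpmpred R p ->
  symb_fun (par_act h t y phi) =
  invmx (cexp (nu * real_complex R t) *: sgn_tensor b vpm h) *m symb_fun phi.
Proof.
move=> ip hh; have [v1 vM _] := rpm.
have dh := SLpm_det_neq0 hh; have hs := SLpm_det hh.
have hi : invmx h \in @SLpmpred R p by move: hh; rewrite !inE det_inv normfV => /eqP ->; rewrite invr1.
have uh : h \in unitmx by rewrite unitmxE unitfE.
have um : cexp (nu * real_complex R t) *: sgn_tensor b vpm h \in unitmx.
  rewrite unitmxZ; last by rewrite unitfE cexp_neq0.
  rewrite /sgn_tensor unitmxZ; last first.
    by rewrite unitrX // unitfE fmorph_eq0 sgr_eq0.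
  by have [] : vpm h \in unitmx /\ vpm (invmx h) \in unitmx by apply: mulmx1_unit; rewrite -vM // mulmxV.
rewrite -[LHS](mulKmx um); congr (_ *m _).
apply: injT; rewrite -!scalemxAl !linearZ TE // !T_symb_fun.
have ip' := isec_par_act t y hh p0 ip.
set c0 := cexp _; set s0 := real_complex R _ ^+ b.
have hl : hpoly l (fun x => c0 * (s0 * tpoly (symbol (par_act h t y phi)) (invmx (map_mx (real_complex R) h) *m x))).
  by do 2!apply: hpolyZ; apply: hpoly_comp; exact: hpoly_tpoly.
(* Both sides are polynomials, so they may be compared at real points, where [tpoly_real] turns them
   into derivatives in a single direction. *)
have hz := hpoly_lin (-1) (hpoly_tpoly (symbol phi)) hl.
suff : (fun x => -1 * tpoly (symbol phi) x + c0 * (s0 * tpoly (symbol (par_act h t y phi)) (invmx (map_mx (real_complex R) h) *m x))) = fun=> 0.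
  move=> e; apply/funext => x; have := congr1 (fun f => f x) e => /eqP.
  by rewrite mulN1r addrC subr_eq0 => /eqP.
apply: (hpoly_real_zero hz) => u.
rewrite -map_invmx /cx -map_mxM -!/(cx _) !tpoly_real //.
pose c := (\det h)^-1 * expR t; pose r := expR (- (t / p%:R)).
have c1 : c != 0 by rewrite mulf_neq0 ?invr_eq0 // gt_eqF ?expR_gt0.
pose A (v : V) : V := diag1_mx (par_M h *m par_A p t *m par_N y) *m v.
have hA (k : R) v x : A (k *: v + x) = k *: A v + A x by rewrite /A mulmxDr scalemxAr.
have AE a0 x z : A (vec a0 x z) = vec (c * (a0 + (y *m x) ord0 ord0)) (r *: (h *m x)) z.
  by rewrite /A par_vec.
have -> : par_act h t y phi = fun v => phi (A v).
  by apply/funext => v; rewrite {2}(vecE v) AE.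
have Ae : A (e0 R p) = c *: e0 R p.
  rewrite e0_vec AE mulmx0 (mxE _ _ ord0 ord0) addr0 mulr1 mulmx0 scaler0.
  apply/colP => k; rewrite [RHS]mxE; elim/ord_cases: k => [|j|].
  - by rewrite !vec_0 mulr1.
  - by rewrite !vec_mid mxE mulr0.
  - by rewrite !vec_max mulr0.
have Az : A bmax = bmax.
  by rewrite bmax_vec AE !mulmx0 (mxE _ _ ord0 ord0) addr0 mulr0 scaler0.
have Au : A (vec 0 (invmx h *m u) 0) = r *: vec 0 u 0 + (c * (y *m (invmx h *m u)) ord0 ord0) *: e0 R p.
  rewrite AE add0r mulKVmx // e0_vec; apply/colP => k; rewrite !mxE; elim/ord_cases: k => [|j|].
  - by rewrite !vec_0 mulr0 add0r mulr1.
  - by rewrite !vec_mid !mxE mulr0 addr0.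
  - by rewrite !vec_max !mulr0 addr0.
rewrite (iterDC_linear hA) map_cat !map_nseq Ae Az Au.
rewrite (bol_invariance _ _ _ ip c1); last by rewrite size_nseq.
rewrite (iterDC_homog _ ip c1 (@e0_punct R p)) size_cat !size_nseq.
rewrite mulN1r; apply/eqP; rewrite addrC subr_eq0; apply/eqP.
have := parity_weight t hs; rewrite -/c -/r -/c0 -/s0 => e.
by rewrite -[RHS]mul1r -{}e; ring.
Qed.

End SymbolFunctional.

(** * The embedding of GL(n) in GL(n + 1) *)

Section Embedded.
Variables (R : realType) (p : nat).
Local Notation M := 'M[R]_p.+1.
Local Notation V := 'cV[R]_p.+2.

Definition emb (i : 'I_p.+1) : 'I_p.+2 := cast_ord (addn1 p.+1) (lshift 1 i).

Lemma emb0 : emb ord0 = ord0. Proof. exact/val_inj. Qed.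

Lemma emb_mid j : emb (rshift 1 j) = mid j. Proof. by []. Qed.

Lemma emb_cases (P : 'I_p.+2 -> Prop) : (forall i, P (emb i)) -> P ord_max -> forall i, P i.
Proof.
move=> h1 h2; apply: ord_cases => //; first by rewrite -emb0.
by move=> j; rewrite -emb_mid.
Qed.

Lemma emb_neq_max i : emb i != ord_max.
Proof. by rewrite -val_eqE /= neq_ltn ltn_ord. Qed.

Lemma emb_inj : injective emb.
Proof. by move=> i j /(congr1 val) /= e; exact/val_inj. Qed.

Lemma mulmx_bvec q (A : 'M[R]_q.+1) j i : (A *m bvec j) i ord0 = A i j.
Proof. by rewrite -colE mxE. Qed.

Lemma diag1_mx_emb (x : M) i k : diag1_mx x (emb i) (emb k) = x i k.
Proof. by rewrite castmxE /emb !cast_ordK block_mxEul. Qed.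

Lemma ord_max_rshift : ord_max = cast_ord (addn1 p.+1) (rshift p.+1 (ord0 : 'I_1)) :> 'I_p.+2.
Proof. by apply/val_inj; rewrite /= addn0. Qed.

Lemma diag1_mx_max (x : M) k : diag1_mx x ord_max (emb k) = 0.
Proof. by rewrite ord_max_rshift castmxE /emb !cast_ordK block_mxEdl mxE. Qed.

Lemma diag1_mx_bmax (x : M) : diag1_mx x *m bmax R p = bmax R p.
Proof.
apply/colP => i; rewrite mulmx_bvec; elim/emb_cases: i => [i|].
  rewrite {1}ord_max_rshift castmxE /emb !cast_ordK block_mxEur !mxE.
  by rewrite -/(emb i) (negbTE (emb_neq_max i)).
by rewrite {1 2}ord_max_rshift castmxE !cast_ordK block_mxEdr !mxE !eqxx.
Qed.

Lemma diag1_mx_bvec (x : M) k : diag1_mx x *m bvec (emb k) = \sum_i x i k *: bvec (emb i).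
Proof.
apply/colP => i; rewrite mulmx_bvec summxE; elim/emb_cases: i => [i|].
  rewrite diag1_mx_emb (bigD1 i) //= big1 => [|j ji]; rewrite !mxE ?eqxx ?mulr1 ?addr0 //.
  by rewrite (inj_eq emb_inj) eq_sym (negbTE ji) mulr0.
rewrite diag1_mx_max big1 // => j _.
by rewrite !mxE eq_sym (negbTE (emb_neq_max j)) mulr0.
Qed.

Definition base_pt (x : M) : V := diag1_mx x *m e0 R p.

Lemma base_ptE x : base_pt x = \sum_i x i ord0 *: bvec (emb i).
Proof. by rewrite /base_pt /e0 -emb0 diag1_mx_bvec. Qed.

Lemma base_pt_lin (h : R) v x : base_pt (h *: v + x) = h *: base_pt v + base_pt x.
Proof.
rewrite !base_ptE scaler_sumr -big_split /=; apply: eq_bigr => i _.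
by rewrite !mxE scalerDl scalerA.
Qed.

Lemma base_pt_continuous : continuous base_pt.
Proof. by apply: linear_mx_continuous => h u v; exact: base_pt_lin. Qed.

Lemma det_diag1_mx (x : M) : \det (diag1_mx x) = \det x.
Proof.
have det_cast k k' (e : k = k') (A : 'M[R]_k) : \det (castmx (e, e) A) = \det A.
  by case: k' / e; rewrite castmx_id.
by rewrite det_cast det_ublock det1 mulr1.
Qed.

Lemma diag1_GL (x : M) : GLset x -> GLset (diag1_mx x).
Proof. by rewrite /GLset /= det_diag1_mx. Qed.

Lemma base_pt_col x : base_pt x = col ord0 (diag1_mx x).
Proof. by rewrite /base_pt colE. Qed.

Lemma base_pt_neq0 x : GLset x -> @punct R p.+1 (base_pt x).
Proof. by move=> /diag1_GL h; rewrite base_pt_col; exact: col0_neq0. Qed.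

Lemma diag1_continuous : continuous (@diag1_mx R p.+1).
Proof.
(* Because of the corner entry 1 the map is affine and not linear; its linear part is split off. *)
move=> x; have e (y : M) : diag1_mx y = (diag1_mx y - diag1_mx 0) + diag1_mx 0 by rewrite subrK.
rewrite (_ : @diag1_mx R p.+1 = fun y => (diag1_mx y - diag1_mx 0) + diag1_mx 0); last exact/funext.
have lin : linear (fun y : M => diag1_mx y - diag1_mx 0).
  have s (B B' : 'M[R]_p.+1) : diag1_mx B - diag1_mx B' = castmx (addn1 p.+1, addn1 p.+1) (block_mx (B - B') 0 0 0 : 'M[R]_(p.+1 + 1)).
    apply/matrixP => i j; rewrite !(castmxE, mxE).
    by case: splitP => k _; rewrite !mxE; case: splitP => k' _; rewrite !mxE ?subrr ?subr0.
  move=> c u v; rewrite !s !subr0; apply/matrixP => i j; rewrite !(castmxE, mxE).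
  by case: splitP => k _; rewrite !mxE; case: splitP => k' _; rewrite !mxE ?mulr0 ?addr0.
have cc : (fun _ : M => diag1_mx (0 : M)) @ x --> diag1_mx (0 : M) by exact: cst_continuous.
have cl : (fun y : M => diag1_mx y - diag1_mx 0) @ x --> diag1_mx (x : M) - diag1_mx 0.
  by apply: (linear_mx_continuous lin).
exact: (cvgD cl cc).
Qed.

End Embedded.

Section CompactBound.
Variable R : realType.

Lemma compact_bound (q : nat) (K : set 'M[R]_q.+1) (c : 'M[R]_q.+1 -> R) :
  compact K -> K `<=` @GLset R q.+1 -> smooth_on (@GLset R q.+1) c ->
  exists2 B : R, 0 <= B & forall x, K x -> `|c x| <= B.
Proof.
move=> cK KG sc.
have cc : {within K, continuous c}.
  apply: continuous_in_subspaceT => x /set_mem Kx.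
  by have [] := smooth_diff1 sc (KG x Kx).
have [B [_ hB]] := compact_bounded (continuous_compact cc cK).
exists (`|B| + 1); first by rewrite addr_ge0.
move=> x Kx; apply: hB; last by exists x.
by rewrite (le_lt_trans (ler_norm B)) // ltrDl.
Qed.

Variables (q : nat) (a : bool) (la : R[i]).
Local Notation V := 'cV[R]_q.+1.
Local Notation M := 'M[R]_q.+1.
Local Notation GL := (@GLset R q.+1).

Definition delta_word (w : seq ('I_q.+1 * 'I_q.+1)) : seq M := [seq delta_mx ij.1 ij.2 | ij <- w].

(* The derivatives of a homogeneous function along the first column are
   recovered from those of the section on the group. *)
Lemma jet_of_section b (ws : seq 'I_q.+1) :
  exists (I : finType) (cs : I -> M -> R) (bs : I -> bool) (us : I -> seq ('I_q.+1 * 'I_q.+1)),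
  [/\ forall i, smooth_on GL (cs i), forall i, (size (us i) <= size ws)%N &
   forall phi, isec a la phi -> forall X, GL X ->
     iterD (map bvec ws) (fun v => reim b (phi v)) (col ord0 X) =
     \sum_i cs i X * iterD (delta_word (us i)) (gl_comp (sec phi) ord0 (bs i)) X].
Proof.
have oG := @open_GL R q.
pose w' : seq M := [seq delta_mx k ord0 | k <- ws].
have sdet : csmooth GL (fun X => chi a la (\det X)).
  exact: (csmooth_chi a la oG (smooth_det oG) (fun _ h => h)).
have hid (h : R) (v x : M) : id (h *: v + x) = h *: id v + id x by [].
have key b' := @iterD_mul_affine R M M id id hid (fun x => @cvg_id _ _) GL GL
  (fun X => mul_coef b b' (chi a la (\det X))) w' oG (smooth_mul_coef b b' oG sdet) (fun _ h => h).
have h b' : exists (I : finType) (cs : I -> M -> R) (us : I -> seq ('I_q.+1 * 'I_q.+1)),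
  [/\ forall i, smooth_on GL (cs i), forall i, (size (us i) <= size ws)%N &
    forall F, smooth_on GL F -> forall X, GL X ->
      iterD w' (fun y => mul_coef b b' (chi a la (\det y)) * F y) X =
      \sum_i cs i X * iterD (delta_word (us i)) F X].
  have [I [cs [vs [h1 h2 h3]]]] := key b'.
  have hu i : exists u : seq ('I_q.+1 * 'I_q.+1), (size u <= size ws)%N /\ vs i = delta_word u.
    have := h2 i; rewrite map_id => /subseqP[mk sm ->].
    exists [seq (k, ord0) | k <- mask mk ws]; split.
      by rewrite size_map; exact: (size_subseq (mask_subseq mk ws)).
    by rewrite /w' -map_mask /delta_word -map_comp.
  have [us hus] := choice hu.
  exists I, cs, us; split => // [i|F sF X GX]; first by have [] := hus i.
  by rewrite h3 //; apply: eq_bigr => i _; have [_ ->] := hus i.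
have [I1 [c1 [u1 [s1 n1 e1]]]] := h true; have [I2 [c2 [u2 [s2 n2 e2]]]] := h false.
exists (I1 + I2)%type, (fun i => match i with inl j => c1 j | inr j => c2 j end),
  (fun i => if i is inl _ then true else false),
  (fun i => match i with inl j => u1 j | inr j => u2 j end).
split=> [[i|i]|[i|i]|phi ip X GX] //.
have cA (k : R) (x y : M) : col ord0 (k *: x + y) = k *: col ord0 x + col ord0 y by rewrite linearP.
have sF b' : smooth_on GL (gl_comp (sec phi) ord0 b') := smooth_sec ip ord0 b'.
have ew : map bvec ws = map (fun x : M => col ord0 x) w'.
  rewrite /w' -map_comp; apply: eq_map => k /=.
  by apply/colP => i; rewrite !mxE eqxx andbT.
have := iterD_affine cA w' (fun v => reim b (phi v)); rewrite -ew => /(congr1 (fun f => f X)) /= <-.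
have eG Y : GL Y -> reim b (phi (col ord0 Y)) =
    \sum_b' 1 * (mul_coef b b' (chi a la (\det Y)) * gl_comp (sec phi) ord0 b' Y).
  move=> GY; rewrite /gl_comp (gl_ext_sec ip.2 GY) mxE.
  have e3 : phi (col ord0 Y) = chi a la (\det Y) * (chi a la (\det Y)^-1 * phi (col ord0 Y)).
    by rewrite mulrA -chiM ?invr_eq0 // divff // chi1 mul1r.
  by rewrite [in LHS]e3 reim_mul; apply: eq_bigr => b' _; rewrite mul1r.
rewrite (iterD_eq w' oG eG GX).
have sM b' := smoothM oG (smooth_mul_coef b b' oG sdet) (sF b').
rewrite (iterD_lin_sum _ (fun=> 1) w' oG sM GX) big_bool big_sumType /= !mul1r.
by rewrite (e1 _ (sF true) X GX) (e2 _ (sF false) X GX).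
Qed.

End CompactBound.

(** * Differential operators with smooth coefficients *)

Section Representable.
Variables (R : realType) (p : nat) (a : bool) (la : R[i]).
Local Notation M := 'M[R]_p.+1.
Local Notation V := 'cV[R]_p.+2.
Local Notation C := R[i].
Local Notation GL := (@GLset R p.+1).
Local Notation U0 := (@punct R p.+1).
Implicit Types (phi : V -> C) (H : (V -> C) -> M -> R).

(* Differential operators with smooth coefficients which do not depend on the
   section they are applied to. *)
Inductive diffop_rep : ((V -> C) -> M -> R) -> Prop :=
| Rep0 H : (forall phi x, isec a la phi -> GL x -> H phi x = 0) -> diffop_rep H
| RepS H H' c b ws : smooth_on GL c -> diffop_rep H' ->
    (forall phi x, isec a la phi -> GL x ->
      H phi x = c x * iterD (map bvec ws) (fun v => reim b (phi v)) (base_pt x) + H' phi x) ->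
    diffop_rep H.

Let oG : open GL := @open_GL R p.
Let oU : open U0 := @open_punct R p.+1.

Lemma rep_ext H H' : (forall phi x, isec a la phi -> GL x -> H phi x = H' phi x) ->
  diffop_rep H' -> diffop_rep H.
Proof.
move=> e h; case: h e => [{}H' h0|{}H' H2 c b ws sc r2 e2] e.
  by apply: Rep0 => phi x ip Gx; rewrite e // h0.
by apply: (RepS sc r2) => phi x ip Gx; rewrite e // (e2 _ _ ip Gx).
Qed.

Lemma repD H1 H2 : diffop_rep H1 -> diffop_rep H2 -> diffop_rep (fun phi x => H1 phi x + H2 phi x).
Proof.
move=> r1 r2; elim: r1 => [H h0|H H' c b ws sc _ IH e].
  by apply: rep_ext r2 => phi x ip Gx; rewrite h0 // add0r.
by apply: (RepS sc IH) => phi x ip Gx; rewrite (e _ _ ip Gx) addrA.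
Qed.

Lemma repM f H : smooth_on GL f -> diffop_rep H -> diffop_rep (fun phi x => f x * H phi x).
Proof.
move=> sf; elim=> [{}H h0|{}H H' c b ws sc _ IH e].
  by apply: Rep0 => phi x ip Gx; rewrite h0 // mulr0.
apply: (RepS (smoothM oG sf sc) IH) => phi x ip Gx.
by rewrite (e _ _ ip Gx) mulrDr mulrA.
Qed.

Lemma rep_sum (I : Type) (s : seq I) (F : I -> (V -> C) -> M -> R) :
  (forall i, diffop_rep (F i)) -> diffop_rep (fun phi x => \sum_(i <- s) F i phi x).
Proof.
move=> h; elim: s => [|i s IH]; first by apply: Rep0 => phi x _ _; rewrite big_nil.
by apply: rep_ext (repD (h i) IH) => phi x _ _; rewrite big_cons.
Qed.

Lemma rep_jet b ws : diffop_rep (fun phi x => iterD (map bvec ws) (fun v => reim b (phi v)) (base_pt x)).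
Proof.
apply: (RepS (c := fun=> 1) (H' := fun _ _ => 0)); first exact: smooth_cst.
  exact: Rep0.
by move=> phi x _ _; rewrite mul1r addr0.
Qed.

Lemma smooth_base F : smooth_on U0 F -> smooth_on GL (fun x => F (base_pt x)).
Proof. exact: (smooth_affine (@base_pt_lin R p) (@base_pt_continuous R p) (@base_pt_neq0 R p)). Qed.

Lemma rep_smooth H phi : diffop_rep H -> isec a la phi -> smooth_on GL (H phi).
Proof.
move=> r ip; elim: r => [{}H h0|{}H H' c b ws sc _ IH e].
  by apply: (smooth_eq oG (G := fun=> 0)) => [x Gx|]; [exact: h0|exact: smooth_cst].
have sJ := smooth_base (smooth_iterD (map bvec ws) (ip.1 b)).
apply: (smooth_eq oG _ (smoothD oG (smoothM oG sc sJ) IH)) => x Gx.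
exact: e.
Qed.

(** A derivative falls on the coefficient or moves the base point. In the second case it lengthens
    the word by constant directions [bvec (emb i)], with the entries of u as new coefficients. *)
Lemma rep_derive u H : diffop_rep H -> diffop_rep (fun phi => 'D_u (H phi)).
Proof.
elim=> [{}H h0|{}H H' c b ws sc r' IH e].
  apply: Rep0 => phi x ip Gx.
  have n : \forall y \near x, H phi y = (fun=> 0) y.
    by have := open_nbhs_nbhs (conj oG Gx); apply: filterS => y Gy; exact: h0.
  by rewrite (near_eq_derive _ n) derive_cst.
apply: (rep_ext (H' := fun phi x => 'D_u c x * iterD (map bvec ws) (fun v => reim b (phi v)) (base_pt x) +
   (\sum_i (u i ord0 * c x) * iterD (map bvec (emb i :: ws)) (fun v => reim b (phi v)) (base_pt x) + 'D_u (H' phi) x))).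
  move=> phi x ip Gx.
  have sJ0 := smooth_iterD (map bvec ws) (ip.1 b).
  have sJ := smooth_base sJ0.
  have n : \forall y \near x, H phi y = c y * iterD (map bvec ws) (fun v => reim b (phi v)) (base_pt y) + H' phi y.
    by have := open_nbhs_nbhs (conj oG Gx); apply: filterS => y Gy; exact: e.
  rewrite (near_eq_derive _ n).
  have dc := smooth_diff1 sc Gx; have dJ := smooth_diff1 sJ Gx.
  have d' := smooth_diff1 (rep_smooth r' ip) Gx.
  rewrite (derive_fD _ (diff1M dc dJ) d') (derive_fM _ dc dJ) (addrC (c x * _)) -addrA; congr (_ + (_ + _)).
  have := iterD_affine (@base_pt_lin R p) [:: u] (iterD (map bvec ws) (fun v => reim b (phi v))).
  move=> /(congr1 (fun f => f x)) /= ->.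
  rewrite (base_ptE u) (derive_sumv _ _ _ oU sJ0 (base_pt_neq0 Gx)) mulr_sumr.
  by apply: eq_bigr => i _; rewrite mulrA (mulrC (c x)).
apply: repD; first by apply: repM; [exact: (smooth_derive u sc)|exact: rep_jet].
apply: repD => //; apply: rep_sum => i; apply: repM; last exact: rep_jet.
exact: (smoothZ _ oG sc).
Qed.

Lemma rep_reim_mul (z : C) (h : (V -> C) -> M -> C) :
  (forall b, diffop_rep (fun phi x => reim b (h phi x))) ->
  forall b, diffop_rep (fun phi x => reim b (z * h phi x)).
Proof.
move=> r b; apply: (rep_ext (H' := fun phi x => \sum_b' mul_coef b b' z * reim b' (h phi x))).
  by move=> phi x _ _; rewrite reim_mul.
by apply: rep_sum => b'; apply: repM => //; exact: smooth_cst.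
Qed.

Lemma rep_reim_cmul (f : M -> C) (h : (V -> C) -> M -> C) : csmooth GL f ->
  (forall b, diffop_rep (fun phi x => reim b (h phi x))) ->
  forall b, diffop_rep (fun phi x => reim b (f x * h phi x)).
Proof.
move=> sf r b; apply: (rep_ext (H' := fun phi x => \sum_b' mul_coef b b' (f x) * reim b' (h phi x))).
  by move=> phi x _ _; rewrite reim_mul.
by apply: rep_sum => b'; apply: repM => //; exact: smooth_mul_coef.
Qed.

Definition lin_on_hpoly n (t : ('cV[C]_p -> C) -> C) :=
  forall c q r, hpoly n q -> hpoly n r -> t (fun y => c * q y + r y) = c * t q + t r.

(** Meant for the entries of [Tinv], which are linear on polynomials of one degree only; hence t is
    assumed linear on [hpoly n]. The induction replaces t by q |-> t(y_i q), until t is applied to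
    constants. *)
Lemma rep_tens n (t : ('cV[C]_p -> C) -> C) (c : (V -> C) -> M -> seq 'I_p -> C) :
  lin_on_hpoly n t -> (forall w b, diffop_rep (fun phi x => reim b (c phi x w))) ->
  forall b, diffop_rep (fun phi x => reim b (t (fun y => tens n (c phi x) (fun i => y i ord0)))).
Proof.
elim: n t c => [|n IH] t c lt rc b /=.
  have h0 : hpoly 0 (fun _ : 'cV[C]_p => 0 : C) by exists 0.
  have h1 : hpoly 0 (fun _ : 'cV[C]_p => 1 : C) by exists 1.
  have t0 : t (fun=> 0) = 0.
    have e0 : -1 * t (fun=> 0) + t (fun=> 0) = 0 by rewrite mulN1r addNr.
    by rewrite -[RHS]e0 -lt //; congr t; apply/funext => y; rewrite mulr0 addr0.
  apply: rep_ext (rep_reim_mul (t (fun=> 1)) (rc [::]) b) => phi x _ _.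
  congr reim; rewrite mulrC -[RHS]addr0 -t0 -lt //.
  by congr t; apply/funext => y; rewrite mulr1 addr0.
have hs i q : hpoly n q -> hpoly n.+1 (fun y : 'cV[C]_p => y i ord0 * q y) by exact: hpoly_coord.
pose ti i (q : 'cV[C]_p -> C) := t (fun y => y i ord0 * q y).
have lti i : lin_on_hpoly n (ti i).
  move=> z q r hq hr; rewrite /ti -lt; [|exact: hs|exact: hs].
  by congr t; apply/funext => y; ring.
have t0 : t (fun=> 0) = 0.
  have e0 : -1 * t (fun=> 0) + t (fun=> 0) = 0 by rewrite mulN1r addNr.
  rewrite -[RHS]e0 -lt; [|exact: hpoly0|exact: hpoly0].
  by congr t; apply/funext => y; rewrite mulr0 addr0.
have tsum (s : seq 'I_p) (F : 'I_p -> 'cV[C]_p -> C) : (forall i, hpoly n.+1 (F i)) ->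
    t (fun y => \sum_(i <- s) F i y) = \sum_(i <- s) t (F i).
  move=> hF; elim: s => [|i s IHs].
    by rewrite big_nil -t0; congr t; apply/funext => y; rewrite big_nil.
  rewrite big_cons -IHs -[t (F i)]mul1r -lt //; last exact: hpoly_sum.
  by congr t; apply/funext => y; rewrite big_cons mul1r.
apply: (rep_ext (H' := fun phi x => \sum_i reim b (ti i (fun y => tens n (fun w => c phi x (i :: w)) (fun i => y i ord0))))).
  move=> phi x _ _; rewrite tsum ?reim_sum // => i.
  by apply: hs; exact: hpoly_tens.
by apply: rep_sum => i; apply: (IH (ti i) (fun phi x w => c phi x (i :: w))).
Qed.

Variables (K : set M).
Hypothesis cK : compact K.
Hypothesis KG : K `<=` GL.
Let K2 := (@diag1_mx R p.+1) @` K.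

Lemma compact_K2 : compact K2.
Proof.
apply: continuous_compact cK; apply: continuous_subspaceT => x.
exact: diag1_continuous.
Qed.

Lemma K2_GL : K2 `<=` @GLset R p.+2.
Proof. by move=> _ [x Kx <-]; apply: diag1_GL; exact: KG. Qed.

Lemma Cinfty_le N N' e (f : SL R p.+2 -> 'cV[C]_1) : (N <= N')%N ->
  Cinfty_nbhs0 K2 N' e f -> Cinfty_nbhs0 K2 N e f.
Proof. by move=> NN h x Kx w sw; apply: h => //; exact: leq_trans NN. Qed.

(** Compactness bounds the coefficients once and for all, as they do not depend on phi, and
    [jet_of_section] turns the derivatives of phi into those of the section on [K2]. *)
Lemma rep_bound H : diffop_rep H -> exists N (B : R), 0 <= B /\
  forall phi e, isec a la phi -> Cinfty_nbhs0 K2 N e (sec phi) ->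
    forall x, K x -> `|H phi x| <= B * e.
Proof.
elim=> [{}H h0|{}H H' c b ws sc _ [N [B [B0 hB]]] e].
  by exists 0%N, 0; split=> // phi e ip _ x Kx; rewrite h0 ?normr0 ?mul0r //; exact: KG.
have [Bc Bc0 hc] := compact_bound cK KG sc.
have [I [cs [bs [us [scs nus ecs]]]]] := jet_of_section a la b ws.
have hc2 i : exists r : R, 0 <= r /\ forall X, K2 X -> `|cs i X| <= r.
  by have [r r0 hr] := compact_bound compact_K2 K2_GL (scs i); exists r.
have [Bs hBs] := choice hc2.
exists (maxn N (size ws)), (Bc * \sum_i Bs i + B); split.
  by rewrite addr_ge0 // mulr_ge0 // sumr_ge0 // => i _; case: (hBs i).
move=> phi eps ip hf x Kx; rewrite (e _ _ ip (KG Kx)).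
have h1 := hB _ _ ip (Cinfty_le (leq_maxl _ _) hf) x Kx.
have Kx2 : K2 (diag1_mx x) by exists x.
rewrite base_pt_col (ecs _ ip _ (K2_GL Kx2)).
rewrite mulrDl; apply: (le_trans (ler_normD _ _)); apply: lerD => //.
rewrite normrM -mulrA; apply: ler_pM => //; first exact: hc.
rewrite mulr_suml; apply: (le_trans (ler_norm_sum _ _ _)); apply: ler_sum => i _.
rewrite normrM; apply: ler_pM => //; first by have [_ h] := hBs i; exact: h.
apply: ltW; apply: hf => //.
by rewrite (leq_trans (nus i)) // leq_maxr.
Qed.

Lemma rep_bound_words n H : diffop_rep H -> exists N (B : R), 0 <= B /\
  forall phi e, isec a la phi -> Cinfty_nbhs0 K2 N e (sec phi) ->
    forall x, K x -> forall w : seq ('I_p.+1 * 'I_p.+1), (size w <= n)%N ->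
      `|iterD (delta_word R w) (H phi) x| <= B * e.
Proof.
elim: n H => [|n IH] H rH.
  have [N [B [B0 hB]]] := rep_bound rH; exists N, B; split=> // phi e ip hf x Kx w.
  by rewrite leqn0 => /nilP ->; exact: (hB _ _ ip hf).
have [N [B [B0 hB]]] := IH H rH.
have hd (ij : 'I_p.+1 * 'I_p.+1) := IH _ (rep_derive (delta_mx ij.1 ij.2) rH).
have [Ns hN] := choice hd; have [Bs hBs] := choice hN.
exists (maxn N (\max_ij Ns ij)), (B + \sum_ij Bs ij).
have Bs0 : 0 <= \sum_ij Bs ij by apply: sumr_ge0 => ij _; case: (hBs ij).
split; first by rewrite addr_ge0.
move=> phi e ip hf x Kx w; rewrite leq_eqVlt => /orP[/eqP sw|sw]; last first.
  have hb := hB _ _ ip (Cinfty_le (leq_maxl _ _) hf) x Kx w sw.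
  have e0 : 0 <= e.
    have := hf (diag1_mx x) (ex_intro2 _ _ x Kx erefl) [::] (leq0n _) ord0 false.
    by move=> /ltW; exact: le_trans.
  by rewrite (le_trans hb) // ler_wpM2r // lerDl.
case/lastP: w sw => [//|w ij]; rewrite size_rcons => -[sw].
rewrite /delta_word map_rcons -cats1 iterD_cat.
have e0 : 0 <= e.
  have := hf (diag1_mx x) (ex_intro2 _ _ x Kx erefl) [::] (leq0n _) ord0 false.
  by move=> /ltW; exact: le_trans.
have [Bij hb] := hBs ij.
have lN : (Ns ij <= maxn N (\max_ij Ns ij))%N.
  by rewrite leq_max (leq_bigmax ij) orbT.
have := hb _ _ ip (Cinfty_le lN hf) x Kx w; rewrite sw => /(_ (leqnn _)) h.
apply: (le_trans h); rewrite ler_wpM2r // (bigD1 ij) //= addrCA lerDl addr_ge0 //.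
by apply: sumr_ge0 => k _; case: (hBs k).
Qed.

End Representable.

Section ExistenceTopology.
Variables (R : realType) (p : nat).
Local Notation M := 'M[R]_p.+1.

Lemma nbhs_SL k (g : SL R k) (B : set (SL R k)) : nbhs g B ->
  exists A : set 'M[R]_k, nbhs (val g) A /\ forall h : SL R k, A (val h) -> B h.
Proof.
rewrite nbhsE => -[W [[A oA eA] Wg] WB]; exists A; split.
  by apply: open_nbhs_nbhs; split=> //; move: Wg; rewrite -eA.
by move=> h Ah; apply: WB; rewrite -eA.
Qed.

Lemma SL_nbhs k (g : SL R k) (A : set 'M[R]_k) : nbhs (val g) A ->
  nbhs g [set h : SL R k | A (val h)].
Proof. by move=> nA; have cS : continuous (@SLval R k) := @initial_continuous _ _ _; exact: (cS g A nA). Qed.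

Lemma sl_retractE (x : M) : sl_retract x =
  x *m (1%:M - delta_mx ord0 ord0) + (\det x)^-1 *: (x *m delta_mx ord0 ord0).
Proof.
rewrite /sl_retract scalemxAr -mulmxDr; congr (_ *m _); apply/matrixP => i j; rewrite !mxE.
have [->|ij] := eqVneq i j.
  by rewrite !mulr1n andbb; case: (j == ord0); rewrite ?subrr ?mulr1 ?add0r ?subr0 ?mulr0 ?addr0.
have -> : (i == ord0) && (j == ord0) = false.
  by apply/negP => /andP[/eqP ei /eqP ej]; rewrite ei ej eqxx in ij.
by rewrite !mulr0n subr0 mulr0 addr0.
Qed.

Lemma sl_retract_continuous (x : M) : GLset x -> {for x, continuous (@sl_retract R p)}.
Proof.
move=> Gx.
have dx : (fun y : M => \det y) @ x --> (\det x : R) by exact: det_continuous.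
have l1 : (fun y : M => y *m (1%:M - delta_mx ord0 ord0)) @ x --> x *m (1%:M - delta_mx ord0 ord0).
  have h : continuous (fun y : M => y *m (1%:M - delta_mx ord0 ord0)).
    by apply: linear_mx_continuous => k u v; rewrite mulmxDl scalemxAl.
  exact: h.
have l2 : (fun y : M => y *m (delta_mx ord0 ord0 : M)) @ x --> x *m (delta_mx ord0 ord0 : M).
  have h : continuous (fun y : M => y *m (delta_mx ord0 ord0 : M)).
    by apply: linear_mx_continuous => k u v; rewrite mulmxDl scalemxAl.
  exact: h.
have dV : (fun y : M => (\det y)^-1) @ x --> ((\det x)^-1 : R) by exact: cvgV dx.
have h := cvgD l1 (cvgZ dV l2).
have e : @sl_retract R p = fun y => y *m (1%:M - delta_mx ord0 ord0) + (\det y)^-1 *: (y *m delta_mx ord0 ord0).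
  by apply/funext => y; exact: sl_retractE.
rewrite /prop_for /continuous_at e; exact: h.
Qed.

Lemma sl_retract_SL (g : SL R p.+1) : sl_retract (val g) = val g.
Proof. by rewrite sl_retractE SL_det invr1 scale1r -mulmxDr subrK mulmx1. Qed.

Lemma diag1_nbhs (g : SL R p.+1) (B : set (SL R p.+2)) : nbhs (diag1 g) B ->
  nbhs g [set h | B (diag1 h)].
Proof.
move=> /nbhs_SL[A [nA AB]].
have := SL_nbhs (diag1_continuous nA); apply: filterS => h Ah; exact: AB.
Qed.

End ExistenceTopology.

Section VanishingSection.
Variables (R : realType) (q : nat) (a : bool) (la : R[i]).
Local Notation rep := (sgn_tensor a (fun _ : 'M[R]_q => 1%:M : 'M[R[i]]_1)).
Hypothesis q0 : (0 < q)%N.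

(** A point v near g e_0 is lifted to a group element near g by [sl_retract (Y v)], where [Y v] is g
    with its first column replaced by v. The lift has first column proportional to v, so homogeneity
    carries the zero of f over to v. *)
Lemma phi_of_near0 (f : SL R q.+1 -> 'cV[R[i]]_1) (g : SL R q.+1) : f \in Ind_pred rep la ->
  nbhs g [set h | f h = 0] -> nbhs (col ord0 (val g)) [set v | phi_of f v = 0].
Proof.
move=> hf /nbhs_SL[A [nA A0]].
have [sp hp] := isec_phi_of q0 hf.
pose v0 := col ord0 (val g).
pose Y (v : 'cV[R]_q.+1) := v *m (delta_mx ord0 ord0 : 'rV[R]_q.+1) + (val g - v0 *m delta_mx ord0 ord0).
have Y0 : Y v0 = val g by rewrite /Y addrC subrK.
have colY v : col ord0 (Y v) = v.
  rewrite /Y !linearD linearN /= /v0 !colE -!mulmxA mul_delta_mx.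
  have e (u : 'cV[R]_q.+1) : u *m delta_mx ord0 (ord0 : 'I_1) = u.
    by rewrite (_ : delta_mx _ _ = 1%:M) ?mulmx1 //; apply/matrixP => i j; rewrite !ord1 !mxE.
  by rewrite !e subrr addr0.
have cY : Y @ v0 --> (val g : 'M[R]_q.+1).
  rewrite -Y0.
  have c1 : (fun v : 'cV[R]_q.+1 => v *m (delta_mx ord0 ord0 : 'rV[R]_q.+1)) @ v0 --> v0 *m (delta_mx ord0 ord0 : 'rV[R]_q.+1).
    have h : continuous (fun v : 'cV[R]_q.+1 => v *m (delta_mx ord0 ord0 : 'rV[R]_q.+1)).
      by apply: linear_mx_continuous => k u v; rewrite mulmxDl scalemxAl.
    exact: h.
  have c2 : (fun _ : 'cV[R]_q.+1 => val g - v0 *m (delta_mx ord0 ord0 : 'rV[R]_q.+1)) @ v0 -->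
     val g - v0 *m (delta_mx ord0 ord0 : 'rV[R]_q.+1) by exact: cst_continuous.
  exact: (cvgD c1 c2).
have Gg : GLset (val g) by rewrite /GLset /= SL_det oner_neq0.
have cr := sl_retract_continuous Gg.
have n1 : nbhs v0 [set v | A (sl_retract (Y v))].
  by apply: (cY [set X | A (sl_retract X)]); apply: (cr A); rewrite sl_retract_SL.
have n2 : nbhs v0 [set v | GLset (Y v)].
  by apply: (cY (@GLset R q.+1)); apply: open_nbhs_nbhs; split; [exact: open_GLset|].
apply: filterS (filterI n1 n2) => v [Av Gv] /=.
have [h eh _] := gl_extE f Gv.
have fh : f h = 0 by apply: A0; rewrite eh.
have := phi_ofE q0 h hf; rewrite fh [RHS]mxE eh col0_retract colY.
have v1 : v != 0 by rewrite -(colY v); exact: col0_neq0.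
have d0 : (\det (Y v))^-1 != 0 by rewrite invr_eq0.
by rewrite hp // => /eqP; rewrite mulf_eq0 (negbTE (chi_neq0 a la d0)) => /eqP.
Qed.

End VanishingSection.

(** * The intertwining operator of a symbol *)

Section Operator.
Variables (R : realType) (p d : nat) (a b : bool) (la nu : R[i]) (l m : nat).
Local Notation V := 'cV[R]_p.+2.
Local Notation M := 'M[R]_p.+1.
Local Notation C := R[i].
Local Notation W := 'cV[C]_p.
Local Notation U0 := (@punct R p.+1).
Local Notation GL := (@GLset R p.+1).
Variable vpm : 'M[R]_p -> 'M[C]_d.
Hypothesis rpm : is_rep (@SLpmpred R p) vpm.
Variable T : {linear 'cV[C]_d -> (W -> R[i]^o)}.
Hypothesis injT : injective T.
Hypothesis rangeT : range T = @homog_poly R p l.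
Hypothesis TE : forall g, g \in @SLpmpred R p -> forall v, T (vpm g *m v) = poly_act g (T v).
Hypothesis p0 : (0 < p)%N.
Hypothesis hb : b = a (+) odd (m + l).
Hypothesis hnu : nu = la + (l + m)%:R + l%:R / p%:R.
Hypothesis hbol : l = 0%N \/ la + (l + m)%:R = 1.
Local Notation rep := (sgn_tensor a (fun _ : 'M[R]_p.+1 => 1%:M : 'M[R[i]]_1)).
Local Notation tau := (sgn_tensor b vpm).
Local Notation symb_fun_gen n S := (symb_fun l n S).
Local Notation symb_fun := (symb_fun l m T).
Implicit Types (phi : V -> C).

Lemma symb_fun0 (n : nat) (S : {linear 'cV[C]_d -> (W -> R[i]^o)}) : injective S -> range S = @homog_poly R p l ->
  symb_fun_gen n S (fun=> 0) = 0.
Proof.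
move=> iS rS; apply: iS; rewrite linear0 T_symb_fun //.
apply/funext => y; rewrite /tpoly (tens_ext (b := fun=> 0)) ?tens0 // => w _.
apply: reim_inj => c; rewrite reim_iterDC (_ : (fun v : V => reim c 0) = fun=> 0).
  by rewrite iterD_cst0; case: c.
by apply/funext => v; case: c.
Qed.

Definition germ_op phi (g : SL R p.+1) : 'cV[C]_d := symb_fun (fun v => phi (val (diag1 g) *m v)).

(** The symbol at the retraction of x, expressed at x itself. [sl_retract] changes the first column
    only: the directions stay, and the base point is divided by the determinant, which yields the
    prefactor. *)
Definition coef_op phi (x : M) (w : seq 'I_p) : C :=
  (chi a la (\det x)^-1 * real_complex R (\det x) ^+ (l + m)) *
  iterDC (map (fun j => diag1_mx x *m bmid R j) w ++ nseq m (bmax R p)) phi (base_pt x).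

Lemma retract_bmid (x : M) j : diag1_mx (sl_retract x) *m bmid R j = diag1_mx x *m bmid R j.
Proof.
rewrite /bmid -emb_mid !diag1_mx_bvec; apply: eq_bigr => i _; congr (_ *: _).
by rewrite /sl_retract mul_mx_diag !mxE mulr1.
Qed.

Lemma retract_base (x : M) : base_pt (sl_retract x) = (\det x)^-1 *: base_pt x.
Proof.
rewrite !base_ptE scaler_sumr; apply: eq_bigr => i _; rewrite scalerA; congr (_ *: _).
by rewrite /sl_retract mul_mx_diag !mxE mulrC.
Qed.

Lemma gl_ext_germ_op phi x : isec a la phi -> GL x ->
  gl_ext (germ_op phi) x = Tinv T (tpoly l (coef_op phi x)).
Proof.
move=> ip Gx; have [g eg ->] := gl_extE (germ_op phi) Gx.
rewrite /germ_op /symb_fun; congr Tinv; apply/funext => y; apply: tens_ext => w sw.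
have hA (k : R) (v u : V) : diag1_mx (val g) *m (k *: v + u) = k *: (diag1_mx (val g) *m v) + diag1_mx (val g) *m u.
  by rewrite mulmxDr scalemxAr.
rewrite /symbol (iterDC_linear hA) -/(base_pt (val g)) eg retract_base.
rewrite map_cat map_nseq diag1_mx_bmax -map_comp.
rewrite (eq_map (g := fun j => diag1_mx x *m bmid R j)); last by move=> j /=; exact: retract_bmid.
have d0 : (\det x)^-1 != 0 by rewrite invr_eq0.
rewrite (iterDC_homog _ ip d0 (base_pt_neq0 Gx)) size_cat size_map size_nseq sw.
by rewrite /coef_op fmorphV exprVn invrK.
Qed.

(** The directions depend on x linearly; expanding them one by one in the fixed basis moves the
    entries of x into the coefficients. *)
Lemma rep_moving w (ws : seq 'I_p.+2) c :
  diffop_rep a la (fun phi x => iterD (map (fun j => diag1_mx x *m bmid R j) w ++ map bvec ws)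
    (fun v => reim c (phi v)) (base_pt x)).
Proof.
elim: w ws => [|j w IH] ws; first exact: rep_jet.
apply: (rep_ext (H' := fun phi x => \sum_i x i (rshift 1 j) *
   iterD (map (fun j => diag1_mx x *m bmid R j) w ++ map bvec (emb i :: ws)) (fun v => reim c (phi v)) (base_pt x))).
  move=> phi x ip Gx; have oU := @open_punct R p.+1; have Ux := base_pt_neq0 Gx.
  rewrite [map _ (j :: w)]/= {1}/bmid -emb_mid diag1_mx_bvec.
  rewrite (iterD_sumv [::] _ _ _ _ oU (ip.1 c) Ux); apply: eq_bigr => i _; congr (_ * _).
  by apply: (iterD_perm oU (ip.1 c) Ux); rewrite cat0s perm_sym perm_catC /= perm_cons perm_catC.
by apply: rep_sum => i; apply: repM => //; apply: mx_coord_smooth; exact: open_GL.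
Qed.

Lemma rep_germ_op i c : diffop_rep a la (fun phi x => gl_comp (germ_op phi) i c x).
Proof.
pose t (q : W -> C) := Tinv T q i ord0.
have lt : lin_on_hpoly l t.
  by move=> z q r hq hr; rewrite /t (Tinv_lin injT rangeT _ hq hr) !mxE.
apply: (rep_ext (H' := fun phi x => reim c (t (fun y => tens l (coef_op phi x) (fun i => y i ord0))))).
  by move=> phi x ip Gx; rewrite /gl_comp gl_ext_germ_op.
apply: rep_tens => // w c'.
have oG := @open_GL R p.
have n0 (x : M) : GL x -> (\det x)^-1 != 0 by move=> h; rewrite invr_eq0.
have sd := smooth_inv oG (smooth_det oG) (fun _ h => h).
apply: rep_reim_cmul => [|c2].
  apply: (csmoothM oG (csmooth_chi a la oG sd n0)).
  exact: (csmoothX _ oG (csmooth_real oG (smooth_det oG))).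
apply: rep_ext (rep_moving w (nseq m ord_max) c2) => phi x _ _.
by rewrite reim_iterDC map_nseq.
Qed.

Lemma germ_op_Ind phi : isec a la phi -> germ_op phi \in Ind_pred tau nu.
Proof.
move=> ip; rewrite inE; split=> [i c|g g' h t x hh eg].
  exact: (rep_smooth (rep_germ_op i c) ip).
have ig := isec_act (diag1 g) ip.
rewrite /germ_op -(symb_fun_par rpm injT rangeT TE p0 hb hnu hbol t x ig hh).
congr symb_fun; apply/funext => v.
rewrite /par_act -par_vec -vecE diag1M SL_valM -mulmxA; congr (phi (_ *m _)).
by rewrite [val (diag1 g')]/= eg.
Qed.

Let q0 : (0 < p.+1)%N := ltn0Sn p.

Definition opD (f : Ind rep la) : Ind tau nu :=
  MkInd (germ_op_Ind (isec_phi_of q0 (IndP f))).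

Lemma phi_of_lin c (f f' : Ind rep la) : phi_of (c *: f + f') = fun v => c * phi_of f v + phi_of f' v.
Proof. by apply/funext => v; rewrite /phi_of /= !mxE. Qed.

Lemma opD_linear : linear opD.
Proof.
move=> c f f'; apply/val_inj/funext => g /=.
rewrite /germ_op phi_of_lin.
have i1 := isec_act (diag1 g) (isec_phi_of q0 (IndP f)).
have i2 := isec_act (diag1 g) (isec_phi_of q0 (IndP f')).
by rewrite (symb_fun_lin m injT rangeT c i1 i2).
Qed.

Lemma opD_continuous : Cinfty_continuous opD.
Proof.
move=> K' N' e' cK KG e0.
have hb' (ic : 'I_d * bool) := rep_bound_words cK KG N' (rep_germ_op ic.1 ic.2).
have [Ns hN] := choice hb'; have [Bs hBs] := choice hN.
have Bs0 : 0 <= \sum_ic Bs ic by apply: sumr_ge0 => ic _; case: (hBs ic).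
have B1 : 0 < 1 + \sum_ic Bs ic by rewrite ltr_pwDl.
exists (@diag1_mx R p.+1 @` K'), (\max_ic Ns ic)%N, (e' / (1 + \sum_ic Bs ic)); split.
- exact: compact_K2.
- exact: K2_GL.
- by rewrite divr_gt0.
move=> f; rewrite [Ind_fun f](sec_phi_of q0 (IndP f)) => hf x Kx w sw i c.
have [B0 hB] := hBs (i, c).
have := hB _ _ (isec_phi_of q0 (IndP f)) (Cinfty_le (leq_bigmax (i, c)) hf) x Kx w sw.
move=> /le_lt_trans; apply; rewrite mulrA ltr_pdivrMr // mulrC ltr_pM2l //.
by rewrite (bigD1 (i, c)) //= addrCA ltrDl ltr_pwDl // sumr_ge0 // => k _; case: (hBs k).
Qed.

Lemma opD_support f : @diag1 R p.+1 @` Ind_supp (opD f) `<=` Ind_supp f.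
Proof.
move=> _ [g hg <-] B nB.
move: nB; rewrite nbhsE => -[B' [oO Og] OB].
have [g' [/= Dg Og'] ] := hg _ (diag1_nbhs (open_nbhs_nbhs (conj oO Og))).
apply: contrapT => h0.
(* If f vanished near [diag1 g'], then [phi_of f] would vanish near the corresponding base point,
   and with it all the derivatives in the symbol, against [Dg]. *)
have f0 : nbhs (diag1 g') [set h | Ind_fun f h = 0].
  have := open_nbhs_nbhs (conj oO Og'); apply: filterS => h Oh /=.
  apply: contrapT => /eqP fh; apply: h0; exists h; split=> //; exact: OB.
have n0 := phi_of_near0 q0 (IndP f) f0.
move/eqP: Dg; apply; rewrite /= /germ_op -(@symb_fun0 m T injT rangeT).
have cA : (fun v : V => val (diag1 g') *m v) @ e0 R p --> (val (diag1 g') *m e0 R p : V).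
  have h : continuous (fun v : V => val (diag1 g') *m v : V).
    by apply: linear_mx_continuous => k u v; rewrite mulmxDr scalemxAr.
  exact: h.
rewrite -/(base_pt (val g')) base_pt_col in cA.
have n1 : nbhs (e0 R p) [set v | phi_of f (val (diag1 g') *m v) = 0] := cA _ n0.
congr Tinv; apply/funext => y; apply: tens_ext => w _; apply: reim_inj => c.
rewrite !reim_iterDC; apply: (nbhs_singleton (iterD_near _ _)).
by apply: filterS n1 => v /= ->.
Qed.

Lemma opD_intertwining : intertwining opD.
Proof.
move=> g f; apply/val_inj/funext => x.
rewrite -[LHS]/(symb_fun (fun v => phi_of (Ind_action (diag1 g) f) (val (diag1 x) *m v))).
rewrite -[RHS]/(symb_fun (fun v => phi_of f (val (diag1 (g^-1 * x)%g) *m v))).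
apply: eq_symb_fun => v v0.
have u0 := mulmx_SL_neq0 (diag1 x) v0.
have [k ek] := exists_SL_col0 q0 u0.
have hf := IndP f; have hg := IndP (Ind_action (diag1 g) f).
have -> : val (diag1 (g^-1 * x)%g) *m v = col ord0 (val ((diag1 g)^-1 * k)%g).
  by rewrite diag1M diag1V !SL_valM -mulmxA -ek !colE mulmxA.
by rewrite -ek (phi_ofE q0 k hg) (phi_ofE q0 _ hf).
Qed.

Lemma opD_Diff : Diff (la := la) (nu := nu) opD.
Proof.
split; last exact: opD_intertwining.
by split; [exact: opD_linear|exact: opD_continuous|exact: opD_support].
Qed.

Lemma lift_mid (j : 'I_p) : exists k : 'I_p.+1, mid j = lift ord0 k.
Proof.
have h : ord0 != mid j by rewrite eq_sym mid_neq0.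
by have [k e _] := unlift_some h; exists k.
Qed.

Lemma lift_max : exists k : 'I_p.+1, ord_max = lift ord0 k :> 'I_p.+2.
Proof.
have h : ord0 != ord_max :> 'I_p.+2 by rewrite eq_sym ord_max_neq0.
by have [k e _] := unlift_some h; exists k.
Qed.

Lemma tens_delta n (I : finType) (c : seq I -> C) j : tens n c (fun i => (i == j)%:R) = c (nseq n j).
Proof.
elim: n c => [//|n IH] c /=.
rewrite (bigD1 j) //= eqxx mul1r IH big1 ?addr0 // => i /negbTE ->.
by rewrite mul0r.
Qed.

Lemma opD_neq0 : exists f, opD f <> 0.
Proof.
pose j0 : 'I_p := Ordinal p0.
have [k0 ek0] := lift_mid j0; have [k1 ek1] := lift_max.
pose w0 := nseq l k0 ++ nseq m k1.
(* The indicator of the rearrangements of [w0] is symmetric, so the derivative of the test section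
   along [w0] is (l + m)! and not 0. *)
pose bb (w : seq 'I_p.+1) : C := (perm_eq w w0)%:R.
have hf := hfun_upoly (l + m) bb.
pose phi := tst a la (l + m) (upoly (l + m) bb).
have ip : isec a la phi := isec_tst a la hf.
have sj : symm (fun w => reim false (bb w)).
  by move=> w w' /permPl e; rewrite /bb /perm_eq; congr (reim false _%:R); rewrite -!/(perm_eq _ _) e.
have ew : map (@bmid R p) (nseq l j0) ++ nseq m (bmax R p) = map (@edir R p) w0.
  by rewrite /w0 map_cat !map_nseq /bmid /bmax /edir ek0 ek1.
have s0 : symbol m phi (nseq l j0) != 0.
  rewrite /symbol ew; apply/eqP => /(congr1 (reim false)); rewrite reim_iterDC iterD_tst //.
  rewrite (_ : (fun v => reim false (upoly (l + m) bb v)) =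
      fun v => tens (l + m) (fun w => reim false (bb w)) (ucoord v)); last first.
    by apply/funext => v; rewrite /upoly reim_tens.
  rewrite jet_tens // size_cat !size_nseq eqxx /bb perm_refl /= mulr1 => /eqP.
  by rewrite pnatr_eq0 gtn_eqF ?fact_gt0.
exists (toInd ip) => D0.
have e1 : symb_fun phi = 0.
  transitivity (germ_op (phi_of (sec phi)) 1%g); last first.
    exact: (congr1 (fun F : Ind tau nu => F 1%g) D0).
  apply: esym; apply: eq_symb_fun => v v0; rewrite diag11 mul1mx.
  have [k <-] := exists_SL_col0 q0 v0.
  by rewrite (phi_ofE q0 k (sec_Ind ip)) mxE.
have := T_symb_fun m rangeT phi; rewrite e1 linear0 => /(congr1 (fun f => f (cx (delta_mx j0 ord0)))) /esym /eqP.
have ed : (fun i => cx (delta_mx j0 ord0 : 'cV[R]_p) i ord0) =1 (fun i => (i == j0)%:R : C).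
  by move=> i; rewrite cxE mxE andbT rmorph_nat.
by rewrite /tpoly (eq_tens _ _ ed) tens_delta (negbTE s0).
Qed.

End Operator.

(** * The classification *)

Section MainTheorem.
Variable R : realType.

Lemma is_triv_poly0 k d (S : {pred 'M[R]_k}) (rho : 'M[R]_k -> 'M[R[i]]_d) :
  is_triv S rho <-> is_poly 0 S rho.
Proof.
split=> -[T [iT rT eT]].
  pose f v : 'cV[R[i]]_k -> R[i]^o := fun _ => T v.
  have lf : linear f by move=> c u v; apply/funext => y; rewrite /f linearP.
  pose F : {linear 'cV[R[i]]_d -> ('cV[R[i]]_k -> R[i]^o)} :=
    HB.pack f (GRing.isLinear.Build _ _ _ _ f lf).
  exists F; split=> /=.
  - by move=> u v /(congr1 (fun h => h 0)) /iT.
  - apply/seteqP; split=> [_ [v _ <-]|q /homog_polyE[c ->]].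
      by apply/homog_polyE; exists (T v).
    have : range T c by rewrite rT.
    by move=> [v _ ev]; exists v => //; apply/funext => y; rewrite /f ev.
  - by move=> g hg v; apply/funext => y; rewrite /f eT.
have hT v : exists c, T v = fun=> c.
  have /homog_polyE[c ec] : @homog_poly R k 0 (T v) by rewrite -rT; exists v.
  by exists c.
pose f v : R[i]^o := T v 0.
have lf : linear f by move=> c u v; rewrite /f linearP.
have fE v y : T v y = f v by rewrite /f; have [c ->] := hT v.
pose F : {linear 'cV[R[i]]_d -> R[i]^o} := HB.pack f (GRing.isLinear.Build _ _ _ _ f lf).
exists F; split=> /=.
- by move=> u v e; apply: iT; apply/funext => y; rewrite !fE.
- apply/seteqP; split=> // c _.
  have : range T (fun=> c) by rewrite rT; apply/homog_polyE; exists c.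
  by move=> [v _ ev]; exists v; rewrite // /f ev.
- by move=> g hg v; rewrite /f eT // /poly_act !fE.
Qed.

(** Lambda_1 is the case l = 0, where poly^0 is trivial and la is free. In this common form the
    conditions are both derived and used. *)
Lemma Lambda_unified p d (a b : bool) (varpi : 'M[R]_p -> 'M[R[i]]_d) (la nu : R[i]) :
  Lambda1 a b varpi la nu \/ Lambda2 a b varpi la nu <->
  exists l m, [/\ b = a (+) odd (m + l), is_poly l (@SLpred R p) varpi,
    nu = la + (l + m)%:R + l%:R / p%:R & l = 0%N \/ la + (l + m)%:R = 1].
Proof.
split=> [[[m [hb hv hn]]|[l [m [hb hv hl hn]]]]|[l [m [hb hv hn]]]].
- exists 0%N, m; split; [by rewrite addn0|exact/is_triv_poly0| |by left].
  by rewrite add0n mul0r addr0.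
- exists l, m; have e : la + (l + m)%:R = 1 by rewrite hl addnC subrK.
  by split=> //; [rewrite e|right].
- case=> [l0|e]; [left; exists m|right; exists l, m].
    move: hb hv hn; rewrite l0 addn0 add0n mul0r addr0 => hb hv hn.
    by split=> //; exact/is_triv_poly0.
  split=> //; last by rewrite hn e.
  by apply/eqP; rewrite eq_sym subr_eq (addnC m) e.
Qed.

Section Fixed.
Variables (r d : nat) (a b : bool) (varpi vpm : 'M[R]_r.+2 -> 'M[R[i]]_d) (la nu : R[i]).
Hypothesis rv : is_rep (@SLpred R r.+2) varpi.
Hypothesis iv : irreducible (@SLpred R r.+2) varpi.
Hypothesis ext : extends_to_SLpm varpi vpm.
Local Notation rep := (sgn_tensor a (fun _ : 'M[R]_r.+3 => 1%:M : 'M[R[i]]_1)).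
Local Notation tau := (sgn_tensor b vpm).
Local Notation DD := (@Diff R r.+2 1 d rep la tau nu).
Local Notation V := 'cV[R]_r.+4.
Implicit Types D : Ind rep la -> Ind tau nu.

(** With p = n - 1 = r + 2 there are two distinct indices, as the torus and the reflection
    require. *)
Let j0 : 'I_r.+2 := ord0.
Let j1 : 'I_r.+2 := ord_max.
Let j01 : j0 != j1. Proof. by []. Qed.
Let p0 : (0 < r.+2)%N. Proof. by []. Qed.
Let q0 : (0 < r.+3)%N. Proof. by []. Qed.

Lemma Diff_germ D f g : DD D ->
  Ind_fun (D f) g = Lam D (fun v => phi_of f (val (diag1 g) *m v)).
Proof.
move=> [dD iD]; rewrite (Lam_act iD g (isec_phi_of q0 (IndP f))).
by congr (Ind_fun (D _) g); apply/val_inj; rewrite /= -(sec_phi_of q0 (IndP f)).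
Qed.

Lemma Diff_neq0 D : DD D -> D <> 0 -> exists2 phi : V -> R[i], isec a la phi & Lam D phi <> 0.
Proof.
move=> hD D0; apply: contrapT => h; apply: D0; apply/funext => f; apply/val_inj/funext => g.
transitivity (0 : 'cV[R[i]]_d); last by [].
rewrite -[LHS]/(Ind_fun (D f) g) (Diff_germ f g hD); apply: contrapT => hg; apply: h.
exists (fun v => phi_of f (val (diag1 g) *m v)) => //.
exact: (isec_act (diag1 g) (isec_phi_of q0 (IndP f))).
Qed.

Lemma Diff_covariant D : DD D -> covariant a la tau nu (Lam D).
Proof. by move=> [dD iD]; exact: covariant_Lam. Qed.

Lemma Diff_proportional D D' : DD D -> D <> 0 -> DD D' -> exists c : R[i], D' = c *: D.
Proof.
move=> hD D0 hD'; have [phi ip L0] := Diff_neq0 hD D0.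
have [c hc] := cov_unique rv iv (sgn_tensor_SL b ext) j01 (Diff_covariant hD) (Diff_covariant hD') ip L0.
exists c; apply/funext => f; apply/val_inj/funext => g.
rewrite -[LHS]/(Ind_fun (D' f) g) (Diff_germ f g hD') hc; last exact: (isec_act (diag1 g) (isec_phi_of q0 (IndP f))).
by rewrite -(Diff_germ f g hD).
Qed.

Lemma Diff_necessary D : DD D -> D <> 0 -> Lambda1 a b varpi la nu \/ Lambda2 a b varpi la nu.
Proof.
move=> hD D0; have [phi ip L0] := Diff_neq0 hD D0; have cL := Diff_covariant hD.
have tauE := sgn_tensor_SL b ext.
have [l [m aL]] := active_exists cL ip L0.
apply/Lambda_unified; exists l, m; split.
- exact: (active_parity rv iv ext j01 cL aL).
- exact: (active_poly rv iv tauE j0 cL aL).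
- exact: (active_nu rv tauE j0 cL aL).
- case: (posnP l) => [->|l0]; [by left|right].
  exact: (active_shift rv iv tauE j01 cL aL l0).
Qed.

Lemma Diff_sufficient : Lambda1 a b varpi la nu \/ Lambda2 a b varpi la nu ->
  exists2 D, DD D & D <> 0.
Proof.
move=> /Lambda_unified[l [m [hb hv hn hl]]].
have [rpm _ _ /(_ l hv)[T [iT rT eT]]] := ext.
exists (opD rpm iT rT eT p0 hb hn hl); first exact: opD_Diff.
move=> D0; have [f] := opD_neq0 rpm iT rT eT p0 hb hn hl.
by rewrite D0.
Qed.

Lemma Diff0 : DD 0.
Proof.
split; last by move=> g f; apply/val_inj/funext.
split; first by move=> c f f'; rewrite scaler0 addr0.
- move=> K' N' e' _ _ e0; exists set0, 0%N, 1; split=> //; first exact: compact0.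
  move=> f _ x _ w _ i c; rewrite (_ : gl_comp _ i c = fun=> 0) ?iterD_cst0 ?normr0 //.
  by apply/funext => y; rewrite /gl_comp /gl_ext; case: insub => [g|]; rewrite mxE; case: c.
- move=> f _ [g hg <-]; have [h []] := hg setT filterT.
  by rewrite /= eqxx.
Qed.

Lemma has_dim1P : has_dim DD 1 <-> exists2 D, DD D & D <> 0.
Proof.
split=> [[B [SB hB]]|[D hD D0]].
  (* If the basis vector were 0, the coordinate vectors 0 and 1 would represent the same element. *)
  exists (B ord0) => // B0; have [c [_ uc]] := hB _ (SB ord0).
  have e (c' : 'rV[R[i]]_1) : B ord0 = \sum_i c' ord0 i *: B i by rewrite big_ord1 B0 scaler0.
  have := uc 0 (e _); rewrite (uc (const_mx 1) (e _)) => /matrixP/(_ ord0 ord0) /eqP.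
  by rewrite !mxE oner_eq0.
exists (fun=> D); split=> // D' hD'; have [c ec] := Diff_proportional hD D0 hD'.
exists (const_mx c); split; first by rewrite big_ord1 mxE.
move=> c'; rewrite big_ord1 ec => e; apply/rowP => i; rewrite (ord1 i) mxE.
move: e => /eqP; rewrite -subr_eq0 -scalerBl => /eqP e.
apply/eqP; rewrite -subr_eq0; apply: contrapT => /negP cc; apply: D0.
have := congr1 (GRing.scale (c - c' ord0 ord0)^-1) e.
by rewrite scalerA mulVf // scale1r scaler0.
Qed.

Lemma Diff_neq_set0 : DD <> [set 0] <-> exists2 D, DD D & D <> 0.
Proof.
split=> [h|[D hD D0] e]; last by apply: D0; have : [set 0] D by rewrite -e.
apply: contrapT => h0; apply: h; apply/seteqP; split=> [D hD|D ->]; last exact: Diff0.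
by apply: contrapT => D0; apply: h0; exists D.
Qed.

End Fixed.
End MainTheorem.

Theorem theorem4p10 (R : realType) (n : nat) (hn : (3 <= n)%N)
    (alpha beta : bool) (d : nat) (varpi varpi_pm : 'M[R]_n.-1 -> 'M[R[i]]_d)
    (lambda nu : R[i]) :
  is_rep (@SLpred R n.-1) varpi ->
  irreducible (@SLpred R n.-1) varpi ->
  extends_to_SLpm varpi varpi_pm ->
  (Diff_triv alpha beta varpi_pm lambda nu <> [set 0] <->
   has_dim (Diff_triv alpha beta varpi_pm lambda nu) 1) /\
  (has_dim (Diff_triv alpha beta varpi_pm lambda nu) 1 <->
   Lambda1 alpha beta varpi lambda nu \/ Lambda2 alpha beta varpi lambda nu).
Proof.
case: n hn varpi varpi_pm => [|[|[|r]]] // _ varpi varpi_pm rv iv ext.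
have h1 := has_dim1P alpha beta lambda nu rv iv ext.
have h2 := @Diff_neq_set0 R r d alpha beta varpi_pm lambda nu.
split; first by rewrite /Diff_triv; split=> [/h2 /h1|/h1 /h2].
split=> [/h1[D hD D0]|h]; first exact: (Diff_necessary rv iv ext hD D0).
by apply/h1; exact: (Diff_sufficient ext h).
Qed.
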